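(* Let $H$ be a finite-dimensional factorizable ribbon Hopf algebra over $\mathbb{C}$ and let $g,n\ge0$. 1) An element $x\in\mathcal{L}_{g,n}(H)$ is invariant under the action of $H$ (i.e. $x\cdot h=\varepsilon(h)x$ for all $h\in H$) if, and only if, for every finite-dimensional $H$-module $I$, $\overset{I}{C}_{g,n}\,x=x\,\overset{I}{C}_{g,n}$. 2) Let $V$ be a representation of $\mathcal{L}_{g,n}(H)$, with action denoted $\triangleright$, and let $\mathrm{Inv}(V)=\{w\in V:\ \overset{I}{C}_{g,n}\triangleright w=\mathbb{I}_{\dim(I)}\,w\ \text{ for all }I\}$. Then $\mathrm{Inv}(V)$ is stable under the action of invariant elements and thus provides a representation of the subalgebra of invariants $\mathcal{L}^{\mathrm{inv}}_{g,n}(H)$.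
   Context: **Hopf algebra.** $H$ has coproduct $\Delta(x)=x'\otimes x''$, counit $\varepsilon$, antipode $S$, universal $R$-matrix $R=a_i\otimes b_i$ (implicit summation), $R'=b_i\otimes a_i$, and ribbon element $v$: $v$ is central invertible, $v^2=uS(u)$ with $u=S(b_i)a_i$, $\Delta(v)=(R'R)^{-1}(v\otimes v)$, $S(v)=v$. Factorizable means that $H^*\to H$, $\varphi\mapsto(\varphi\otimes\mathrm{id})(RR')$ is bijective. All modules are finite-dimensional. **Matrices.** For an $H$-module $I$ (with a chosen basis), $\overset{I}{x}$ is the matrix of $x\in H$ acting on $I$, and $\overset{I}{T}$ is the matrix with entries in $H^*$ such that $\overset{I}{T}(x)=\overset{I}{x}$; the entries of all $\overset{I}{T}$ span $H^*$. For matrices $M,N$ over an algebra, $M_1$ and $N_2$ denote $M$ and $N$ acting on the first and second factor of $\mathrm{Mat}_m(\mathbb{C})\otimes\mathrm{Mat}_{n}(\mathbb{C})$, so $(M_1N_2)^{ik}_{jl}=M^i_jN^k_l$. $\overset{IJ}{X}_{12}$ is the action of $X\in H\otimes H$ on $I\otimes J$. $\mathbb{I}_k$ is the identity matrix of size $k$. Products such as $\overset{I}{C}x$ and actions $\overset{I}{C}\triangleright w$ are entrywise. **The algebra.** $\mathcal{L}_{g,n}(H)$ is the associative unital algebra generated by $2g+n$ copies of the vector space $H^*$; the images of $\overset{I}{T}$ in these copies are the matrices $\overset{I}{A}(i),\overset{I}{B}(i)$ ($1\le i\le g$) and $\overset{I}{M}(i)$ ($g+1\le i\le g+n$), equal to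 $1$ for $I$ the trivial module. With $U(i),V(i)$ standing for $A(i)$ or $B(i)$ if $i\le g$ and for $M(i)$ if $i>g$, the relations are, for all $I,J$: $\overset{I\otimes J}{U}(i)_{12}=\overset{I}{U}(i)_1\overset{IJ}{R'}_{12}\overset{J}{U}(i)_2(\overset{IJ}{R'})_{12}^{-1}$ for all $i$; $\overset{IJ}{R}_{12}\overset{I}{U}(i)_1\overset{IJ}{R}{}_{12}^{-1}\overset{J}{V}(j)_2=\overset{J}{V}(j)_2\overset{IJ}{R}_{12}\overset{I}{U}(i)_1\overset{IJ}{R}{}_{12}^{-1}$ for $i<j$; $\overset{IJ}{R}_{12}\overset{I}{B}(i)_1\overset{IJ}{R'}_{12}\overset{J}{A}(i)_2=\overset{J}{A}(i)_2\overset{IJ}{R}_{12}\overset{I}{B}(i)_1\overset{IJ}{R}{}_{12}^{-1}$ for $i\le g$. All these matrices are invertible. $\mathcal{L}_{g,n}(H)$ is a right $H$-module-algebra by $\overset{I}{U}(i)\cdot h=\overset{I}{h'}\,\overset{I}{U}(i)\,\overset{I}{S(h'')}$; $\mathcal{L}^{\mathrm{inv}}_{g,n}(H)=\{x:x\cdot h=\varepsilon(h)x\ \forall h\in H\}$. (Equivalently, invariance means $\Omega(x)=1\otimes x$ for the corresponding left coaction $\Omega$ of the dual Hopf algebra $\mathcal{O}(H)$.) **The matrices $C_{g,n}$.** $\overset{I}{C}(i)=\overset{I}{v}{}^2\overset{I}{B}(i)\overset{I}{A}(i)^{-1}\overset{I}{B}(i)^{-1}\overset{I}{A}(i)$ for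 $1\le i\le g$ and $\overset{I}{C}_{g,n}=\overset{I}{C}(1)\cdots\overset{I}{C}(g)\,\overset{I}{M}(g+1)\cdots\overset{I}{M}(g+n)$. *)

(* Defs.v *)
From HB Require Import structures.
From mathcomp Require Import all_boot all_order all_algebra all_field.
From mathcomp Require Import mxtens.
From mathcomp Require Import boolp classical_sets.

Set Implicit Arguments.
Unset Strict Implicit.
Unset Printing Implicit Defensive.

Import GRing.Theory.
Local Open Scope ring_scope.

(* Tensor product of finite-dimensional spaces, by coordinates in the chosen
   bases: X i j is the coefficient of e_i ⊗ f_j. *)
Definition tens (K : fieldType) (A B : vectType K) : Type :=
  'M[K]_(\dim {:A}, \dim {:B}).

HB.instance Definition _ (K : fieldType) (A B : vectType K) :=
  Vector.copy (tens A B) 'M[K]_(\dim {:A}, \dim {:B}).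

Notation "A ⊗ B" := (tens A B) (at level 40, left associativity) : type_scope.

Definition ten (K : fieldType) (A B : vectType K) (a : A) (b : B) : tens A B :=
  \matrix_(i, j) (coord (vbasis {:A}) i a * coord (vbasis {:B}) j b).

Notation "a ⊗ b" := (ten a b) (at level 40, left associativity) : ring_scope.

(* The linear map on A ⊗ B induced by a bilinear f. The notation is Sweedler's
   implicit summation: X = a ⊗ b, summed over the decomposition of X. *)
Definition tlift (K : fieldType) (A B : vectType K) (V : lmodType K)
    (f : A -> B -> V) (X : tens A B) : V :=
  \sum_i \sum_j (X : 'M[K]_(\dim {:A}, \dim {:B})) i j
                 *: f (vbasis {:A})`_i (vbasis {:B})`_j.

Notation "\sw_ ( a , b <- X ) F" := (tlift (fun a b => F) X)
  (at level 41, F at level 41, X at level 200,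
   format "\sw_ ( a ,  b  <-  X )  F") : ring_scope.

Definition bilin (K : fieldType) (A B V : lmodType K) (f : A -> B -> V) :=
  (forall b, linear (f^~ b)) /\ (forall a, linear (f a)).

Lemma coord_vb (K : fieldType) (U : vectType K) (k l : 'I_(\dim {:U})) :
  coord (vbasis {:U}) k (vbasis {:U})`_l = (k == l)%:R.
Proof. by rewrite coord_free ?(basis_free (vbasisP _)) // eq_sym. Qed.

Section TensTheory.
Variables (K : fieldType) (A B : vectType K).
Implicit Types (a : A) (b : B) (V : lmodType K).

Lemma bilin_ten : bilin (@ten K A B).
Proof.
split=> x c u v; apply/matrixP=> i j; rewrite !mxE linearP.
  by rewrite mulrDl mulrA.
by rewrite mulrDr mulrCA.
Qed.

Lemma tlift_is_linear V (f : A -> B -> V) : linear (tlift f).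
Proof.
move=> c X Y; rewrite /tlift scaler_sumr -big_split; apply: eq_bigr => i _ /=.
rewrite scaler_sumr -big_split; apply: eq_bigr => j _ /=.
by rewrite !mxE scalerDl scalerA.
Qed.

HB.instance Definition _ V (f : A -> B -> V) :=
  GRing.isLinear.Build K (tens A B) V _ (tlift f) (tlift_is_linear f).

Lemma tens_sumE (X : tens A B) : X = \sw_(a, b <- X) (a ⊗ b).
Proof.
apply/matrixP=> i j; rewrite /tlift.
have ce := coord_vb.
rewrite summxE (bigD1 i) //= summxE (bigD1 j) //=.
rewrite !mxE !ce !eqxx !mulr1 !big1 ?addr0 // => [k nk|k nk].
  rewrite summxE big1 // => l _.
  by rewrite !mxE !ce [i == k]eq_sym (negPf nk) mul0r mulr0.
by rewrite !mxE !ce [j == k]eq_sym (negPf nk) !mulr0.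
Qed.

Lemma tlift_ten V (f : A -> B -> V) a b : bilin f -> tlift f (a ⊗ b) = f a b.
Proof.
case=> f1 f2; pose e := vbasis {:A}; pose e' := vbasis {:B}.
pose F1 b' := GRing.isLinear.Build K A V _ (f^~ b') (f1 b').
pose L1 b' : {linear A -> V} := HB.pack (f^~ b') (F1 b').
pose F2 a' := GRing.isLinear.Build K B V _ (f a') (f2 a').
pose L2 a' : {linear B -> V} := HB.pack (f a') (F2 a').
rewrite {2}(coord_vbasis (memvf a)) {2}(coord_vbasis (memvf b)).
rewrite -[f _ _]/(L1 _ _) linear_sum; apply: eq_bigr => i _.
rewrite linearZ /= -[f _ _]/(L2 _ _) linear_sum scaler_sumr.
by apply: eq_bigr => j _; rewrite linearZ scalerA mxE.
Qed.

Lemma tens_ind (P : tens A B -> Prop) :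
  P 0 -> (forall a b, P (a ⊗ b)) -> (forall X Y, P X -> P Y -> P (X + Y)) ->
  forall X, P X.
Proof.
move=> P0 Pt PD X; rewrite [X]tens_sumE /tlift.
apply: (big_ind P) => // i _; apply: (big_ind P) => // j _.
have [lt _] := bilin_ten.
suff -> : forall c a b, c *: (a ⊗ b) = (c *: a) ⊗ b by [].
by move=> c a b; apply/matrixP=> k l; rewrite !mxE linearZ /= mulrA.
Qed.

Lemma tlift_eq V (f f' : A -> B -> V) : (forall a b, f a b = f' a b) ->
  tlift f =1 tlift f'.
Proof.
by move=> ff' X; apply: eq_bigr => i _; apply: eq_bigr => j _; rewrite ff'.
Qed.

Lemma tlift_lin V V' (L : V -> V') (f : A -> B -> V) X :
  linear L -> L (tlift f X) = tlift (fun a b => L (f a b)) X.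
Proof.
move=> hL; pose F := GRing.isLinear.Build K V V' _ L hL.
pose LL : {linear V -> V'} := HB.pack L F.
rewrite -[L _]/(LL _) linear_sum; apply: eq_bigr => i _.
by rewrite linear_sum; apply: eq_bigr => j _; rewrite linearZ.
Qed.

End TensTheory.

Arguments tlift_lin {K A B V V'} L f X _.

Lemma tlift_comb (K : fieldType) (A B : vectType K) (V : lmodType K)
    (f f' : A -> B -> V) c X :
  tlift (fun a b => c *: f a b + f' a b) X = c *: tlift f X + tlift f' X.
Proof.
rewrite /tlift scaler_sumr -big_split; apply: eq_bigr => i _ /=.
rewrite scaler_sumr -big_split; apply: eq_bigr => j _ /=.
by rewrite scalerDr !scalerA mulrC.
Qed.

Section TensAlg.
Variables (K : fieldType) (A B : falgType K).

Lemma ten_linl c (a a' : A) (b : B) :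
  (c *: a + a') ⊗ b = c *: (a ⊗ b) + a' ⊗ b.
Proof. by case: (bilin_ten A B) => -> _. Qed.

Lemma ten_linr c (a : A) (b b' : B) :
  a ⊗ (c *: b + b') = c *: (a ⊗ b) + a ⊗ b'.
Proof. by case: (bilin_ten A B) => _ ->. Qed.

Definition tmul (X Y : A ⊗ B) : A ⊗ B :=
  \sw_(a, b <- X) \sw_(c, d <- Y) ((a * c) ⊗ (b * d)).

Lemma tmul_is_linearl Y : linear (tmul^~ Y).
Proof. by move=> c X X'; rewrite /tmul linearP. Qed.

Lemma tmul_is_linearr X : linear (tmul X).
Proof.
move=> c Y Y'; rewrite /tmul -tlift_comb; apply: tlift_eq => a b.
by rewrite linearP.
Qed.

Lemma tmul_ten a b c d : tmul (a ⊗ b) (c ⊗ d) = (a * c) ⊗ (b * d).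
Proof.
rewrite /tmul tlift_ten ?tlift_ten //; split=> x k u v.
- by rewrite -scalerAr -mulrDr ten_linl || rewrite mulrDr -scalerAr ten_linl.
- by rewrite mulrDr -scalerAr ten_linr.
- by rewrite -tlift_comb; apply: tlift_eq => *; rewrite mulrDl -scalerAl ten_linl.
- by rewrite -tlift_comb; apply: tlift_eq => *; rewrite mulrDl -scalerAl ten_linr.
Qed.

Lemma tmulDl : left_distributive tmul +%R.
Proof.
by move=> X Y Z; have := tmul_is_linearl Z 1 X Y; rewrite !scale1r.
Qed.

Lemma tmulDr : right_distributive tmul +%R.
Proof.
by move=> X Y Z; have := tmul_is_linearr X 1 Y Z; rewrite !scale1r.
Qed.

Lemma tmul0l X : tmul 0 X = 0.
Proof. by apply: (addIr (tmul 0 X)); rewrite -tmulDl !add0r. Qed.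

Lemma tmul0r X : tmul X 0 = 0.
Proof. by apply: (addIr (tmul X 0)); rewrite -tmulDr !add0r. Qed.

Lemma tmulA : associative tmul.
Proof.
move=> X Y Z; elim/tens_ind: X => [|a b|X X' eX eX']; first by rewrite !tmul0l.
  elim/tens_ind: Y => [|c d|Y Y' eY eY'].
  - by rewrite !(tmul0r, tmul0l).
  - elim/tens_ind: Z => [|e f|Z Z' eZ eZ']; first by rewrite !tmul0r.
      by rewrite !tmul_ten !mulrA.
    by rewrite !tmulDr eZ eZ'.
  - by rewrite !(tmulDl, tmulDr) eY eY'.
by rewrite !tmulDl eX eX'.
Qed.

Lemma tmul1l : left_id (1 ⊗ 1) tmul.
Proof.
by elim/tens_ind=> [|a b|X X' eX eX'];
  rewrite ?tmul0r ?tmul_ten ?mul1r ?tmulDr ?eX ?eX'.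
Qed.

Lemma tmul1r : right_id (1 ⊗ 1) tmul.
Proof.
by elim/tens_ind=> [|a b|X X' eX eX'];
  rewrite ?tmul0l ?tmul_ten ?mulr1 ?tmulDl ?eX ?eX'.
Qed.

Lemma tens1_neq0 : (1 : A) ⊗ (1 : B) != 0.
Proof.
have cn0 (C : falgType K) : exists i, coord (vbasis {:C}) i 1 != 0.
  apply/existsP; apply: contraT; rewrite negb_exists => /forallP c0.
  case/eqP: (oner_neq0 C); rewrite (coord_vbasis (memvf 1)) big1 // => i _.
  by move/eqP: (negbNE (c0 i)) => ->; rewrite scale0r.
have [i ci] := cn0 A; have [j cj] := cn0 B.
apply/eqP => /matrixP/(_ i j)/eqP; rewrite !mxE mulf_eq0.
by rewrite (negPf ci) (negPf cj).
Qed.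

HB.instance Definition _ := GRing.Zmodule_isNzRing.Build (tens A B)
  tmulA tmul1l tmul1r tmulDl tmulDr tens1_neq0.

Fact tens_scalerAl c (X Y : A ⊗ B) : c *: (X * Y) = (c *: X) * Y.
Proof.
by rewrite -[c *: X]addr0 [RHS]tmul_is_linearl tmul0l addr0.
Qed.

Fact tens_scalerAr c (X Y : A ⊗ B) : c *: (X * Y) = X * (c *: Y).
Proof.
by rewrite -[c *: Y]addr0 [RHS]tmul_is_linearr tmul0r addr0.
Qed.

HB.instance Definition _ := GRing.Lmodule_isLalgebra.Build K (tens A B)
  tens_scalerAl.
HB.instance Definition _ := GRing.Lalgebra_isAlgebra.Build K (tens A B)
  tens_scalerAr.
HB.instance Definition _ := Algebra_isFalgebra.Build K (tens A B).

Lemma ten_mul (a c : A) (b d : B) :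
  (a ⊗ b) * (c ⊗ d) = (a * c) ⊗ (b * d) :> A ⊗ B.
Proof. exact: tmul_ten. Qed.

Lemma ten_one : 1 = 1 ⊗ 1 :> A ⊗ B. Proof. by []. Qed.

End TensAlg.

Record hopfAlgType (K : fieldType) := HopfAlg {
  hopf_car :> falgType K;
  coprod : {lrmorphism hopf_car -> (hopf_car ⊗ hopf_car)%type};
  counit : {lrmorphism hopf_car -> K | *%R};
  antipode : {linear hopf_car -> hopf_car};
  coprodA : forall x,
    \sw_(a, b <- coprod x) \sw_(c, d <- coprod a) (c ⊗ (d ⊗ b))
      = \sw_(a, b <- coprod x) (a ⊗ coprod b);
  counitl : forall x, \sw_(a, b <- coprod x) (counit a *: b) = x;
  counitr : forall x, \sw_(a, b <- coprod x) (counit b *: a) = x;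
  antipodel : forall x, \sw_(a, b <- coprod x) (antipode a * b) = counit x *: 1;
  antipoder : forall x, \sw_(a, b <- coprod x) (a * antipode b) = counit x *: 1
}.

Definition tswap (K : fieldType) (A B : vectType K) (X : tens A B) : tens B A :=
  \sw_(a, b <- X) (b ⊗ a).

Record ribbonHopf (K : fieldType) := RibbonHopf {
  rib_hopf :> hopfAlgType K;
  rmat : tens rib_hopf rib_hopf;
  rmat_unit : rmat \is a GRing.unit;
  rmat_coprod : forall x,
    rmat * coprod rib_hopf x = tswap (coprod rib_hopf x) * rmat;
  rmat_coprodl :
    \sw_(a, b <- rmat) (coprod rib_hopf a ⊗ b)
      = (\sw_(a, b <- rmat) ((a ⊗ 1) ⊗ b)) * (\sw_(a, b <- rmat) ((1 ⊗ a) ⊗ b));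
  rmat_coprodr :
    \sw_(a, b <- rmat) (a ⊗ coprod rib_hopf b)
      = (\sw_(a, b <- rmat) (a ⊗ (1 ⊗ b))) * (\sw_(a, b <- rmat) (a ⊗ (b ⊗ 1)));
  ribbon : rib_hopf;
  ribbon_unit : ribbon \is a GRing.unit;
  ribbon_central : forall x, ribbon * x = x * ribbon;
  ribbon_sq : let u := \sw_(a, b <- rmat) (antipode rib_hopf b * a) in
    ribbon ^+ 2 = u * antipode rib_hopf u;
  ribbon_coprod :
    coprod rib_hopf ribbon = (tswap rmat * rmat)^-1 * (ribbon ⊗ ribbon);
  ribbon_antipode : antipode rib_hopf ribbon = ribbon
}.

Definition dualv (K : fieldType) (H : vectType K) : vectType K := 'Hom(H, K^o).

Definition factorizable (K : fieldType) (H : ribbonHopf K) : Prop :=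
  bijective (fun phi : dualv H =>
    \sw_(a, b <- rmat H * tswap (rmat H)) ((phi a : K) *: b)).

(* A finite-dimensional H-module with a chosen basis: hact x is the matrix of x. *)
Record hmod (K : fieldType) (H : falgType K) := HMod {
  hdim : nat;
  hact :> {lrmorphism H -> 'M[K]_hdim}
}.

Section Modules.
Variables (K : fieldType) (H : hopfAlgType K).
Implicit Types I J : hmod H.

(* the action of X \in H ⊗ H on I ⊗ J *)
Definition tact I J (X : tens H H) : 'M[K]_(hdim I * hdim J) :=
  \sw_(a, b <- X) (I a *t J b).

Lemma bilin_tact I J : bilin (fun a b => I a *t J b).
Proof.
split=> [b|a] c u v; apply/matrixP=> i j; rewrite !mxE linearP !mxE.
  by rewrite mulrDl mulrA.
by rewrite mulrDr mulrCA.
Qed.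

Lemma tact_ten I J a b : tact I J (a ⊗ b) = I a *t J b.
Proof. by rewrite /tact tlift_ten //; apply: bilin_tact. Qed.

Lemma tact_is_linear I J : linear (tact I J).
Proof. by move=> c X Y; rewrite /tact linearP. Qed.

Lemma tens1mx m n : (1%:M : 'M[K]_m) *t (1%:M : 'M[K]_n) = 1%:M.
Proof.
apply/matrixP=> i j; case: (mxtens_indexP i) => i0 i1.
case: (mxtens_indexP j) => j0 j1; rewrite tensmxE !mxE.
rewrite (can_eq (@mxtens_indexK _ _)) xpair_eqE /=.
by rewrite -natrM mulnb.
Qed.

Lemma tact_is_multiplicative I J : monoid_morphism (tact I J).
Proof.
split; first by rewrite tact_ten !rmorph1 [1]/(1%:M) [X in _ *t X]/(1%:M) tens1mx.
have F := GRing.isLinear.Build _ _ _ _ (tact I J) (tact_is_linear I J).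
pose L : {linear tens H H -> _} := HB.pack (tact I J) F.
move=> X Y; rewrite -![tact I J _]/(L _).
elim/tens_ind: X => [|a b|X X' eX eX']; first by rewrite mul0r linear0 mul0r.
  elim/tens_ind: Y => [|c d|Y Y' eY eY'].
  - by rewrite mulr0 linear0 mulr0.
  - by rewrite ten_mul /= !tact_ten !rmorphM; apply: (esym (tensmx_mul _ _ _ _)).
  - by rewrite mulrDr !linearD eY eY' mulrDr.
by rewrite mulrDl !linearD eX eX' mulrDl.
Qed.

HB.instance Definition _ I J := GRing.isLinear.Build _ _ _ _ (tact I J)
  (tact_is_linear I J).
HB.instance Definition _ I J := GRing.isMonoidMorphism.Build _ _ (tact I J)
  (tact_is_multiplicative I J).

Definition hmod_tens I J : hmod H := HMod (tact I J \o coprod H).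

Definition triv_act (x : H) : 'M[K]_1 := (counit H x)%:M.

Lemma triv_act_is_linear : linear triv_act.
Proof.
by move=> c x y; rewrite /triv_act linearP; apply/matrixP=> i j; rewrite !mxE mulrnDl mulrnAr.
Qed.

Lemma triv_act_is_multiplicative : monoid_morphism triv_act.
Proof.
by split=> [|x y]; rewrite /triv_act ?rmorph1 // rmorphM scalar_mxM.
Qed.

HB.instance Definition _ := GRing.isLinear.Build _ _ _ _ triv_act
  triv_act_is_linear.
HB.instance Definition _ := GRing.isMonoidMorphism.Build _ _ triv_act
  triv_act_is_multiplicative.

Definition hmod_triv : hmod H := HMod triv_act.

(* the entry (i, j) of the matrix T of I, as a linear form on H *)
Definition mxcoef I (i j : 'I_(hdim I)) : dualv H :=
  linfun (fun x : H => I x i j : K^o).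

Lemma mxcoef_is_linear I i j : linear (fun x : H => I x i j : K^o).
Proof. by move=> c x y; rewrite linearP !mxE. Qed.

Lemma mxcoefE I i j x : mxcoef i j x = I x i j.
Proof.
pose F := GRing.isLinear.Build _ _ _ _ _ (mxcoef_is_linear i j).
pose L : {linear H -> K^o} := HB.pack (fun x : H => I x i j : K^o) F.
exact: (lfunE L).
Qed.

End Modules.

(* Unital associative algebras, presented as rings with a central morphism
   from K. The zero algebra is allowed, unlike in algType. *)
Record pzAlg (K : fieldType) := PzAlg {
  pzalg_ring :> pzRingType;
  pzalg_in : {rmorphism K -> pzalg_ring};
  pzalg_central : forall c x, pzalg_in c * x = x * pzalg_in c
}.

Definition pzmod (K : fieldType) (E : pzAlg K) : Type := E.

Section PzMod.
Variables (K : fieldType) (E : pzAlg K).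
Let scale (c : K) (x : pzmod E) : pzmod E := pzalg_in E c * (x : E).
HB.instance Definition _ := GRing.Zmodule.copy (pzmod E) E.
Fact pzmod_scaleA a b v : scale a (scale b v) = scale (a * b) v.
Proof. by rewrite /scale rmorphM mulrA. Qed.
Fact pzmod_scale1 : left_id 1 scale.
Proof. by move=> v; rewrite /scale rmorph1 mul1r. Qed.
Fact pzmod_scaleDr : right_distributive scale +%R.
Proof. by move=> a u v; rewrite /scale mulrDr. Qed.
Fact pzmod_scaleDl v : {morph scale^~ v: a b / a + b}.
Proof. by move=> a b; rewrite /scale rmorphD mulrDl. Qed.
HB.instance Definition _ := GRing.Zmodule_isLmodule.Build K (pzmod E)
  pzmod_scaleA pzmod_scale1 pzmod_scaleDr pzmod_scaleDl.
Lemma pzscaleE c (x : E) : c *: (x : pzmod E) = pzalg_in E c * x.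
Proof. by []. Qed.
Lemma pzscaleAl c (x y : E) :
  c *: (x * y : pzmod E) = ((c *: (x : pzmod E) : pzmod E) : E) * y.
Proof. by rewrite !pzscaleE mulrA. Qed.
Lemma pzscaleAr c (x y : E) :
  c *: (x * y : pzmod E) = x * ((c *: (y : pzmod E) : pzmod E) : E).
Proof. by rewrite !pzscaleE mulrA pzalg_central -mulrA. Qed.
End PzMod.

(* M_1 = M ⊗ id and N_2 = id ⊗ N. Rows and columns are indexed by pairs through
   mxtens_index; E need not be commutative, see leg12E for M_1 N_2. *)
Definition leg1 (E : pzRingType) m n (M : 'M[E]_m) : 'M[E]_(m * n) :=
  M *t (1%:M : 'M[E]_n).
Definition leg2 (E : pzRingType) m n (N : 'M[E]_n) : 'M[E]_(m * n) :=
  (1%:M : 'M[E]_m) *t N.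

Section Relations.
Variables (K : fieldType) (H : ribbonHopf K) (g n : nat).

Inductive gen := GenA of 'I_g | GenB of 'I_g | GenM of 'I_n.

(* the position in 0, ..., g + n - 1 of the handle or puncture of a generator *)
Definition gen_pos (s : gen) : nat :=
  match s with GenA i => i | GenB i => i | GenM j => g + j end.

Definition genfam (E : pzAlg K) := gen -> {linear dualv H -> pzmod E}.

(* The matrix with the image under X s of the matrix coefficients of I. *)
Definition gmx (E : pzAlg K) (X : genfam E) (s : gen) (I : hmod H) :
  'M[E]_(hdim I) := \matrix_(i, j) (X s (mxcoef i j) : E).

Definition emx (E : pzAlg K) m (A : 'M[K]_m) : 'M[E]_m := map_mx (pzalg_in E) A.

Definition Rmx (E : pzAlg K) (I J : hmod H) : 'M[E]_(hdim I * hdim J) :=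
  emx E (tact I J (rmat H)).
Definition R'mx (E : pzAlg K) (I J : hmod H) : 'M[E]_(hdim I * hdim J) :=
  emx E (tact I J (tswap (rmat H))).
Definition Rimx (E : pzAlg K) (I J : hmod H) : 'M[E]_(hdim I * hdim J) :=
  emx E (invmx (tact I J (rmat H))).
Definition R'imx (E : pzAlg K) (I J : hmod H) : 'M[E]_(hdim I * hdim J) :=
  emx E (invmx (tact I J (tswap (rmat H)))).

Record Lrel (E : pzAlg K) (X : genfam E) : Prop := LRel {
  lrel_triv : forall s, gmx X s (hmod_triv H) = 1%:M;
  lrel_fusion : forall s (I J : hmod H),
    gmx X s (hmod_tens I J)
      = leg1 _ (gmx X s I) *m R'mx E I J *m leg2 _ (gmx X s J) *m R'imx E I J;
  lrel_exchange : forall s t (I J : hmod H), (gen_pos s < gen_pos t)%N ->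
    Rmx E I J *m leg1 _ (gmx X s I) *m Rimx E I J *m leg2 _ (gmx X t J)
      = leg2 _ (gmx X t J) *m Rmx E I J *m leg1 _ (gmx X s I) *m Rimx E I J;
  lrel_handle : forall (i : 'I_g) (I J : hmod H),
    Rmx E I J *m leg1 _ (gmx X (GenB i) I) *m R'mx E I J
        *m leg2 _ (gmx X (GenA i) J)
      = leg2 _ (gmx X (GenA i) J) *m Rmx E I J *m leg1 _ (gmx X (GenB i) I)
        *m Rimx E I J
}.

(* formal noncommutative polynomials in the generators *)
Inductive term :=
  | TConst of K
  | TGen of gen & dualv H
  | TAdd of term & term
  | TMul of term & term.

Fixpoint teval (E : pzAlg K) (X : genfam E) (t : term) : E :=
  match t with
  | TConst c => pzalg_in E c
  | TGen s phi => X s phi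
  | TAdd t u => teval X t + teval X u
  | TMul t u => teval X t * teval X u
  end.

(* Equality of formal expressions modulo the algebra axioms, the linear
   structure of dualv H and the relations Lrel: t and u are identified when they
   agree for every family satisfying Lrel. The quotient Lgn is thus the algebra
   presented by the generators and the relations; its universal property is given
   by Lfam_rel, Llift, Llift_gen and Lgn_ind. *)
Definition teq (t u : term) : bool :=
  `[< forall (E : pzAlg K) (X : genfam E), Lrel X -> teval X t = teval X u >].

HB.instance Definition _ := gen_eqMixin term.
HB.instance Definition _ := gen_choiceMixin term.

Lemma teq_refl : reflexive teq. Proof. by move=> t; apply/asboolP. Qed.
Lemma teq_sym : symmetric teq.
Proof.
by move=> t u; apply/asboolP/asboolP => tu E X hX; rewrite tu.
Qed.
Lemma teq_trans : transitive teq.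
Proof.
by move=> t u v /asboolP ut /asboolP tv; apply/asboolP => E X hX; rewrite ut ?tv.
Qed.
Canonical teq_equiv := EquivRel teq teq_refl teq_sym teq_trans.

Definition Lgn : Type := {eq_quot teq}%qT.
HB.instance Definition _ := Choice.copy Lgn {eq_quot teq}%qT.
HB.instance Definition _ := EqQuotient.copy Lgn {eq_quot teq}%qT.

Definition Leval (E : pzAlg K) (X : genfam E) (x : Lgn) : E := teval X (repr x).

Lemma Leval_pi (E : pzAlg K) (X : genfam E) t :
  Lrel X -> Leval X (\pi_Lgn t)%qT = teval X t.
Proof.
move=> hX; have : (repr (\pi_Lgn t) == t %[mod Lgn])%qT by rewrite reprK.
by rewrite eqmodE => /asboolP; apply.
Qed.

Lemma Lext (x y : Lgn) :
  (forall (E : pzAlg K) (X : genfam E), Lrel X -> Leval X x = Leval X y) ->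
  x = y.
Proof.
move=> xy; rewrite -[x]reprK -[y]reprK; apply/eqP; rewrite eqmodE.
by apply/asboolP => E X hX; apply: xy.
Qed.

Definition Lin (c : K) : Lgn := (\pi_Lgn (TConst c))%qT.
Definition Lgen (s : gen) (phi : dualv H) : Lgn := (\pi_Lgn (TGen s phi))%qT.
Definition Ladd (x y : Lgn) : Lgn := (\pi_Lgn (TAdd (repr x) (repr y)))%qT.
Definition Lmul (x y : Lgn) : Lgn := (\pi_Lgn (TMul (repr x) (repr y)))%qT.
Definition Lopp (x : Lgn) : Lgn := Lmul (Lin (-1)) x.

Section LevalTheory.
Variables (E : pzAlg K) (X : genfam E).
Hypothesis hX : Lrel X.

Lemma Leval_in c : Leval X (Lin c) = pzalg_in E c.
Proof. exact: Leval_pi. Qed.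
Lemma Leval_gen s phi : Leval X (Lgen s phi) = X s phi.
Proof. exact: Leval_pi. Qed.
Lemma Leval_add x y : Leval X (Ladd x y) = Leval X x + Leval X y.
Proof. exact: Leval_pi. Qed.
Lemma Leval_mul x y : Leval X (Lmul x y) = Leval X x * Leval X y.
Proof. exact: Leval_pi. Qed.
Lemma Leval_opp x : Leval X (Lopp x) = - Leval X x.
Proof. by rewrite Leval_mul Leval_in rmorphN1 mulN1r. Qed.

Definition LevalE := (Leval_opp, Leval_add, Leval_mul, Leval_in).

End LevalTheory.

Lemma LaddA : associative Ladd. Proof. by move=> x y z; apply: Lext => E X hX; rewrite !(LevalE hX) addrA. Qed.
Lemma LaddC : commutative Ladd. Proof. by move=> x y; apply: Lext => E X hX; rewrite !(LevalE hX) addrC. Qed.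
Lemma Ladd0 : left_id (Lin 0) Ladd.
Proof. by move=> x; apply: Lext => E X hX; rewrite !(LevalE hX) rmorph0 add0r. Qed.
Lemma LaddN : left_inverse (Lin 0) Lopp Ladd.
Proof. by move=> x; apply: Lext => E X hX; rewrite !(LevalE hX) rmorph0 addNr. Qed.
Lemma LmulA : associative Lmul. Proof. by move=> x y z; apply: Lext => E X hX; rewrite !(LevalE hX) mulrA. Qed.
Lemma Lmul1l : left_id (Lin 1) Lmul.
Proof. by move=> x; apply: Lext => E X hX; rewrite !(LevalE hX) rmorph1 mul1r. Qed.
Lemma Lmul1r : right_id (Lin 1) Lmul.
Proof. by move=> x; apply: Lext => E X hX; rewrite !(LevalE hX) rmorph1 mulr1. Qed.
Lemma LmulDl : left_distributive Lmul Ladd.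
Proof. by move=> x y z; apply: Lext => E X hX; rewrite !(LevalE hX) mulrDl. Qed.
Lemma LmulDr : right_distributive Lmul Ladd.
Proof. by move=> x y z; apply: Lext => E X hX; rewrite !(LevalE hX) mulrDr. Qed.

HB.instance Definition _ := GRing.isPzRing.Build Lgn
  LaddA LaddC Ladd0 LaddN LmulA Lmul1l Lmul1r LmulDl LmulDr.

Lemma Lin_zmod : zmod_morphism Lin.
Proof.
move=> c d; rewrite -[Lin c - Lin d]/(Ladd (Lin c) (Lopp (Lin d))).
by apply: Lext => E X hX; rewrite !(LevalE hX) rmorphB.
Qed.
Lemma Lin_monoid : monoid_morphism Lin.
Proof.
split=> // c d; rewrite -[Lin c * Lin d]/(Lmul (Lin c) (Lin d)).
by apply: Lext => E X hX; rewrite !(LevalE hX) rmorphM.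
Qed.
HB.instance Definition _ := GRing.isZmodMorphism.Build K Lgn Lin Lin_zmod.
HB.instance Definition _ := GRing.isMonoidMorphism.Build K Lgn Lin Lin_monoid.

Lemma Lin_central c (x : Lgn) : Lin c * x = x * Lin c.
Proof.
rewrite -[LHS]/(Lmul (Lin c) x) -[RHS]/(Lmul x (Lin c)).
by apply: Lext => E X hX; rewrite !(LevalE hX) pzalg_central.
Qed.

Definition LgnAlg : pzAlg K := PzAlg Lin_central.

Lemma Lgen_linear s : linear (Lgen s : dualv H -> pzmod LgnAlg).
Proof.
move=> c phi psi; apply: Lext => E X hX.
rewrite -[Z in _ = Leval _ Z]/(Ladd (Lmul (Lin c) (Lgen s phi)) (Lgen s psi)).
by rewrite Leval_add // Leval_mul // Leval_in // !Leval_gen // linearP.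
Qed.
HB.instance Definition _ s := GRing.isLinear.Build K (dualv H) (pzmod LgnAlg) _
  (Lgen s) (Lgen_linear s).

Definition Lfam : genfam LgnAlg := fun s => Lgen s.

Section Lift.
Variables (E : pzAlg K) (X : genfam E).
Hypothesis hX : Lrel X.
Let hX' := hX.

Lemma Leval_zmod : zmod_morphism (Leval X).
Proof.
move=> x y; rewrite -[x - y]/(Ladd x (Lopp y)).
by rewrite Leval_add // Leval_opp.
Qed.
Lemma Leval_monoid : monoid_morphism (Leval X).
Proof.
split=> [|x y]; last exact: Leval_mul.
by rewrite -[1]/(Lin 1) Leval_in // rmorph1.
Qed.

Definition Llift_fun of Lrel X := Leval X.
HB.instance Definition _ := GRing.isZmodMorphism.Build Lgn E (Llift_fun hX)
  Leval_zmod.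
HB.instance Definition _ := GRing.isMonoidMorphism.Build Lgn E (Llift_fun hX)
  Leval_monoid.
Definition Llift : {rmorphism Lgn -> E} := Llift_fun hX.

Lemma Llift_in c : Llift (pzalg_in LgnAlg c) = pzalg_in E c.
Proof. exact: Leval_in. Qed.
Lemma Llift_gen s phi : Llift (Lfam s phi) = X s phi.
Proof. exact: Leval_gen. Qed.

Lemma gmx_lift s (I : hmod H) : map_mx Llift (gmx Lfam s I) = gmx X s I.
Proof. by apply/matrixP=> i j; rewrite !mxE Llift_gen. Qed.
Lemma emx_lift m (A : 'M[K]_m) : map_mx Llift (emx LgnAlg A) = emx E A.
Proof. by apply/matrixP=> i j; rewrite !mxE Llift_in. Qed.
End Lift.

Lemma map_leg1 (E E' : pzRingType) (f : {rmorphism E -> E'}) m k (M : 'M[E]_m) :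
  map_mx f (leg1 k M) = leg1 k (map_mx f M).
Proof. by rewrite /leg1 map_mxT map_mx1. Qed.
Lemma map_leg2 (E E' : pzRingType) (f : {rmorphism E -> E'}) m k (M : 'M[E]_k) :
  map_mx f (leg2 m M) = leg2 m (map_mx f M).
Proof. by rewrite /leg2 map_mxT map_mx1. Qed.

Lemma Lext_mx m k (M N : 'M[LgnAlg]_(m, k)) :
  (forall (E : pzAlg K) (X : genfam E) (hX : Lrel X),
    map_mx (Llift hX) M = map_mx (Llift hX) N) -> M = N.
Proof.
move=> MN; apply/matrixP=> i j; apply: Lext => E X hX.
by have /matrixP/(_ i j) := MN E X hX; rewrite !mxE.
Qed.

Theorem Lfam_rel : Lrel Lfam.
Proof.
split.
- move=> s; apply: Lext_mx => E X hX.
  by rewrite gmx_lift map_mx1 lrel_triv.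
- move=> s I J; apply: Lext_mx => E X hX.
  by rewrite !map_mxM !map_leg1 !map_leg2 !emx_lift !gmx_lift lrel_fusion.
- move=> s t I J st; apply: Lext_mx => E X hX.
  by rewrite !map_mxM !map_leg1 !map_leg2 !emx_lift !gmx_lift lrel_exchange.
- move=> i I J; apply: Lext_mx => E X hX.
  by rewrite !map_mxM !map_leg1 !map_leg2 !emx_lift !gmx_lift lrel_handle.
Qed.

Theorem Lgn_ind (P : LgnAlg -> Prop) :
  (forall c, P (pzalg_in LgnAlg c)) -> (forall s phi, P (Lfam s phi)) ->
  (forall x y, P x -> P y -> P (x + y)) ->
  (forall x y, P x -> P y -> P (x * y)) -> forall x, P x.
Proof.
move=> Pc Pg PD PM x; rewrite -[x]reprK.
elim: (repr x) => [c|s phi|t IHt u IHu|t IHt u IHu].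
- exact: Pc.
- exact: Pg.
- suff -> : (\pi_Lgn (TAdd t u))%qT = (\pi_Lgn t : LgnAlg)%qT + (\pi_Lgn u)%qT by apply: PD.
  by apply: Lext => E X hX; rewrite Leval_add // !Leval_pi.
- suff -> : (\pi_Lgn (TMul t u))%qT = (\pi_Lgn t : LgnAlg)%qT * (\pi_Lgn u)%qT by apply: PM.
  by apply: Lext => E X hX; rewrite Leval_mul // !Leval_pi.
Qed.

End Relations.

Section Convolution.
Variables (K : fieldType) (H : hopfAlgType K) (E : pzAlg K).

(* The linear maps from H to E, by their values on the basis of H, with the
   convolution product. *)
Definition conv : Type := {ffun 'I_(\dim {:H}) -> E}.
HB.instance Definition _ := GRing.Zmodule.copy conv {ffun 'I_(\dim {:H}) -> E}.

Definition cev (f : conv) (h : H) : pzmod E :=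
  \sum_i coord (vbasis {:H}) i h *: (f i : pzmod E).

Definition cmk (F : H -> pzmod E) : conv := [ffun i : 'I_(\dim {:H}) => F (vbasis {:H})`_i : E].

Lemma cev_is_linear f : linear (cev f).
Proof.
move=> c x y; rewrite /cev scaler_sumr -big_split; apply: eq_bigr => i _ /=.
by rewrite linearP scalerDl scalerA.
Qed.
HB.instance Definition _ f := GRing.isLinear.Build K H (pzmod E) _ (cev f)
  (cev_is_linear f).

Lemma cmkE F h : linear F -> cev (cmk F) h = F h.
Proof.
move=> hF; pose M := GRing.isLinear.Build K H (pzmod E) _ F hF.
pose L : {linear H -> pzmod E} := HB.pack F M.
rewrite {2}(coord_vbasis (memvf h)) -[F _]/(L _) linear_sum.
by apply: eq_bigr => i _; rewrite linearZ /= ffunE.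
Qed.

Lemma cev_ext f f' : (forall h, cev f h = cev f' h) -> f = f'.
Proof.
move=> ff'; apply/ffunP => i; have := ff' (vbasis {:H})`_i.
have ce (u : conv) : cev u (vbasis {:H})`_i = u i.
  rewrite /cev (bigD1 i) //= coord_vb eqxx scale1r big1 ?addr0 // => j ji.
  by rewrite coord_vb (negPf ji) scale0r.
by rewrite !ce.
Qed.

Lemma cevD f f' h : cev (f + f') h = cev f h + cev f' h.
Proof.
by rewrite /cev -big_split; apply: eq_bigr => i _; rewrite ffunE scalerDr.
Qed.

Lemma cev0 h : cev 0 h = 0.
Proof. by rewrite /cev big1 // => i _; rewrite ffunE scaler0. Qed.

Lemma cev_sum I (r : seq I) (P : pred I) (F : I -> conv) h :
  cev (\sum_(i <- r | P i) F i) h = \sum_(i <- r | P i) cev (F i) h.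
Proof.
apply: (big_morph (fun f => cev f h) _ (cev0 h)) => u v; exact: cevD.
Qed.

Definition cmul (f f' : conv) : conv :=
  cmk (fun h => \sw_(a, b <- coprod H h) ((cev f a : E) * (cev f' b : E) : pzmod E)).

Definition cin (c : K) : conv := cmk (fun h => counit H h *: (pzalg_in E c : pzmod E)).

Lemma cmulE f f' h :
  cev (cmul f f') h
    = \sw_(a, b <- coprod H h) ((cev f a : E) * (cev f' b : E) : pzmod E).
Proof. by rewrite cmkE // => c x y; rewrite !linearP. Qed.

Lemma cinE c h : cev (cin c) h = counit H h *: (pzalg_in E c : pzmod E).
Proof. by rewrite cmkE // => k x y; rewrite linearP scalerDl scalerA. Qed.

Lemma bilin_cev (f f' : conv) :
  bilin (fun a b => (cev f a : E) * (cev f' b : E) : pzmod E).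
Proof.
split=> [b|a] c u v; rewrite linearP.
  by rewrite [LHS]mulrDl -pzscaleAl.
by rewrite [LHS]mulrDr -pzscaleAr.
Qed.

Lemma mulpz_linear (x : E) : linear (fun y : pzmod E => (y : E) * x : pzmod E).
Proof. by move=> c u v; rewrite [LHS]mulrDl -pzscaleAl. Qed.
Lemma pzmul_linear (x : E) : linear (fun y : pzmod E => x * (y : E) : pzmod E).
Proof. by move=> c u v; rewrite [LHS]mulrDr -pzscaleAr. Qed.

Lemma cmulA : associative cmul.
Proof.
move=> f f' f''; apply: cev_ext => h; rewrite !cmulE.
pose L2 (x : H) (Y : tens H H) : pzmod E :=
  \sw_(b, c <- Y) ((cev f x : E) * ((cev f' b : E) * (cev f'' c : E)) : pzmod E).
have bL2 : bilin L2.
  split=> [Y|x] c u v; last by rewrite /L2 linearP.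
  rewrite /L2 -tlift_comb; apply: tlift_eq => a b.
  by rewrite linearP [LHS]mulrDl -pzscaleAl.
have bi a : bilin (fun b c => (cev f a : E) * ((cev f' b : E) * (cev f'' c : E)) : pzmod E).
  split=> [b|b] c u v; rewrite linearP.
    by rewrite [X in _ * X]mulrDl [LHS]mulrDr -pzscaleAl -pzscaleAr.
  by rewrite [X in _ * X]mulrDr [LHS]mulrDr -!pzscaleAr.
transitivity (tlift L2 (\sw_(a, b <- coprod H h) (a ⊗ coprod H b))).
  rewrite (tlift_lin (tlift L2)); last by move=> c x y; rewrite linearP.
  apply: tlift_eq => a b; rewrite tlift_ten // cmulE.
  by rewrite (tlift_lin (fun y : pzmod E => (cev f a : E) * (y : E) : pzmod E)) //;
    apply: pzmul_linear.
rewrite -coprodA (tlift_lin (tlift L2)); last by move=> c x y; rewrite linearP.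
apply: tlift_eq => a b; rewrite (tlift_lin (tlift L2)); last by move=> c x y; rewrite linearP.
rewrite cmulE (tlift_lin (fun y : pzmod E => (y : E) * cev f'' b : pzmod E));
  last exact: mulpz_linear.
by apply: tlift_eq => c d; rewrite tlift_ten // /L2 tlift_ten // mulrA.
Qed.

Lemma cin_mull c f h : cev (cmul (cin c) f) h = c *: cev f h.
Proof.
rewrite cmulE -{2}[h]counitl.
rewrite (tlift_lin (fun x => c *: cev f x)); last first.
  by move=> k x y; rewrite linearP scalerDr !scalerA mulrC.
apply: tlift_eq => a b; rewrite cinE linearZ /=.
by rewrite -pzscaleAl scalerA mulrC -scalerA.
Qed.

Lemma cin_mulr c f h : cev (cmul f (cin c)) h = c *: cev f h.
Proof.
rewrite cmulE -{2}[h]counitr.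
rewrite (tlift_lin (fun x => c *: cev f x)); last first.
  by move=> k x y; rewrite linearP scalerDr !scalerA mulrC.
apply: tlift_eq => a b; rewrite cinE linearZ /=.
by rewrite -pzscaleAr -pzalg_central -pzscaleE scalerA mulrC -scalerA.
Qed.

Lemma cmul1l : left_id (cin 1) cmul.
Proof. by move=> f; apply: cev_ext => h; rewrite cin_mull scale1r. Qed.
Lemma cmul1r : right_id (cin 1) cmul.
Proof. by move=> f; apply: cev_ext => h; rewrite cin_mulr scale1r. Qed.
Lemma cmulDl : left_distributive cmul +%R.
Proof.
move=> f f' f''; apply: cev_ext => h; rewrite cevD !cmulE.
rewrite -[X in _ = X + _]scale1r -tlift_comb; apply: tlift_eq => a b.
by rewrite cevD scale1r; apply: mulrDl.
Qed.
Lemma cmulDr : right_distributive cmul +%R.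
Proof.
move=> f f' f''; apply: cev_ext => h; rewrite cevD !cmulE.
rewrite -[X in _ = X + _]scale1r -tlift_comb; apply: tlift_eq => a b.
by rewrite cevD scale1r; apply: mulrDr.
Qed.

HB.instance Definition _ := GRing.Zmodule_isPzRing.Build conv
  cmulA cmul1l cmul1r cmulDl cmulDr.

Lemma cin_zmod : zmod_morphism cin.
Proof.
move=> c d; apply/eqP; rewrite eq_sym subr_eq; apply/eqP; apply: cev_ext => h.
by rewrite cevD !cinE -scalerDr /= -[_ + _]rmorphD subrK.
Qed.
Lemma cin_monoid : monoid_morphism cin.
Proof.
split=> // c d; apply: cev_ext => h.
rewrite [in RHS]cin_mull !cinE.
have -> : pzalg_in E (c * d) = c *: (pzalg_in E d : pzmod E) by exact: rmorphM.
by rewrite !scalerA mulrC.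
Qed.
HB.instance Definition _ := GRing.isZmodMorphism.Build K conv cin cin_zmod.
HB.instance Definition _ := GRing.isMonoidMorphism.Build K conv cin cin_monoid.
Lemma cin_central c (f : conv) : cin c * f = f * cin c.
Proof. by apply: cev_ext => h; rewrite [LHS]cin_mull [RHS]cin_mulr. Qed.

Definition convAlg : pzAlg K := PzAlg cin_central.

Lemma cevM (f f' : conv) h :
  cev (f * f') h
    = \sw_(a, b <- coprod H h) ((cev f a : E) * (cev f' b : E) : pzmod E).
Proof. exact: cmulE. Qed.

Lemma cevZ c (f : pzmod convAlg) h : cev (c *: f) h = c *: cev f h.
Proof. exact: cin_mull. Qed.

(* x |-> (h |-> counit h *: x) *)
Definition ccst (x : E) : conv := cmk (fun h => counit H h *: (x : pzmod E)).
Lemma ccstE x h : cev (ccst x) h = counit H h *: (x : pzmod E).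
Proof. by rewrite cmkE // => k y z; rewrite linearP scalerDl scalerA. Qed.
Lemma ccst_mull x f h : cev (ccst x * f) h = x * (cev f h : E).
Proof.
rewrite cevM -{2}[h]counitl.
rewrite (tlift_lin (fun y => x * (cev f y : E) : pzmod E)); last first.
  by move=> k u v; rewrite linearP [LHS]mulrDr -pzscaleAr.
apply: tlift_eq => a b; rewrite ccstE linearZ /=.
by rewrite -pzscaleAl -pzscaleAr.
Qed.
Lemma ccst_mulr x f h : cev (f * ccst x) h = (cev f h : E) * x.
Proof.
rewrite cevM -{2}[h]counitr.
rewrite (tlift_lin (fun y => (cev f y : E) * x : pzmod E)); last first.
  by move=> k u v; rewrite linearP [LHS]mulrDl -pzscaleAl.
apply: tlift_eq => a b; rewrite ccstE linearZ /=.
by rewrite -pzscaleAl -pzscaleAr.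
Qed.
Lemma ccst_zmod : zmod_morphism ccst.
Proof.
move=> c d; apply/eqP; rewrite eq_sym subr_eq; apply/eqP; apply: cev_ext => h.
by rewrite cevD !ccstE -scalerDr /= subrK.
Qed.
Lemma ccst_monoid : monoid_morphism ccst.
Proof.
split=> [|c d]; apply: cev_ext => h.
  by rewrite ccstE cinE rmorph1.
by rewrite ccst_mull !ccstE -pzscaleAr.
Qed.
HB.instance Definition _ := GRing.isZmodMorphism.Build E conv ccst ccst_zmod.
HB.instance Definition _ := GRing.isMonoidMorphism.Build E conv ccst ccst_monoid.

End Convolution.

Lemma tlift_sum (K : fieldType) (A B : vectType K) (V : lmodType K) m
    (f : 'I_m -> A -> B -> V) X :
  tlift (fun a b => \sum_k f k a b) X = \sum_k tlift (f k) X.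
Proof.
rewrite /tlift [RHS]exchange_big; apply: eq_bigr => i _ /=.
rewrite [RHS]exchange_big; apply: eq_bigr => j _ /=.
by rewrite scaler_sumr.
Qed.

Section LegTheory.
Variables (E : pzRingType) (m n : nat).
Implicit Types (M : 'M[E]_m) (N : 'M[E]_n).

Lemma leg1E M i j k l :
  leg1 n M (mxtens_index (i, k)) (mxtens_index (j, l)) = M i j *+ (k == l).
Proof. by rewrite /leg1 tensmxE !mxE mulr_natr. Qed.
Lemma leg2E N i j k l :
  leg2 m N (mxtens_index (i, k)) (mxtens_index (j, l)) = N k l *+ (i == j).
Proof. by rewrite /leg2 tensmxE !mxE mulr_natl. Qed.

Lemma sum_mxtens (F : 'I_(m * n) -> E) :
  \sum_k F k = \sum_i \sum_j F (mxtens_index (i, j)).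
Proof.
rewrite pair_big (reindex (@mxtens_index m n)) /=.
  by apply: eq_bigr => -[].
by exists (@mxtens_unindex m n) => i _; rewrite (mxtens_indexK, mxtens_unindexK).
Qed.

Lemma leg12E M N i j k l :
  (leg1 n M *m leg2 m N) (mxtens_index (i, k)) (mxtens_index (j, l))
    = M i j * N k l.
Proof.
rewrite mxE sum_mxtens (bigD1 j) //= (bigD1 k) //=.
rewrite leg1E leg2E !eqxx !big1 ?addr0 // => [a aj|a ak].
  by rewrite big1 // => b _; rewrite leg2E (negPf aj) mulr0.
by rewrite leg1E eq_sym (negPf ak) mul0r.
Qed.
Lemma leg21E M N i j k l :
  (leg2 m N *m leg1 n M) (mxtens_index (i, k)) (mxtens_index (j, l))
    = N k l * M i j.
Proof.
rewrite mxE sum_mxtens (bigD1 i) //= (bigD1 l) //=.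
rewrite leg1E leg2E !eqxx !big1 ?addr0 // => [a aj|a ak].
  by rewrite big1 // => b _; rewrite leg2E eq_sym (negPf aj) mul0r.
by rewrite leg1E (negPf ak) mulr0.
Qed.

Lemma leg1M M M' : leg1 n (M *m M') = leg1 n M *m leg1 n M'.
Proof.
apply/matrixP=> x y; case: (mxtens_indexP x) => i k.
case: (mxtens_indexP y) => j l; rewrite leg1E !mxE sum_mxtens -sumrMnl.
apply: eq_bigr => a _; rewrite (bigD1 k) //= big1 ?addr0 => [|b bk].
  by rewrite !leg1E eqxx mulrnAr.
by rewrite !leg1E eq_sym (negPf bk) mul0r.
Qed.
Lemma leg2M N N' : leg2 m (N *m N') = leg2 m N *m leg2 m N'.
Proof.
apply/matrixP=> x y; case: (mxtens_indexP x) => i k.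
case: (mxtens_indexP y) => j l; rewrite leg2E !mxE sum_mxtens -sumrMnl.
rewrite (bigD1 i) //= [X in _ = _ + X]big1 ?addr0 => [|b bk].
  by apply: eq_bigr => a _; rewrite !leg2E eqxx mulrnAr.
by rewrite big1 // => a _; rewrite !leg2E eq_sym (negPf bk) mul0r.
Qed.
Lemma leg1_1 : leg1 n (1%:M : 'M[E]_m) = 1%:M.
Proof.
apply/matrixP=> x y; case: (mxtens_indexP x) => i k.
case: (mxtens_indexP y) => j l; rewrite leg1E !mxE.
by rewrite (can_eq (@mxtens_indexK _ _)) xpair_eqE -mulrnA mulnb.
Qed.
Lemma leg2_1 : leg2 m (1%:M : 'M[E]_n) = 1%:M. Proof. exact: leg1_1. Qed.

Lemma leg_comm M N : (forall i j k l, M i j * N k l = N k l * M i j) ->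
  leg1 n M *m leg2 m N = leg2 m N *m leg1 n M.
Proof.
move=> cMN; apply/matrixP=> x y; case: (mxtens_indexP x) => i k.
by case: (mxtens_indexP y) => j l; rewrite leg12E leg21E.
Qed.

End LegTheory.

Lemma tswapE (K : fieldType) (A B : vectType K) (a : A) (b : B) :
  tswap (a ⊗ b) = b ⊗ a.
Proof.
rewrite /tswap tlift_ten //; have [l1 l2] := bilin_ten B A.
by split=> ? ? ? ?; rewrite (l1, l2).
Qed.

Lemma tswap_linear (K : fieldType) (A B : vectType K) : linear (@tswap K A B).
Proof. by move=> c X Y; rewrite /tswap linearP. Qed.
HB.instance Definition _ (K : fieldType) (A B : vectType K) :=
  GRing.isLinear.Build K (tens A B) (tens B A) _ (@tswap K A B)
    (@tswap_linear K A B).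

Lemma tswapK (K : fieldType) (A B : vectType K) :
  cancel (@tswap K A B) (@tswap K B A).
Proof.
elim/tens_ind=> [|a b|X Y eX eY].
- by rewrite !linear0.
- by rewrite !tswapE.
- by rewrite [tswap (X + Y)]linearD [LHS]linearD /= eX eY.
Qed.

Lemma tswapM (K : fieldType) (A B : falgType K) (X Y : tens A B) :
  tswap (X * Y) = tswap X * tswap Y.
Proof.
elim/tens_ind: X => [|a b|X X' eX eX']; first by rewrite mul0r linear0 mul0r.
  elim/tens_ind: Y => [|c d|Y Y' eY eY'].
  - by rewrite mulr0 linear0 mulr0.
  - by rewrite ten_mul !tswapE ten_mul.
  - by rewrite mulrDr !linearD /= eY eY' mulrDr.
by rewrite mulrDl !linearD /= eX eX' mulrDl.
Qed.

Section RmatTheory.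
Variables (K : fieldType) (H : ribbonHopf K).
Implicit Types I J : hmod H.

Lemma tswap_rmat_unit : tswap (rmat H) \is a GRing.unit.
Proof.
apply/unitrP; exists (tswap (rmat H)^-1); rewrite -!tswapM.
by rewrite mulVr ?mulrV ?rmat_unit // [tswap 1]tswapE.
Qed.

Lemma tact_unit I J X : X \is a GRing.unit -> tact I J X \in unitmx.
Proof.
move=> uX; suff : tact I J X *m tact I J X^-1 = 1%:M by case/mulmx1_unit.
by rewrite -[_ *m _](rmorphM (tact I J)) mulrV // rmorph1.
Qed.

Lemma tswap_rmat_coprod x :
  tswap (rmat H) * tswap (coprod H x) = coprod H x * tswap (rmat H).
Proof. by rewrite -tswapM rmat_coprod tswapM tswapK. Qed.

End RmatTheory.

Section Coaction.
Variables (K : fieldType) (H : ribbonHopf K) (g n : nat).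
Variables (E : pzAlg K) (X : genfam H g n E).
Implicit Types I J : hmod H.
Local Notation C := (convAlg H E).

(* the transpose of x |-> h' x S(h'') *)
Definition adact (h : H) (phi : dualv H) : dualv H :=
  linfun (fun x => \sw_(a, b <- coprod H h) (phi (a * x * antipode H b) : K^o)).

Lemma adactE h phi x :
  adact h phi x = \sw_(a, b <- coprod H h) (phi (a * x * antipode H b) : K^o).
Proof.
pose F x := \sw_(a, b <- coprod H h) (phi (a * x * antipode H b) : K^o).
have hF : linear F.
  move=> c u v; rewrite /F -tlift_comb; apply: tlift_eq => a b.
  by rewrite mulrDr mulrDl -scalerAr -scalerAl linearP.
pose M := GRing.isLinear.Build _ _ _ _ F hF.
pose L : {linear H -> K^o} := HB.pack F M.
exact: (lfunE L).
Qed.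

Lemma adact_linearl phi : linear (adact^~ phi).
Proof.
move=> c h h'; apply/lfunP=> x; rewrite add_lfunE scale_lfunE !adactE.
by rewrite !linearP.
Qed.

Lemma adact_linearr h : linear (adact h).
Proof.
move=> c phi psi; apply/lfunP=> x; rewrite add_lfunE scale_lfunE !adactE.
rewrite -tlift_comb; apply: tlift_eq => a b.
by rewrite add_lfunE scale_lfunE.
Qed.

Definition coact_fun (s : gen g n) (phi : dualv H) : pzmod C :=
  cmk (fun h => X s (adact h phi)).

Lemma coact_funE s phi h : cev (coact_fun s phi) h = X s (adact h phi).
Proof. by rewrite cmkE // => c x y; rewrite adact_linearl linearP. Qed.

Lemma coact_linear s : linear (coact_fun s).
Proof.
move=> c phi psi; apply: cev_ext => h.
by rewrite [in RHS]cevD cevZ !coact_funE adact_linearr linearP.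
Qed.
HB.instance Definition _ s := GRing.isLinear.Build K (dualv H) (pzmod C) _
  (coact_fun s) (coact_linear s).

(* h |-> (x |-> X (h' x S(h''))), with values in the convolution algebra *)
Definition coact : genfam H g n C := fun s => coact_fun s.

(* matrices of linear forms on H, as matrices over C *)
Definition Tmx m (F : H -> 'M[K]_m) : 'M[C]_m :=
  \matrix_(i, j) cmk (fun h => (pzalg_in E (F h i j) : pzmod E)).

Lemma TmxE m (F : H -> 'M[K]_m) i j h : linear F ->
  cev (Tmx F i j) h = pzalg_in E (F h i j).
Proof.
move=> hF; rewrite mxE cmkE // => c x y; rewrite hF !mxE rmorphD rmorphM.
by [].
Qed.

Lemma Tmx_conv_linear m (F G : H -> 'M[K]_m) :
  linear (fun h => \sw_(a, b <- coprod H h) (F a *m G b)).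
Proof. by move=> c x y; rewrite !linearP. Qed.

Lemma entry_linear m (i j : 'I_m) : linear (fun A : 'M[K]_m => pzalg_in E (A i j) : pzmod E).
Proof. by move=> c A B; rewrite !mxE rmorphD rmorphM. Qed.

Lemma TmxM m (F G : H -> 'M[K]_m) : linear F -> linear G ->
  Tmx F *m Tmx G = Tmx (fun h => \sw_(a, b <- coprod H h) (F a *m G b)).
Proof.
move=> hF hG; apply/matrixP=> i j; apply: cev_ext => h.
rewrite TmxE; last exact: Tmx_conv_linear.
rewrite mxE cev_sum (tlift_lin (fun A : 'M_m => pzalg_in E (A i j) : pzmod E));
  last exact: entry_linear.
transitivity (\sw_(a, b <- coprod H h)
   (\sum_k (pzalg_in E (F a i k) * pzalg_in E (G b k j) : pzmod E))); last first.
  apply: tlift_eq => a b; rewrite mxE rmorph_sum; apply: eq_bigr => k _.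
  by rewrite rmorphM.
rewrite tlift_sum; apply: eq_bigr => k _; rewrite cevM.
by apply: tlift_eq => a b; rewrite !TmxE.
Qed.

Lemma emx_Tmx m (A : 'M[K]_m) : emx C A = Tmx (fun h => counit H h *: A).
Proof.
apply/matrixP=> i j; apply: cev_ext => h.
rewrite TmxE; last by move=> c x y; rewrite linearP scalerDl scalerA.
by rewrite !mxE cinE [RHS]rmorphM.
Qed.

Lemma emx_mulTmx m (A : 'M[K]_m) (F : H -> 'M[K]_m) : linear F ->
  emx C A *m Tmx F = Tmx (fun h => A *m F h).
Proof.
move=> hF; rewrite emx_Tmx TmxM //; last first.
  by move=> c x y; rewrite linearP scalerDl scalerA.
apply/matrixP=> i j; apply: cev_ext => h; rewrite !mxE; congr (cev _ h).
apply/ffunP=> k; rewrite !ffunE; congr (pzalg_in E (fun_of_matrix _ i j)).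
rewrite -{2}[(vbasis _)`_k]counitl.
rewrite (tlift_lin (fun x => A *m F x)); last first.
  by move=> c x y; rewrite hF mulmxDr scalemxAr.
apply: tlift_eq => a b.
have -> : F (counit H a *: b) = counit H a *: F b.
  by have := hF (counit H a) b 0; rewrite !addr0 (_ : F 0 = 0) ?addr0 //;
    have := hF (-1) 0 0; rewrite scaler0 addr0 scaleN1r addNr.
by rewrite -scalemxAl scalemxAr.
Qed.

Lemma Tmx_mulemx m (A : 'M[K]_m) (F : H -> 'M[K]_m) : linear F ->
  Tmx F *m emx C A = Tmx (fun h => F h *m A).
Proof.
move=> hF; rewrite emx_Tmx TmxM //; last first.
  by move=> c x y; rewrite linearP scalerDl scalerA.
apply/matrixP=> i j; apply: cev_ext => h; rewrite !mxE; congr (cev _ h).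
apply/ffunP=> k; rewrite !ffunE; congr (pzalg_in E (fun_of_matrix _ i j)).
rewrite -{2}[(vbasis _)`_k]counitr.
rewrite (tlift_lin (fun x => F x *m A)); last first.
  by move=> c x y; rewrite hF mulmxDl scalemxAl.
apply: tlift_eq => a b.
have -> : F (counit H b *: a) = counit H b *: F a.
  by have := hF (counit H b) a 0; rewrite !addr0 (_ : F 0 = 0) ?addr0 //;
    have := hF (-1) 0 0; rewrite scaler0 addr0 scaleN1r addNr.
by rewrite -scalemxAl scalemxAr.
Qed.

Lemma Tmx_eq m (F G : H -> 'M[K]_m) : F =1 G -> Tmx F = Tmx G.
Proof.
move=> FG; apply/matrixP=> i j; rewrite !mxE; apply/ffunP=> k.
by rewrite !ffunE FG.
Qed.

Lemma leg1_Tmx m k (F : H -> 'M[K]_m) : linear F ->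
  leg1 k (Tmx F) = Tmx (fun h => F h *t (1%:M : 'M_k)).
Proof.
move=> hF; apply/matrixP=> x y; case: (mxtens_indexP x) => i a.
case: (mxtens_indexP y) => j b; rewrite leg1E; apply: cev_ext => h.
rewrite TmxE; last first.
  move=> c u v; apply/matrixP=> p q; rewrite hF !mxE mulrDl mulrA //.
rewrite tensmxE !mxE; case: (a == b); rewrite ?mulr1 ?mulr0 ?mulr1n ?mulr0n.
  by rewrite -TmxE // mxE.
by rewrite rmorph0 cev0.
Qed.
Lemma leg2_Tmx m k (F : H -> 'M[K]_k) : linear F ->
  leg2 m (Tmx F) = Tmx (fun h => (1%:M : 'M_m) *t F h).
Proof.
move=> hF; apply/matrixP=> x y; case: (mxtens_indexP x) => i a.
case: (mxtens_indexP y) => j b; rewrite leg2E; apply: cev_ext => h.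
rewrite TmxE; last first.
  move=> c u v; apply/matrixP=> p q; rewrite hF !mxE mulrDr mulrCA //.
rewrite tensmxE !mxE; case: (i == j); rewrite ?mul1r ?mul0r ?mulr1n ?mulr0n.
  by rewrite -TmxE // mxE.
by rewrite rmorph0 cev0.
Qed.

Local Notation T I := (Tmx (I : H -> 'M[K]_(hdim I))).
Local Notation TS I := (Tmx (fun h => I (antipode H h) : 'M[K]_(hdim I))).
Local Notation U s I := (map_mx (ccst H (E := E)) (gmx X s I)).

Lemma hact_linear I : linear (I : H -> 'M[K]_(hdim I)).
Proof. by move=> c x y; rewrite linearP. Qed.
Lemma hactS_linear I : linear (fun h => I (antipode H h) : 'M[K]_(hdim I)).
Proof. by move=> c x y; rewrite !linearP. Qed.

Lemma emx1 m : emx C (1%:M : 'M[K]_m) = 1%:M.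
Proof. exact: map_mx1. Qed.

Lemma T_TS I : T I *m TS I = 1%:M.
Proof.
rewrite TmxM; [|exact: hact_linear|exact: hactS_linear].
rewrite -emx1 emx_Tmx; apply: Tmx_eq => h.
transitivity (I (counit H h *: 1)); last by rewrite linearZ /= rmorph1.
rewrite -antipoder (tlift_lin I); last exact: hact_linear.
by apply: tlift_eq => a b; rewrite rmorphM.
Qed.

Lemma TS_T I : TS I *m T I = 1%:M.
Proof.
rewrite TmxM; [|exact: hactS_linear|exact: hact_linear].
rewrite -emx1 emx_Tmx; apply: Tmx_eq => h.
transitivity (I (counit H h *: 1)); last by rewrite linearZ /= rmorph1.
rewrite -antipodel (tlift_lin I); last exact: hact_linear.
by apply: tlift_eq => a b; rewrite rmorphM.
Qed.

Lemma mxcoef_adact I (i j : 'I_(hdim I)) h :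
  adact h (mxcoef i j) = \sw_(a, b <- coprod H h)
    (\sum_k \sum_l (I a i k * I (antipode H b) l j) *: mxcoef k l).
Proof.
apply/lfunP=> x; rewrite adactE.
rewrite (tlift_lin (fun phi : dualv H => phi x : K^o)); last first.
  by move=> c u v; rewrite add_lfunE scale_lfunE.
apply: tlift_eq => a b; rewrite mxcoefE !rmorphM mxE sum_lfunE.
under [RHS]eq_bigr do rewrite sum_lfunE.
rewrite exchange_big; apply: eq_bigr => l _ /=.
rewrite mxE mulr_suml; apply: eq_bigr => k _.
by rewrite scale_lfunE mxcoefE -mulrA [X in _ * X]mulrC mulrA.
Qed.

Lemma gmx_coact s I : gmx coact s I = T I *m U s I *m TS I.
Proof.
apply/matrixP=> i j; apply: cev_ext => h.
rewrite [gmx _ _ _ i j]mxE coact_funE mxcoef_adact.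
rewrite (tlift_lin (X s)); last by move=> c x y; rewrite linearP.
rewrite [in RHS]mxE cev_sum.
transitivity (\sw_(a, b <- coprod H h) (\sum_l
   ((\sum_k pzalg_in E (I a i k) * gmx X s I k l)
      * pzalg_in E (I (antipode H b) l j) : pzmod E))).
  apply: tlift_eq => a b; rewrite exchange_big linear_sum; apply: eq_bigr => l _ /=.
  rewrite linear_sum mulr_suml; apply: eq_bigr => k _.
  rewrite linearZ /= pzscaleE rmorphM mxE -!mulrA.
  by congr (_ * _); rewrite pzalg_central.
rewrite tlift_sum; apply: eq_bigr => l _; rewrite cevM; apply: tlift_eq => a b.
rewrite TmxE; last exact: hactS_linear.
rewrite mxE cev_sum; congr (_ * _); apply: eq_bigr => k _.
rewrite [map_mx _ _ _ _]mxE ccst_mulr TmxE //; exact: hact_linear.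
Qed.

Lemma T_tens I J : T (hmod_tens I J) = leg1 _ (T I) *m leg2 _ (T J).
Proof.
rewrite leg1_Tmx ?leg2_Tmx; try exact: hact_linear.
rewrite TmxM; last 2 first.
- by move=> c x y; apply/matrixP=> p q; rewrite linearP !mxE mulrDl mulrA.
- by move=> c x y; apply/matrixP=> p q; rewrite linearP !mxE mulrDr mulrCA.
apply: Tmx_eq => h; apply: tlift_eq => a b.
by rewrite tensmx_mul mulmx1 mul1mx.
Qed.

Lemma T_tens21 I J : leg2 _ (T J) *m leg1 _ (T I)
  = Tmx (fun h => tact I J (tswap (coprod H h))).
Proof.
rewrite leg1_Tmx ?leg2_Tmx; try exact: hact_linear.
rewrite TmxM; last 2 first.
- by move=> c x y; apply/matrixP=> p q; rewrite linearP !mxE mulrDr mulrCA.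
- by move=> c x y; apply/matrixP=> p q; rewrite linearP !mxE mulrDl mulrA.
apply: Tmx_eq => h; rewrite (tlift_lin (tact I J)); last exact: tact_is_linear.
by apply: tlift_eq => a b; rewrite tact_ten tensmx_mul mulmx1 mul1mx.
Qed.

Lemma tact_coprod_linear I J : linear (fun h => tact I J (coprod H h)).
Proof. by move=> c x y; rewrite !linearP. Qed.
Lemma tact_tswap_linear I J : linear (fun h => tact I J (tswap (coprod H h))).
Proof. by move=> c x y; rewrite !linearP. Qed.

Lemma RTT I J : Rmx C I J *m (leg1 _ (T I) *m leg2 _ (T J))
  = leg2 _ (T J) *m leg1 _ (T I) *m Rmx C I J.
Proof.
rewrite T_tens21 -T_tens.
rewrite emx_mulTmx; last exact: tact_coprod_linear.
rewrite Tmx_mulemx; last exact: tact_tswap_linear.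
apply: Tmx_eq => h.
rewrite -[LHS](rmorphM (tact I J)) -[RHS](rmorphM (tact I J)).
by rewrite rmat_coprod.
Qed.

Lemma R'TT I J : R'mx C I J *m (leg2 _ (T J) *m leg1 _ (T I))
  = leg1 _ (T I) *m leg2 _ (T J) *m R'mx C I J.
Proof.
rewrite T_tens21 -T_tens.
rewrite emx_mulTmx; last exact: tact_tswap_linear.
rewrite Tmx_mulemx; last exact: tact_coprod_linear.
apply: Tmx_eq => h.
rewrite -[LHS](rmorphM (tact I J)) -[RHS](rmorphM (tact I J)).
by rewrite tswap_rmat_coprod.
Qed.

Lemma emxM m (A B : 'M[K]_m) : emx C (A *m B) = emx C A *m emx C B.
Proof. exact: map_mxM. Qed.

Lemma RmxV I J : Rmx C I J *m Rimx C I J = 1%:M.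
Proof. by rewrite -emxM mulmxV ?emx1 // tact_unit ?rmat_unit. Qed.
Lemma VRmx I J : Rimx C I J *m Rmx C I J = 1%:M.
Proof. by rewrite -emxM mulVmx ?emx1 // tact_unit ?rmat_unit. Qed.
Lemma R'mxV I J : R'mx C I J *m R'imx C I J = 1%:M.
Proof. by rewrite -emxM mulmxV ?emx1 // tact_unit ?tswap_rmat_unit. Qed.
Lemma VR'mx I J : R'imx C I J *m R'mx C I J = 1%:M.
Proof. by rewrite -emxM mulVmx ?emx1 // tact_unit ?tswap_rmat_unit. Qed.

Lemma T_cst_comm (x : E) (f : H -> K) : linear (f : H -> K^o) ->
  (cmk (fun h => pzalg_in E (f h) : pzmod E) : C) * ccst H x
    = ccst H x * cmk (fun h => pzalg_in E (f h) : pzmod E).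
Proof.
move=> hf; apply: cev_ext => h; rewrite ccst_mulr ccst_mull cmkE ?pzalg_central //.
by move=> c u v; rewrite hf rmorphD rmorphM.
Qed.

Lemma coef_linear m (F : H -> 'M[K]_m) i j : linear F ->
  linear (fun h => F h i j : K^o).
Proof. by move=> hF c u v; rewrite hF !mxE. Qed.

Lemma comm_T1_U2 m k (F : H -> 'M[K]_m) (M : 'M[E]_k) : linear F ->
  leg1 k (Tmx F) *m leg2 m (map_mx (ccst H (E := E)) M)
    = leg2 m (map_mx (ccst H (E := E)) M) *m leg1 k (Tmx F).
Proof.
move=> hF; apply: leg_comm => i j a b; rewrite !mxE.
by apply: T_cst_comm; apply: coef_linear.
Qed.

Lemma comm_U1_T2 m k (F : H -> 'M[K]_k) (M : 'M[E]_m) : linear F ->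
  leg1 k (map_mx (ccst H (E := E)) M) *m leg2 m (Tmx F)
    = leg2 m (Tmx F) *m leg1 k (map_mx (ccst H (E := E)) M).
Proof.
move=> hF; apply: leg_comm => i j a b; rewrite !mxE.
by apply/esym/T_cst_comm; apply: coef_linear.
Qed.

Lemma emx_cst m (A : 'M[K]_m) : map_mx (ccst H (E := E)) (emx E A) = emx C A.
Proof. by apply/matrixP=> i j; rewrite !mxE. Qed.

End Coaction.

Lemma inv_unique (M : pzRingType) (a b c : M) : c * a = 1 -> a * b = 1 -> c = b.
Proof. by move=> ca ab; rewrite -[c]mulr1 -ab mulrA ca mul1r. Qed.

Section RingIdentities.
Variables (M : pzRingType) (T1 T2 S1 S2 U1 U2 : M).
Hypotheses (TS1 : T1 * S1 = 1) (ST1 : S1 * T1 = 1).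
Hypotheses (TS2 : T2 * S2 = 1) (ST2 : S2 * T2 = 1).
Hypotheses (UT : U1 * T2 = T2 * U1) (US : U1 * S2 = S2 * U1).
Hypotheses (TU : T1 * U2 = U2 * T1) (SU : S1 * U2 = U2 * S1).

Lemma swap_inv (r : M) : r * (T2 * T1) = T1 * T2 * r -> S1 * r * T2 = T2 * r * S1.
Proof.
move=> rTT; rewrite -[LHS]mulr1 -TS1 !mulrA -(mulrA _ T2 T1) -(mulrA S1).
by rewrite rTT !mulrA ST1 mul1r.
Qed.

Lemma conj_mid (r : M) : r * (T2 * T1) = T1 * T2 * r ->
  T1 * U1 * S1 * r * (T2 * U2 * S2) = T1 * T2 * (U1 * r * U2) * (S1 * S2).
Proof.
move=> /swap_inv rTT.
have -> : T1 * U1 * S1 * r * (T2 * U2 * S2) = T1 * U1 * (S1 * r * T2) * U2 * S2.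
  by rewrite !mulrA.
rewrite rTT !mulrA -[T1 * U1 * T2]mulrA UT !mulrA.
by rewrite -[_ * S1 * U2]mulrA SU !mulrA.
Qed.

Lemma inv_swap (r ri A B : M) : r * ri = 1 -> ri * r = 1 ->
  r * A = B * r -> ri * B = A * ri.
Proof.
move=> rri rir h; transitivity (ri * (B * r) * ri).
  by rewrite -!mulrA rri mulr1.
by rewrite -h !mulrA rir mul1r.
Qed.

Lemma SS12 : S1 * S2 * (T2 * T1) = 1.
Proof. by rewrite !mulrA -(mulrA S1) ST2 mulr1. Qed.
Lemma TT12 : T1 * T2 * (S2 * S1) = 1.
Proof. by rewrite !mulrA -(mulrA T1) TS2 mulr1. Qed.
Lemma TT21 : T2 * T1 * (S1 * S2) = 1.
Proof. by rewrite !mulrA -(mulrA T2) TS1 mulr1. Qed.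
Lemma SS21 : S2 * S1 * (T1 * T2) = 1.
Proof. by rewrite !mulrA -(mulrA S2) ST1 mulr1. Qed.

Lemma conj_right (r ri : M) : r * ri = 1 -> ri * r = 1 ->
  r * (T1 * T2) = T2 * T1 * r ->
  T2 * U2 * S2 * r * (T1 * U1 * S1) * ri
    = T2 * T1 * (U2 * r * U1 * ri) * (S1 * S2).
Proof.
move=> rri rir h.
have h1 : S2 * r * T1 = T1 * r * S2.
  transitivity (S2 * (r * (T1 * T2)) * S2).
    by rewrite !mulrA -(mulrA _ T2 S2) TS2 mulr1.
  by rewrite h !mulrA ST2 mul1r.
have h2 : ri * (S1 * S2) = S2 * S1 * ri.
  transitivity (S2 * S1 * (T1 * T2 * ri) * (S1 * S2)).
    by rewrite [S2 * S1 * (_ * ri)]mulrA SS21 mul1r.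
  by rewrite -(inv_swap rri rir h) -!mulrA (mulrA T1) TS1 mul1r TS2 mulr1.
transitivity (T2 * U2 * (S2 * r * T1) * U1 * S1 * ri); first by rewrite !mulrA.
rewrite h1.
transitivity (T2 * (U2 * T1) * r * (S2 * U1) * S1 * ri); first by rewrite !mulrA.
rewrite -TU -US.
transitivity (T2 * T1 * (U2 * r * U1) * (S2 * S1 * ri)); first by rewrite !mulrA.
by rewrite -h2 !mulrA.
Qed.

Lemma inv_right (r ri : M) : r * ri = 1 -> ri * r = 1 ->
  r * (T2 * T1) = T1 * T2 * r -> S1 * S2 * ri = ri * (S2 * S1).
Proof.
move=> rri rir h; apply/esym.
transitivity (S1 * S2 * (T2 * T1 * ri) * (S2 * S1)).
  by rewrite [S1 * S2 * (_ * ri)]mulrA SS12 mul1r.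
by rewrite -(inv_swap rri rir h) -!mulrA (mulrA T2) TS2 mul1r TS1 mulr1.
Qed.

Lemma conj_fusion (r ri : M) : r * ri = 1 -> ri * r = 1 ->
  r * (T2 * T1) = T1 * T2 * r ->
  T1 * T2 * (U1 * r * U2 * ri) * (S2 * S1)
    = T1 * U1 * S1 * r * (T2 * U2 * S2) * ri.
Proof.
move=> rri rir h; rewrite (conj_mid h) -[RHS]mulrA (inv_right rri rir h).
by rewrite !mulrA.
Qed.

Lemma conj_left (r r' : M) :
  r * (T1 * T2) = T2 * T1 * r -> r' * (T2 * T1) = T1 * T2 * r' ->
  r * (T1 * U1 * S1) * r' * (T2 * U2 * S2)
    = T2 * T1 * (r * U1 * r' * U2) * (S1 * S2).
Proof.
move=> h h'; transitivity (r * (T1 * U1 * S1 * r' * (T2 * U2 * S2))).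
  by rewrite !mulrA.
rewrite (conj_mid h'); transitivity (r * (T1 * T2) * (U1 * r' * U2) * (S1 * S2)).
  by rewrite !mulrA.
by rewrite h !mulrA.
Qed.

Lemma conj_exchange (r ri r' : M) : r * ri = 1 -> ri * r = 1 ->
  r * (T1 * T2) = T2 * T1 * r -> r' * (T2 * T1) = T1 * T2 * r' ->
  r * U1 * r' * U2 = U2 * r * U1 * ri ->
  r * (T1 * U1 * S1) * r' * (T2 * U2 * S2)
    = T2 * U2 * S2 * r * (T1 * U1 * S1) * ri.
Proof. by move=> rri rir h h' e; rewrite (conj_left h h') (conj_right rri rir h) e. Qed.

End RingIdentities.

Section CoactionRel.
Variables (K : fieldType) (H : ribbonHopf K) (g n : nat).
Variables (E : pzAlg K) (X : genfam H g n E).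
Hypothesis hX : Lrel X.
Implicit Types I J : hmod H.
Local Notation C := (convAlg H E).
Local Notation T I := (Tmx E (I : H -> 'M[K]_(hdim I))).
Local Notation TS I := (Tmx E (fun h => I (antipode H h) : 'M[K]_(hdim I))).
Local Notation U s I := (map_mx (ccst H (E := E)) (gmx X s I)).

Lemma TS_tens I J : TS (hmod_tens I J) = leg2 _ (TS J) *m leg1 _ (TS I).
Proof.
have h1 := TS_T E (hmod_tens I J); rewrite T_tens in h1.
have h2 : leg1 _ (T I) *m leg2 _ (T J) *m (leg2 _ (TS J) *m leg1 _ (TS I)) = 1%:M.
  rewrite !mulmxA -(mulmxA (leg1 _ _)) -leg2M T_TS leg2_1 mulmx1.
  by rewrite -leg1M T_TS leg1_1.
exact: (inv_unique h1 h2).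
Qed.

Section Pair.
Variables (I J : hmod H) (s t : gen g n).
Let T1 := leg1 (hdim J) (T I).
Let T2 := leg2 (hdim I) (T J).
Let S1 := leg1 (hdim J) (TS I).
Let S2 := leg2 (hdim I) (TS J).
Let U1 := leg1 (hdim J) (U s I).
Let U2 := leg2 (hdim I) (U t J).

Fact TS1 : T1 *m S1 = 1%:M. Proof. by rewrite -leg1M T_TS leg1_1. Qed.
Fact ST1 : S1 *m T1 = 1%:M. Proof. by rewrite -leg1M TS_T leg1_1. Qed.
Fact TS2 : T2 *m S2 = 1%:M. Proof. by rewrite -leg2M T_TS leg2_1. Qed.
Fact ST2 : S2 *m T2 = 1%:M. Proof. by rewrite -leg2M TS_T leg2_1. Qed.
Fact UT : U1 *m T2 = T2 *m U1.
Proof. by apply: comm_U1_T2; apply: hact_linear. Qed.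
Fact US : U1 *m S2 = S2 *m U1.
Proof. by apply: comm_U1_T2; apply: hactS_linear. Qed.
Fact TU : T1 *m U2 = U2 *m T1.
Proof. by apply: comm_T1_U2; apply: hact_linear. Qed.
Fact SU : S1 *m U2 = U2 *m S1.
Proof. by apply: comm_T1_U2; apply: hactS_linear. Qed.

End Pair.

Lemma leg1_coact J s I : leg1 (hdim J) (gmx (coact X) s I)
  = leg1 _ (T I) *m leg1 _ (U s I) *m leg1 _ (TS I).
Proof. by rewrite gmx_coact !leg1M. Qed.
Lemma leg2_coact I s J : leg2 (hdim I) (gmx (coact X) s J)
  = leg2 _ (T J) *m leg2 _ (U s J) *m leg2 _ (TS J).
Proof. by rewrite gmx_coact !leg2M. Qed.

Theorem coact_rel : Lrel (coact X).
Proof.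
split.
- move=> s; rewrite gmx_coact lrel_triv // map_mx1 mulmx1; exact: T_TS.
- move=> s I J; rewrite gmx_coact T_tens TS_tens lrel_fusion //.
  rewrite !map_mxM map_leg1 map_leg2 !emx_cst leg1_coact leg2_coact.
  exact: (conj_fusion (TS1 I J) (ST1 I J) (TS2 I J) (ST2 I J) (UT I J s)
    (SU I J s) (R'mxV E I J) (VR'mx E I J) (R'TT E I J)).
- move=> s t I J st; rewrite leg1_coact leg2_coact.
  have := lrel_exchange hX I J st => /(congr1 (map_mx (ccst H (E := E)))).
  rewrite !map_mxM map_leg1 map_leg2 !emx_cst => e.
  exact: (conj_exchange (TS1 I J) (ST1 I J) (TS2 I J) (ST2 I J) (UT I J s)
    (US I J s) (TU I J t) (SU I J t) (RmxV E I J) (VRmx E I J) (RTT E I J)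
    (inv_swap (RmxV E I J) (VRmx E I J) (RTT E I J)) e).
- move=> i I J; rewrite leg1_coact leg2_coact.
  have := lrel_handle hX i I J => /(congr1 (map_mx (ccst H (E := E)))).
  rewrite !map_mxM map_leg1 map_leg2 !emx_cst => e.
  exact: (conj_exchange (TS1 I J) (ST1 I J) (TS2 I J) (ST2 I J)
    (UT I J (GenB n i)) (US I J (GenB n i)) (TU I J (GenA n i))
    (SU I J (GenA n i)) (RmxV E I J) (VRmx E I J) (RTT E I J) (R'TT E I J) e).
Qed.

End CoactionRel.

Section MainDefs.
Variables (K : fieldType) (H : ribbonHopf K) (g n : nat).
Local Notation L := (Lgn H g n).
Local Notation LA := (LgnAlg H g n).
Local Notation LF := (@Lfam K H g n).

(* The right action x · h: x |-> (h |-> x · h) is the algebra morphism from L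
   to the convolution algebra of linear maps H -> L which is given on the
   generators by coact, see Lact_gmx, LactM and Lact_in below. *)
Definition Lact (x : L) (h : H) : L := cev (Llift (coact_rel (Lfam_rel H g n)) x) h.

Lemma Lact_linearl h : {morph Lact^~ h : x y / x + y}.
Proof. by move=> x y; rewrite /Lact rmorphD cevD. Qed.

Lemma Lact_linearr x : linear (Lact x : H -> pzmod LA).
Proof. by move=> c h k; rewrite /Lact linearP. Qed.

Lemma LactM x y h :
  Lact (x * y) h = \sw_(a, b <- coprod H h) (Lact x a * Lact y b : pzmod LA).
Proof. by rewrite /Lact rmorphM cevM. Qed.

Lemma Lact_in c h : Lact (pzalg_in LA c) h = pzalg_in LA (counit H h * c).
Proof. by rewrite /Lact Llift_in [LHS]cinE [RHS]rmorphM. Qed.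

Lemma Lact_gmx s (I : hmod H) i j h :
  Lact (gmx LF s I i j) h
    = \sw_(a, b <- coprod H h)
        ((emx LA (I a) *m gmx LF s I
          *m emx LA (I (antipode H b))) i j : pzmod LA).
Proof.
rewrite /Lact !mxE Llift_gen coact_funE mxcoef_adact.
rewrite (tlift_lin (LF s)); last by move=> c x y; rewrite linearP.
apply: (@tlift_eq K H H (pzmod LA)) => a b; rewrite exchange_big linear_sum mxE; apply: eq_bigr => l _ /=.
rewrite linear_sum mxE mulr_suml; apply: eq_bigr => k _.
rewrite linearZ /= pzscaleE rmorphM !mxE -!mulrA.
by congr (_ * _); rewrite pzalg_central.
Qed.

Definition Linvariant (x : L) : Prop :=
  forall h : H, Lact x h = pzalg_in LA (counit H h) * x.

Definition Linv : {pred L} := fun x => `[< Linvariant x >].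

(* The two-sided inverse of M, which is unique when it exists. *)
Definition mxinv m (M : 'M[L]_m) : 'M[L]_m :=
  xget 0 [set N | M *m N = 1%:M /\ N *m M = 1%:M]%classic.

Definition Amx (i : 'I_g) (I : hmod H) : 'M[L]_(hdim I) :=
  gmx LF (GenA n i) I.
Definition Bmx (i : 'I_g) (I : hmod H) : 'M[L]_(hdim I) :=
  gmx LF (GenB n i) I.
Definition Mmx (j : 'I_n) (I : hmod H) : 'M[L]_(hdim I) :=
  gmx LF (GenM g j) I.

Definition Chandle (i : 'I_g) (I : hmod H) : 'M[L]_(hdim I) :=
  emx LA (I (ribbon H) ^+ 2) *m Bmx i I *m mxinv (Amx i I)
    *m mxinv (Bmx i I) *m Amx i I.

Definition Cmx (I : hmod H) : 'M[L]_(hdim I) :=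
  (\prod_(i < g) Chandle i I) * (\prod_(j < n) Mmx j I).

(* A representation of L is a left L-module. *)
Definition Inv (V : lmodType L) : {pred V} := fun w =>
  `[< forall I : hmod H,
        map_mx (fun c : L => c *: w) (Cmx I)
          = map_mx (fun c : L => c *: w) 1%:M >].

End MainDefs.

Arguments Linv {K} H g n.
Arguments Inv {K H g n} V.

(* Main.v *)
(* Idea.  Write R = a ⊗ b and R' = b ⊗ a.  The exchange relations give
   R C_1 R' U_2 = U_2 R C_1 R' for C = C_{g,n} and every generating matrix U, and
   C satisfies the fusion relation of a single generator; for the handle factors
   this is where the normalisation by v^2 enters.  Since H is factorizable,
   C = (id ⊗ mu)(R R') defines a linear map mu from H to L_{g,n}(H), and fusion makes
   it an algebra morphism (a quantum moment map).  The first relation then says that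
   mu(h') (x · h'') = x mu(h) when x is a generator, hence for all x, as both sides
   are compatible with products.  In the convolution algebra of linear maps
   H -> L_{g,n}(H) this reads mu * (x · -) = x mu, where mu is invertible with inverse
   mu ∘ S; so x is invariant if and only if it commutes with the image of mu, that is
   with the entries of C. *)
From HB Require Import structures.
Require Import Defs.
From mathcomp Require Import all_boot all_algebra all_field.
From mathcomp Require Import mxtens boolp classical_sets.
From mathcomp Require Import complex reals.

Set Implicit Arguments.
Unset Strict Implicit.
Unset Printing Implicit Defensive.

Import GRing.Theory.
Local Open Scope ring_scope.

(** In R C_1 R' the exchange relations act differently on the two sides of the position of U:
    earlier blocks commute with U_2 after conjugation by R, later ones after conjugation by R'^{-1},
    and these conjugations telescope. For the fusion of a handle, the fused A and B commute with
    R'R, and separating the two legs in B A^{-1} B^{-1} A costs (R'R)^2; since Δ(v^2) = (R'R)^{-2}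
    (v^2 ⊗ v^2), the factor v^2 pays for it. The obstacle in the multiplicativity of mu is that a
    map known only to be linear does not respect matrix products. R R' satisfies in H the same
    fusion relation as C, but with an R' between the two legs. An identity between R and the
    antipode replaces this inner R' by scalar matrices placed outside, through which a linear map
    does pass. That mu exists at all rests on the naturality of C in the module; everything is then
    tested on the regular module, whose coefficients span the dual of H. Invertibility of A, B, M is
    not part of [Lrel]: it is derived from duality and from the invertible action of u = S(b) a, and
    it also yields mu(1) = 1. *)

(** * Commutation identities in an arbitrary ring *)

Section NoncommutativeIdentities.
Variable M : pzRingType.
Implicit Types (x y u r s : M).

Lemma comm_inv x y yi :
  y * yi = 1 -> yi * y = 1 -> GRing.comm x y -> GRing.comm x yi.
Proof.
move=> yyi yiy xy; rewrite /GRing.comm -[LHS]mul1r -yiy -!mulrA; congr (_ * _).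
by rewrite (mulrA y) -xy -mulrA yyi mulr1.
Qed.

Lemma comm_conj x y r ri : r * ri = 1 -> ri * r = 1 ->
  GRing.comm (r * x * ri) y -> GRing.comm x (ri * y * r).
Proof.
move=> rri rir; rewrite /GRing.comm => h.
transitivity (ri * (r * x * ri * y) * r).
  by rewrite !mulrA rir mul1r.
by rewrite h -!mulrA rir mulr1.
Qed.

Lemma conj_mul x y r ri : ri * r = 1 ->
  r * (x * y) * ri = r * x * ri * (r * y * ri).
Proof.
move=> rir; transitivity (r * (x * (ri * r) * y) * ri); last by rewrite !mulrA.
by rewrite rir mulr1.
Qed.

Lemma conj_prod m (w : 'I_m -> M) r ri : r * ri = 1 -> ri * r = 1 ->
  r * \prod_i w i * ri = \prod_i (r * w i * ri).
Proof.
move=> rri rir; apply: (big_morph (fun x => r * x * ri)) => [x y|].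
  exact: conj_mul.
by rewrite mulr1.
Qed.

(* The factors before the marked one are conjugated by [r], those after it by
   [s^-1]; in the product, consecutive conjugations cancel. *)
Lemma comm_marked_prod m (w : 'I_m -> M) (p : 'I_m) u r ri s si :
  r * ri = 1 -> ri * r = 1 -> s * si = 1 -> si * s = 1 ->
  (forall i : 'I_m, (i < p)%N -> GRing.comm u (r * w i * ri)) ->
  GRing.comm u (r * w p * s) ->
  (forall i : 'I_m, (p < i)%N -> GRing.comm u (si * w i * s)) ->
  GRing.comm u (r * (\prod_i w i) * s).
Proof.
move=> rri rir ssi sis; elim: m w p => [|m IH] w p; first by case: p.
case: (unliftP ord0 p) => [q ->|->] lo at_p hi; rewrite big_ord_recl.
  have -> : r * (w ord0 * \prod_(i < m) w (lift ord0 i)) * s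
    = r * w ord0 * ri * (r * (\prod_(i < m) w (lift ord0 i)) * s).
    by rewrite !mulrA -(mulrA _ ri) rir mulr1.
  apply: commrM; first exact: lo.
  by apply: (IH _ q) => // i qi; [apply: lo | apply: hi]; rewrite !lift0.
have -> : r * (w ord0 * \prod_(i < m) w (lift ord0 i)) * s
  = r * w ord0 * s * (si * (\prod_(i < m) w (lift ord0 i)) * s).
  by rewrite !mulrA -(mulrA _ s) ssi mulr1.
apply: commrM => //; rewrite conj_prod //; apply: commr_prod => i _.
by apply: hi; rewrite lift0.
Qed.

(** * One handle: [r], [s] stand for R, R', and [a1], [a2], [b1], [b2] for the legs of A, B *)

Section Handle.
Variables (r ri s si a1 a1i a2 a2i b1 b1i b2 b2i : M).
Hypotheses (rri : r * ri = 1) (rir : ri * r = 1).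
Hypotheses (ssi : s * si = 1) (sis : si * s = 1).
Hypotheses (a1V : a1 * a1i = 1) (Va1 : a1i * a1 = 1).
Hypotheses (a2V : a2 * a2i = 1) (Va2 : a2i * a2 = 1).
Hypotheses (b1V : b1 * b1i = 1) (Vb1 : b1i * b1 = 1).
Hypotheses (b2V : b2 * b2i = 1) (Vb2 : b2i * b2 = 1).
Hypotheses (ra : r * a1 * s * a2 = a2 * r * a1 * s).
Hypotheses (sa : s * a2 * r * a1 = a1 * s * a2 * r).
Hypotheses (rb : r * b1 * s * b2 = b2 * r * b1 * s).
Hypotheses (sb : s * b2 * r * b1 = b1 * s * b2 * r).
Hypotheses (rh : r * b1 * s * a2 = a2 * r * b1 * ri).
Hypotheses (sh : s * b2 * r * a1 = a1 * s * b2 * si).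

(** The handle matrix without v^2. For reflection v^2 is central and splits off; for fusion it
    contributes the powers of R'R. *)
Let c1 := b1 * a1i * b1i * a1.
Let c2 := b2 * a2i * b2i * a2.

Lemma cancelP x y (h : x * y = 1) z : z * x * y = z.
Proof. by rewrite -mulrA h mulr1. Qed.

Let aiy : a1i * s * a2 * r = s * a2 * r * a1i.
Proof.
rewrite -!mulrA; apply/esym; rewrite !mulrA.
have : GRing.comm (s * a2 * r) a1 by rewrite /GRing.comm !mulrA.
by move/(comm_inv a1V Va1); rewrite /GRing.comm !mulrA.
Qed.
Let biz : b1i * s * b2 * r = s * b2 * r * b1i.
Proof.
have : GRing.comm (s * b2 * r) b1 by rewrite /GRing.comm !mulrA.
by move/(comm_inv b1V Vb1); rewrite /GRing.comm !mulrA.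
Qed.

(** [a2] is pushed leftwards through [a1], [b1i], [a1i], [b1] in turn. Each passage changes the
    braidings around [a2] into those which the next relation requires. *)
Lemma handle_reflectA : r * c1 * s * a2 = a2 * (r * c1 * s).
Proof.
rewrite /c1.
have e1 : a1 * s * a2 = ri * a2 * r * a1 * s.
  by rewrite -[LHS]mul1r -rir -!mulrA; congr (_ * _); rewrite !mulrA ra.
have e2 : b1i * ri * a2 = s * a2 * r * b1i * ri.
  have: b1i * ri * (r * b1 * s * a2) * r * b1i * ri
        = b1i * ri * (a2 * r * b1 * ri) * r * b1i * ri by rewrite rh.
  rewrite !mulrA !(cancelP rir) Vb1 mul1r => ->.
  by rewrite (cancelP b1V) (cancelP rri).
have e3 : r * b1 * s * a2 * r = a2 * r * b1 by rewrite rh (cancelP rir).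
transitivity (r * b1 * a1i * b1i * (a1 * s * a2)); first by rewrite !mulrA.
rewrite e1; transitivity (r * b1 * a1i * (b1i * ri * a2) * r * a1 * s).
  by rewrite !mulrA.
rewrite e2; transitivity (r * b1 * (a1i * s * a2 * r) * b1i * (ri * r) * a1 * s).
  by rewrite !mulrA.
rewrite aiy rir mulr1.
transitivity (r * b1 * s * a2 * r * a1i * b1i * a1 * s); first by rewrite !mulrA.
by rewrite e3 !mulrA.
Qed.

Let a1iz : a1i * s * b2 * r = s * b2 * si * a1i.
Proof.
have : a1i * (s * b2 * r * a1) * a1i = a1i * (a1 * s * b2 * si) * a1i by rewrite sh.
by rewrite !mulrA (cancelP a1V) Va1 mul1r.
Qed.

Lemma handle_reflectB : r * c1 * s * b2 = b2 * (r * c1 * s).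
Proof.
rewrite /c1.
have e1 : a1 * s * b2 = s * b2 * r * a1 * s by rewrite sh (cancelP sis).
transitivity (r * b1 * a1i * b1i * (a1 * s * b2)); first by rewrite !mulrA.
rewrite e1; transitivity (r * b1 * a1i * (b1i * s * b2 * r) * a1 * s).
  by rewrite !mulrA.
rewrite biz; transitivity (r * b1 * (a1i * s * b2 * r) * b1i * a1 * s).
  by rewrite !mulrA.
rewrite a1iz; transitivity (r * b1 * s * b2 * si * a1i * b1i * a1 * s).
  by rewrite !mulrA.
by rewrite rb (cancelP ssi) !mulrA.
Qed.

Let a12 := a1 * s * a2 * si.
Let b12 := b1 * s * b2 * si.
Let a12i := s * a2i * si * a1i.
Let b12i := s * b2i * si * b1i.

Let qcomm u1 u2 : r * u1 * s * u2 = u2 * r * u1 * s ->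
  s * u2 * r * u1 = u1 * s * u2 * r ->
  GRing.comm (s * r) (u1 * s * u2 * si).
Proof.
move=> h1 h2; rewrite /GRing.comm.
transitivity (s * (r * u1 * s * u2) * si); first by rewrite !mulrA.
rewrite h1 !mulrA (cancelP ssi) h2 (cancelP sis) //.
Qed.

(** The double braiding R'R is an endomorphism of the tensor product, so the fused matrix commutes
    with it; algebraically this combines the two reflection equations. *)
Lemma fusion_comm_a : GRing.comm (s * r) a12. Proof. exact: qcomm. Qed.
Lemma fusion_comm_b : GRing.comm (s * r) b12. Proof. exact: qcomm. Qed.

Lemma fusion_inv u1 u1i u2 u2i : u1 * u1i = 1 -> u2 * u2i = 1 ->
  u1 * s * u2 * si * (s * u2i * si * u1i) = 1.
Proof.
move=> h1 h2.
by rewrite !mulrA (cancelP sis) (cancelP h2) (cancelP ssi) h1.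
Qed.
Lemma fusion_invl u1 u1i u2 u2i : u1i * u1 = 1 -> u2i * u2 = 1 ->
  s * u2i * si * u1i * (u1 * s * u2 * si) = 1.
Proof.
move=> h1 h2.
by rewrite !mulrA (cancelP h1) (cancelP sis) (cancelP h2) ssi.
Qed.

(** The prefactor is (R'R)^{-2}. One copy of (R'R)^{-1} separates the legs at the junction of A^{-1}
    and B^{-1}, the other carries [b1] past the leg 2 factors, and reflection for [c1] finishes. *)
Lemma handle_fusion :
  ri * si * (ri * si) * (b12 * a12i * b12i * a12) = c1 * s * c2 * si.
Proof.
have qV : s * r * (ri * si) = 1 by rewrite !mulrA (cancelP rri).
have Vq : ri * si * (s * r) = 1 by rewrite !mulrA (cancelP sis).
have qb : GRing.comm b12 (ri * si).
  exact/(comm_inv qV Vq)/commr_sym/fusion_comm_b.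
have qa : GRing.comm a12 (ri * si).
  exact/(comm_inv qV Vq)/commr_sym/fusion_comm_a.
have qai : GRing.comm (ri * si) a12i.
  apply: comm_inv (commr_sym qa); [exact: fusion_inv | exact: fusion_invl].
(* As (R'R)^{-1} commutes with the fused matrices, one copy can be inserted between [a12i] and
   [b12i]; there its [si] cancels and only [a1i * ri * b2i] is left to reorder. *)
transitivity (ri * si * (b12 * a12i * (ri * si) * b12i * a12)).
  have -> : ri * si * (b12 * a12i * (ri * si) * b12i * a12)
    = ri * si * ((b12 * a12i) * (ri * si)) * b12i * a12 by rewrite !mulrA.
  have <- : ri * si * (b12 * a12i) = b12 * a12i * (ri * si).
    exact/commrM/qai/commr_sym/qb.
  by rewrite !mulrA.
rewrite /a12i /b12i.
have e1 : a1i * ri * b2i = s * b2i * si * a1i * s.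
  have h : ri * b2i * si * a1 = a1 * s * b2i * si.
    have : ri * b2i * si * a1 * (a1i * s * b2 * r) * a1 * s * b2i * si
      = ri * b2i * si * a1 * (s * b2 * si * a1i) * a1 * s * b2i * si.
      by rewrite a1iz.
    rewrite !mulrA (cancelP a1V) (cancelP sis) (cancelP Vb2) rir mul1r => ->.
    by rewrite (cancelP Va1) (cancelP sis) (cancelP b2V) (cancelP ssi).
  have : a1i * (ri * b2i * si * a1) * a1i * s = a1i * (a1 * s * b2i * si) * a1i * s.
    by rewrite h.
  by rewrite !mulrA Va1 mul1r (cancelP a1V) (cancelP sis).
have e2 : si * b1 * s * b2 * a2i * b2i = b2 * a2i * b2i * r * b1 * s.
  have h1 : b2i * r * b1 * s = r * b1 * s * b2i.
    have : GRing.comm (r * b1 * s) b2 by rewrite /GRing.comm !mulrA.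
    by move/(comm_inv b2V Vb2); rewrite /GRing.comm !mulrA.
  have h2 : a2i * r * b1 * s = r * b1 * ri * a2i.
    have : a2i * (r * b1 * s * a2) * a2i = a2i * (a2 * r * b1 * ri) * a2i.
      by rewrite rh.
    by rewrite !mulrA (cancelP a2V) Va2 mul1r.
  have h3 : b2 * r * b1 * ri = si * b1 * s * b2.
    have : si * (s * b2 * r * b1) * ri = si * (b1 * s * b2 * r) * ri by rewrite sb.
    by rewrite !mulrA sis mul1r (cancelP rri).
  transitivity (b2 * a2i * (b2i * r * b1 * s)); last by rewrite !mulrA.
  rewrite h1; transitivity (b2 * (a2i * r * b1 * s) * b2i); last by rewrite !mulrA.
  by rewrite h2 !mulrA h3.
(* The reflection equations make [r * c1 * s] commute with [a2] and [b2], hence with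
   [b2 * a2i * b2i], the first three factors of [c2]. *)
have e3 : b1 * a1i * b1i * a1 * s * b2 * a2i * b2i
    = ri * b2 * a2i * b2i * r * b1 * a1i * b1i * a1 * s.
  have cA : GRing.comm (r * c1 * s) a2 by apply: handle_reflectA.
  have cB : GRing.comm (r * c1 * s) b2 by apply: handle_reflectB.
  have cY : GRing.comm (r * c1 * s) (b2 * a2i * b2i).
    by apply: commrM; [apply: commrM => //; apply: comm_inv cA|apply: comm_inv cB].
  move: (congr1 (fun z => ri * z) cY).
  by rewrite /c1 !mulrA rir mul1r.
transitivity (ri * si * b1 * s * b2 * a2i * si * (a1i * ri * b2i)
    * si * b1i * a1 * s * a2 * si).
  rewrite /b12 /a12 !mulrA.
  by rewrite !(cancelP sis).
rewrite e1; transitivity (ri * (si * b1 * s * b2 * a2i * b2i)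
    * si * a1i * b1i * a1 * s * a2 * si); last first.
  rewrite e2 /c1 /c2 !mulrA e3.
  by rewrite !(cancelP ssi).
by rewrite !mulrA (cancelP sis) (cancelP ssi).
Qed.
End Handle.
End NoncommutativeIdentities.

(** * Natural families of matrices, and scalar matrices on legs *)

Section Naturality.
Variables (K : fieldType) (H : ribbonHopf K) (E : pzAlg K).
Implicit Types I J : hmod H.

Definition hmod_hom I J (F : 'M[K]_(hdim J, hdim I)) :=
  forall h, F *m I h = J h *m F.

(** By [nat_form_mxcoef], the entries of such a family are the values of a single linear map from
    the dual of H on matrix coefficients. *)
Definition natural (N : forall I, 'M[E]_(hdim I)) :=
  forall I J (F : 'M[K]_(hdim J, hdim I)), hmod_hom F ->
    map_mx (pzalg_in E) F *m N I = N J *m map_mx (pzalg_in E) F.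

Lemma natural_mul N N' : natural N -> natural N' ->
  natural (fun I => N I *m N' I).
Proof. by move=> nN nN' I J F hF; rewrite mulmxA nN // -mulmxA nN' // mulmxA. Qed.

Lemma natural_1 : natural (fun I => 1%:M).
Proof. by move=> I J F hF; rewrite mulmx1 mul1mx. Qed.

Lemma natural_prod m (W : 'I_m -> forall I, 'M[E]_(hdim I)) :
  (forall k, natural (W k)) -> natural (fun I => \prod_(k < m) W k I).
Proof.
elim: m W => [|m IH] W nW I J F hF.
  by rewrite !big_ord0; apply: natural_1 hF.
rewrite !big_ord_recl.
have nW' := IH (fun k => W (lift ord0 k)) (fun k => nW _).
exact: (natural_mul (nW ord0) nW' hF).
Qed.

Lemma natural_inv N N' : (forall I, N I *m N' I = 1%:M) ->
  (forall I, N' I *m N I = 1%:M) -> natural N -> natural N'.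
Proof.
move=> h h' nN I J F hF; rewrite -[LHS]mul1mx -(h' J) -mulmxA (mulmxA (N J)).
by rewrite -nN // -!mulmxA h mulmx1.
Qed.

Lemma natural_central (z : H) : (forall h, z * h = h * z) ->
  natural (fun I => emx E (I z)).
Proof. by move=> zC I J F hF; rewrite /emx -!map_mxM hF. Qed.

Lemma emx_tens m n (A : 'M[K]_m) (B : 'M[K]_n) :
  emx E (A *t B) = leg1 _ (emx E A) *m leg2 _ (emx E B).
Proof.
apply/matrixP=> x y; case: (mxtens_indexP x) => i k.
case: (mxtens_indexP y) => j l; rewrite leg12E /emx [LHS]mxE tensmxE !mxE.
by rewrite rmorphM.
Qed.

Lemma emx_leg1 m n (A : 'M[K]_m) : leg1 n (emx E A) = emx E (leg1 n A).
Proof. by rewrite /emx map_leg1. Qed.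
Lemma emx_leg2 m n (A : 'M[K]_n) : leg2 m (emx E A) = emx E (leg2 m A).
Proof. by rewrite /emx map_leg2. Qed.

Lemma emx_mul m (A B : 'M[K]_m) : emx E (A *m B) = emx E A *m emx E B.
Proof. exact: map_mxM. Qed.

Lemma emx_one m : emx E (1%:M : 'M[K]_m) = 1%:M.
Proof. exact: map_mx1. Qed.

Lemma leg_emx_comm m n (A : 'M[K]_m) (N : 'M[E]_n) :
  leg1 n (emx E A) *m leg2 m N = leg2 m N *m leg1 n (emx E A).
Proof. by apply: leg_comm => i j k l; rewrite mxE pzalg_central. Qed.
Lemma emx_leg_comm m n (A : 'M[K]_n) (N : 'M[E]_m) :
  leg1 n N *m leg2 m (emx E A) = leg2 m (emx E A) *m leg1 n N.
Proof. by apply: leg_comm => i j k l; rewrite [emx _ _ _ _]mxE pzalg_central. Qed.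

Lemma RV I J : Rmx E I J *m Rimx E I J = 1%:M.
Proof. by rewrite -emx_mul mulmxV ?emx_one // tact_unit ?rmat_unit. Qed.
Lemma VR I J : Rimx E I J *m Rmx E I J = 1%:M.
Proof. by rewrite -emx_mul mulVmx ?emx_one // tact_unit ?rmat_unit. Qed.
Lemma R'V I J : R'mx E I J *m R'imx E I J = 1%:M.
Proof. by rewrite -emx_mul mulmxV ?emx_one // tact_unit ?tswap_rmat_unit. Qed.
Lemma VR' I J : R'imx E I J *m R'mx E I J = 1%:M.
Proof. by rewrite -emx_mul mulVmx ?emx_one // tact_unit ?tswap_rmat_unit. Qed.

End Naturality.

(** * Exchanging the two legs *)

Section LegSwap.
Variables (m n : nat).

Definition swap_index (x : 'I_(m * n)) : 'I_(n * m) :=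
  mxtens_index ((mxtens_unindex x).2, (mxtens_unindex x).1).

(** Conjugation by the flip. It turns a relation for (J, I) into one for (I, J) with the legs and R,
    R' interchanged. *)
Definition mxswap (E : Type) (M : 'M[E]_(n * m)) : 'M[E]_(m * n) :=
  mxsub swap_index swap_index M.

Lemma swap_indexE i k : swap_index (mxtens_index (i, k)) = mxtens_index (k, i).
Proof. by rewrite /swap_index mxtens_indexK. Qed.

Lemma mxswapM (E : pzRingType) (M N : 'M[E]_(n * m)) :
  mxswap (M *m N) = mxswap M *m mxswap N.
Proof.
apply/matrixP=> x y; rewrite !mxE !sum_mxtens exchange_big /=.
by apply: eq_bigr => i _; apply: eq_bigr => k _; rewrite !mxE swap_indexE.
Qed.

Lemma mxswap_leg1 (E : pzRingType) (M : 'M[E]_n) : mxswap (leg1 m M) = leg2 m M.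
Proof.
apply/matrixP=> x y; case: (mxtens_indexP x) => i k.
by case: (mxtens_indexP y) => j l; rewrite mxE !swap_indexE leg1E leg2E.
Qed.

Lemma mxswap_leg2 (E : pzRingType) (M : 'M[E]_m) : mxswap (leg2 n M) = leg1 n M.
Proof.
apply/matrixP=> x y; case: (mxtens_indexP x) => i k.
by case: (mxtens_indexP y) => j l; rewrite mxE !swap_indexE leg1E leg2E.
Qed.

Lemma mxswap_tens (K : fieldType) (A : 'M[K]_n) (B : 'M[K]_m) :
  mxswap (A *t B) = B *t A.
Proof.
apply/matrixP=> x y; case: (mxtens_indexP x) => i k.
by case: (mxtens_indexP y) => j l; rewrite mxE !swap_indexE !tensmxE mulrC.
Qed.

Lemma mxswap1 (E : pzRingType) : mxswap (1%:M : 'M[E]_(n * m)) = 1%:M.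
Proof. by rewrite -(leg1_1 _ n m) mxswap_leg1 leg2_1. Qed.

Lemma mxswap_linear (K : fieldType) : linear (@mxswap K).
Proof. by move=> c A B; apply/matrixP=> i j; rewrite !mxE. Qed.

Lemma mxswap_map (E E' : Type) (f : E -> E') (M : 'M[E]_(n * m)) :
  mxswap (map_mx f M) = map_mx f (mxswap M).
Proof. by apply/matrixP=> i j; rewrite !mxE. Qed.

End LegSwap.

Section LegSwapR.
Variables (K : fieldType) (H : ribbonHopf K) (E : pzAlg K).
Implicit Types I J : hmod H.

Lemma mxswap_tact I J X : mxswap (tact J I X) = tact I J (tswap X).
Proof.
rewrite (tlift_lin (@mxswap _ _ _)); last exact: mxswap_linear.
rewrite (tlift_lin (tact I J)); last exact: tact_is_linear.
by apply: tlift_eq => a b; rewrite tact_ten mxswap_tens.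
Qed.

Lemma mxswap_R I J : mxswap (Rmx E J I) = R'mx E I J.
Proof. by rewrite mxswap_map mxswap_tact. Qed.
Lemma mxswap_R' I J : mxswap (R'mx E J I) = Rmx E I J.
Proof. by rewrite mxswap_map mxswap_tact tswapK. Qed.

Lemma mxswap_Ri I J : mxswap (Rimx E J I) = R'imx E I J.
Proof.
apply: (@inv_unique _ (R'mx E I J)); last exact: R'V.
by rewrite -mxswap_R -[LHS]mxswapM VR mxswap1.
Qed.
Lemma mxswap_R'i I J : mxswap (R'imx E J I) = Rimx E I J.
Proof.
apply: (@inv_unique _ (Rmx E I J)); last exact: RV.
by rewrite -mxswap_R' -[LHS]mxswapM VR' mxswap1.
Qed.

Definition op_tact I J (h : H) : 'M[K]_(hdim I * hdim J) :=
  tact I J (tswap (coprod H h)).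
Lemma op_tact_linear I J : linear (op_tact I J).
Proof. by move=> c x y; rewrite /op_tact !linearP. Qed.
Lemma op_tact_multiplicative I J : monoid_morphism (op_tact I J).
Proof.
split=> [|x y]; rewrite /op_tact.
  by rewrite rmorph1 [tswap 1]tswapE rmorph1.
by rewrite rmorphM tswapM rmorphM.
Qed.
HB.instance Definition _ I J := GRing.isLinear.Build _ _ _ _ (op_tact I J)
  (op_tact_linear I J).
HB.instance Definition _ I J := GRing.isMonoidMorphism.Build _ _ (op_tact I J)
  (op_tact_multiplicative I J).
(* [J ⊗ I], written on the underlying space of [I ⊗ J]. *)
Definition hmod_optens I J : hmod H := HMod (op_tact I J).

(** This is R Δ = Δ^op R. Keeping the underlying space of I ⊗ J makes R itself, without a flip, a
    module map to which naturality applies. *)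
Lemma braid_hom I J :
  @hmod_hom _ _ (hmod_tens I J) (hmod_optens I J) (tact I J (rmat H)).
Proof.
move=> h; rewrite /= /op_tact -[LHS](rmorphM (tact I J)) -[RHS](rmorphM (tact I J)).
by rewrite rmat_coprod.
Qed.

Lemma braid'_hom I J :
  @hmod_hom _ _ (hmod_optens I J) (hmod_tens I J) (tact I J (tswap (rmat H))).
Proof.
move=> h; rewrite /= /op_tact -[LHS](rmorphM (tact I J)) -[RHS](rmorphM (tact I J)).
by rewrite tswap_rmat_coprod.
Qed.

End LegSwapR.

(** * Relations between generators deduced from the defining ones *)

Section Generators.
Variables (K : fieldType) (H : ribbonHopf K) (g n : nat).
Variables (E : pzAlg K) (X : genfam H g n E).
Implicit Types I J : hmod H.

(** The identity F T = T F already holds between matrices of linear forms on H, and [X s] is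
    linear. *)
Lemma gmx_natural s : natural (gmx X s).
Proof.
move=> I J F hF; apply/matrixP=> i j; rewrite !mxE.
transitivity (X s (\sum_k F i k *: mxcoef k j)).
  by rewrite linear_sum; apply: eq_bigr => k _; rewrite !mxE linearZ.
transitivity (X s (\sum_k F k j *: mxcoef i k)); last first.
  rewrite linear_sum; apply: eq_bigr => k _; rewrite !mxE linearZ /=.
  by rewrite pzscaleE pzalg_central.
congr (X s _); apply/lfunP => h; rewrite !sum_lfunE.
have /matrixP/(_ i j) := hF h; rewrite !mxE => e.
transitivity (\sum_k F i k * I h k j).
  by apply: eq_bigr => k _; rewrite scale_lfunE mxcoefE.
rewrite e; apply: eq_bigr => k _.
by rewrite scale_lfunE mxcoefE mulrC.
Qed.

Lemma gmx_optens s I J :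
  gmx X s (hmod_optens I J) = mxswap (gmx X s (hmod_tens J I)).
Proof.
apply/matrixP=> i j; rewrite !mxE; congr (X s _); apply/lfunP => h.
rewrite !mxcoefE /= /op_tact.
by rewrite -mxswap_tact mxE.
Qed.

Hypothesis hX : Lrel X.

Lemma gmx_optensE s I J : gmx X s (hmod_optens I J)
  = leg2 _ (gmx X s J) *m Rmx E I J *m leg1 _ (gmx X s I) *m Rimx E I J.
Proof.
rewrite gmx_optens lrel_fusion // !mxswapM mxswap_leg1 mxswap_leg2.
by rewrite mxswap_R' mxswap_R'i.
Qed.

(** The reflection equation is naturality along the braiding R, with both tensor products expanded
    by fusion. *)
Lemma gmx_reflect s I J :
  Rmx E I J *m leg1 _ (gmx X s I) *m R'mx E I J *m leg2 _ (gmx X s J)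
  = leg2 _ (gmx X s J) *m Rmx E I J *m leg1 _ (gmx X s I) *m R'mx E I J.
Proof.
have := gmx_natural s (braid_hom I J).
rewrite gmx_optensE lrel_fusion // -/(emx _ _) -/(Rmx E I J) !mulmxA.
rewrite -(mulmxA _ (Rimx E I J)) VR mulmx1 => /(congr1 (mulmx^~ (R'mx E I J))).
by rewrite -(mulmxA _ (R'imx E I J)) VR' mulmx1.
Qed.

Lemma gmx_reflect' s I J :
  R'mx E I J *m leg2 _ (gmx X s J) *m Rmx E I J *m leg1 _ (gmx X s I)
  = leg1 _ (gmx X s I) *m R'mx E I J *m leg2 _ (gmx X s J) *m Rmx E I J.
Proof.
have := gmx_natural s (braid'_hom I J).
rewrite gmx_optensE lrel_fusion // -/(emx _ _) -/(R'mx E I J) !mulmxA.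
rewrite -(mulmxA _ (R'imx E I J)) VR' mulmx1 => /(congr1 (mulmx^~ (Rmx E I J))).
by rewrite -(mulmxA _ (Rimx E I J)) VR mulmx1.
Qed.

(** The flip puts the generator of lower position on leg 2: this is the form needed for blocks of C
    that come after a given generator. *)
Lemma gmx_exchange' s t I J : (gen_pos s < gen_pos t)%N ->
  R'mx E I J *m leg2 _ (gmx X s J) *m R'imx E I J *m leg1 _ (gmx X t I)
  = leg1 _ (gmx X t I) *m R'mx E I J *m leg2 _ (gmx X s J) *m R'imx E I J.
Proof.
move=> st; have /(congr1 (@mxswap _ _ _)) := lrel_exchange hX J I st.
by rewrite !mxswapM !mxswap_leg1 !mxswap_leg2 mxswap_R mxswap_Ri.
Qed.

Lemma gmx_handle' i I J :
  R'mx E I J *m leg2 _ (gmx X (GenB n i) J) *m Rmx E I J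
    *m leg1 _ (gmx X (GenA n i) I)
  = leg1 _ (gmx X (GenA n i) I) *m R'mx E I J
    *m leg2 _ (gmx X (GenB n i) J) *m R'imx E I J.
Proof.
have /(congr1 (@mxswap _ _ _)) := lrel_handle hX i J I.
by rewrite !mxswapM !mxswap_leg1 !mxswap_leg2 mxswap_R mxswap_R' mxswap_Ri.
Qed.

End Generators.

(** * Antimultiplicativity of the antipode, and dual modules *)

Section AlgebraAsPz.
Variables (K : fieldType) (A : falgType K).
Fact falg_central c (x : A) : c%:A * x = x * c%:A.
Proof. by rewrite -scalerAl mul1r -scalerAr mulr1. Qed.
Definition falg_pz : pzAlg K := @PzAlg K A (in_alg A) falg_central.
Lemma falg_pzZ c (x : A) : c *: (x : pzmod falg_pz) = c *: x.
Proof. by rewrite pzscaleE /= -scalerAl mul1r. Qed.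
Lemma falg_pz_linear (V : lmodType K) (f : V -> A) :
  linear f -> linear (f : V -> pzmod falg_pz).
Proof. by move=> hf c x y; rewrite hf falg_pzZ. Qed.
Lemma falg_pz_tlift (B C : vectType K) (f : B -> C -> A) X :
  tlift (f : B -> C -> pzmod falg_pz) X = tlift f X.
Proof. by apply: eq_bigr => i _; apply: eq_bigr => j _; rewrite falg_pzZ. Qed.
End AlgebraAsPz.

Section Antipode.
Variables (K : fieldType) (H : hopfAlgType K).
Local Notation S := (antipode H).
Local Notation E0 := (falg_pz H).
Local Notation E1 := (convAlg H E0).
Local Notation E2 := (convAlg H E1).

(** Iterating the convolution algebra gives the convolution of bilinear maps H × H -> H, that is, of
    linear maps on H ⊗ H. *)
Let cv2 (f : H -> H -> H) : E2 :=
  cmk (fun x => cmk (fun y => f x y : pzmod E0) : pzmod E1).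

Let cev2 (F : E2) x y : H := cev (cev F x : E1) y.

Let cv2E f x y : bilin f -> cev2 (cv2 f) x y = f x y.
Proof.
case=> f1 f2; rewrite /cev2 cmkE; last first.
  move=> c u v; apply: cev_ext => h; rewrite cevD cevZ !cmkE.
  - by rewrite f1 falg_pzZ.
  - exact/falg_pz_linear/f2.
  - exact/falg_pz_linear/f2.
  - exact/falg_pz_linear/f2.
by rewrite cmkE //; apply/falg_pz_linear/f2.
Qed.

Let cev2_ext F G : (forall x y, cev2 F x y = cev2 G x y) -> F = G.
Proof. by move=> FG; apply: cev_ext => x; apply: cev_ext => y; apply: FG. Qed.

Let cev2M F G x y : cev2 (F * G) x y =
  \sw_(a, b <- coprod H x) \sw_(c, d <- coprod H y) (cev2 F a c * cev2 G b d).
Proof.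
rewrite /cev2 cevM (tlift_lin (fun f : pzmod E1 => cev f y)); last first.
  by move=> c u v; rewrite cevD cevZ.
rewrite falg_pz_tlift; apply: tlift_eq => a b.
by rewrite cevM falg_pz_tlift.
Qed.

Let cev2_1 x y : cev2 1 x y = counit H x * counit H y *: 1.
Proof.
rewrite /cev2 [cev (1 : E2) x]cinE cevZ [cev _ y]cinE rmorph1.
by rewrite !falg_pzZ scalerA.
Qed.

(** For the convolution of bilinear maps, S(xy) is a left inverse and S(y)S(x) a right inverse of
    the multiplication, so they agree. *)
Lemma antipodeM x y : S (x * y) = S y * S x.
Proof.
have bS : bilin (fun x y => S (x * y)).
  by split=> [b|a] c u v; rewrite ?mulrDl ?mulrDr -?scalerAl -?scalerAr linearP.
have bM : bilin (fun x y : H => x * y).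
  by split=> [b|a] c u v; rewrite ?mulrDl ?mulrDr -?scalerAl -?scalerAr.
have bSS : bilin (fun x y => S y * S x).
  by split=> [b|a] c u v; rewrite linearP ?mulrDl ?mulrDr -?scalerAl -?scalerAr.
rewrite -(cv2E x y bS) -(cv2E x y bSS); congr (cev2 _ x y).
apply: (@inv_unique E2 (cv2 (fun x y : H => x * y))); apply: cev2_ext => {}x {}y.
  rewrite cev2M cev2_1 -rmorphM /= -antipodel rmorphM [_ * coprod H y]/(tmul _ _).
  rewrite /tmul (tlift_lin (tlift (fun a b => S a * b))) /=; last first.
    by move=> c u v; rewrite linearP.
  apply: tlift_eq => a b.
  rewrite (tlift_lin (tlift (fun a b => S a * b))) /=; last first.
    by move=> c u v; rewrite linearP.
  apply: tlift_eq => c d; rewrite !cv2E // tlift_ten //.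
  by split=> [k|k] l u v; rewrite ?linearP ?mulrDl ?mulrDr -?scalerAl -?scalerAr.
rewrite cev2M cev2_1.
transitivity (\sw_(a, b <- coprod H x) (counit H y *: (a * S b))).
  apply: tlift_eq => a b.
  transitivity (\sw_(c, d <- coprod H y) (a * (c * S d) * S b)).
    by apply: tlift_eq => c d; rewrite !cv2E // !mulrA.
  rewrite -(tlift_lin (fun z => a * z * S b) (fun c d => c * S d)); last first.
    by move=> l u v; rewrite mulrDr mulrDl -scalerAr -scalerAl.
  by rewrite antipoder -scalerAr mulr1 -scalerAl.
rewrite -(tlift_lin (fun z => counit H y *: z) (fun a b => a * S b)).
  by rewrite antipoder scalerA mulrC.
by move=> l u v; rewrite scalerDr !scalerA mulrC.
Qed.

Lemma antipode1 : S 1 = 1.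
Proof.
have := antipodel (1 : H); rewrite !rmorph1 scale1r [1 in LHS]ten_one.
rewrite tlift_ten ?mulr1 //.
by split=> [k|k] l u v; rewrite ?linearP ?mulrDl ?mulrDr -?scalerAl -?scalerAr.
Qed.

Variable I : hmod H.

Definition dual_act (h : H) : 'M[K]_(hdim I) := (I (S h))^T.
Lemma dual_act_linear : linear dual_act.
Proof. by move=> c x y; rewrite /dual_act !linearP. Qed.
Lemma dual_act_multiplicative : monoid_morphism dual_act.
Proof.
split=> [|x y]; rewrite /dual_act ?antipode1 ?rmorph1 ?trmx1 //.
by rewrite antipodeM rmorphM trmx_mul.
Qed.
HB.instance Definition _ := GRing.isLinear.Build _ _ _ _ dual_act dual_act_linear.
HB.instance Definition _ := GRing.isMonoidMorphism.Build _ _ dual_act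
  dual_act_multiplicative.
Definition hmod_dual : hmod H := HMod dual_act.

End Antipode.

Lemma tlift_mxE (K : fieldType) (A B : vectType K) p q
    (f : A -> B -> 'M[K]_(p, q)) X i j :
  tlift f X i j = tlift (fun a b => f a b i j : K^o) X.
Proof.
rewrite /tlift summxE; apply: eq_bigr => k _; rewrite summxE.
by apply: eq_bigr => l _; rewrite mxE.
Qed.

(** * Invertibility of the generating matrices, by duality *)

Section Duality.
Variables (K : fieldType) (H : ribbonHopf K) (I : hmod H).
Local Notation m := (hdim I).
Local Notation I' := (hmod_dual I).

Definition coev_mx : 'M[K]_(m * m, 1) :=
  \matrix_(x, _) ((mxtens_unindex x).1 == (mxtens_unindex x).2)%:R.
Definition ev_mx : 'M[K]_(1, m * m) := coev_mx^T.

Lemma coev_mxE i k j : coev_mx (mxtens_index (i, k)) j = (i == k)%:R.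
Proof. by rewrite mxE mxtens_indexK. Qed.
Lemma ev_mxE i k j : ev_mx j (mxtens_index (i, k)) = (i == k)%:R.
Proof. by rewrite mxE coev_mxE. Qed.

Lemma tens_coev (A B : 'M[K]_m) i k j :
  ((A *t B) *m coev_mx) (mxtens_index (i, k)) j = (A *m B^T) i k.
Proof.
rewrite !mxE sum_mxtens; apply: eq_bigr => a _.
rewrite (bigD1 a) //= tensmxE coev_mxE eqxx mulr1 mxE big1 ?addr0 // => b ba.
by rewrite coev_mxE eq_sym (negPf ba) mulr0.
Qed.

Lemma ev_tens (A B : 'M[K]_m) i k j :
  (ev_mx *m (A *t B)) j (mxtens_index (i, k)) = (A^T *m B) i k.
Proof.
rewrite !mxE sum_mxtens; apply: eq_bigr => a _.
rewrite (bigD1 a) //= tensmxE ev_mxE eqxx mul1r mxE big1 ?addr0 // => b ba.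
by rewrite ev_mxE eq_sym (negPf ba) mul0r.
Qed.

Lemma coev_hom : @hmod_hom _ _ (hmod_triv H) (hmod_tens I I') coev_mx.
Proof.
move=> h; rewrite /= /tact (tlift_lin (mulmx^~ coev_mx)); last first.
  by move=> c u v; rewrite mulmxDl scalemxAl.
apply/matrixP=> x j; case: (mxtens_indexP x) => i k.
rewrite tlift_mxE.
transitivity (\sw_(a, b <- coprod H h) (I (a * antipode H b) i k : K^o)).
  rewrite -(tlift_lin (fun y => I y i k : K^o) (fun a b => a * antipode H b)).
    rewrite antipoder linearZ /= rmorph1 /triv_act.
    rewrite mxE big_ord1 coev_mxE !mxE !ord1 mulr1n mulrC.
    by [].
  by move=> c u v; rewrite linearP !mxE.
by apply: (@tlift_eq K H H K^o) => a b; rewrite tens_coev /dual_act trmxK rmorphM.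
Qed.

Lemma ev_hom : @hmod_hom _ _ (hmod_tens I' I) (hmod_triv H) ev_mx.
Proof.
move=> h; rewrite /= /tact (tlift_lin (mulmx ev_mx)); last first.
  by move=> c u v; rewrite mulmxDr scalemxAr.
apply/matrixP=> j x; case: (mxtens_indexP x) => i k.
rewrite tlift_mxE.
transitivity (\sw_(a, b <- coprod H h) (I (antipode H a * b) i k : K^o)).
  by apply: (@tlift_eq K H H K^o) => a b; rewrite ev_tens /dual_act trmxK rmorphM.
rewrite -(tlift_lin (fun y => I y i k : K^o) (fun a b => antipode H a * b)).
  rewrite antipodel linearZ /= rmorph1 /triv_act.
  by rewrite [RHS]mxE big_ord1 ev_mxE !mxE !ord1 mulr1n.
by move=> c u v; rewrite linearP !mxE.
Qed.

Definition drinfeld_elt : H := \sw_(a, b <- rmat H) (antipode H b * a).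

Lemma ev_R' i k j : (ev_mx *m tact I' I (tswap (rmat H))) j (mxtens_index (i, k))
  = I drinfeld_elt i k.
Proof.
rewrite (tlift_lin (tact I' I)); last exact: tact_is_linear.
rewrite (tlift_lin (mulmx ev_mx)); last first.
  by move=> c u v; rewrite mulmxDr scalemxAr.
rewrite tlift_mxE.
rewrite [RHS](tlift_lin (fun y => I y i k : K^o)); last first.
  by move=> c u v; rewrite linearP !mxE.
by apply: (@tlift_eq K H H K^o) => a b; rewrite tact_ten ev_tens /dual_act trmxK rmorphM.
Qed.

(** Since v^2 = u S(u) is invertible, u has a right inverse; for square matrices over a field this
    is enough. *)
Lemma drinfeld_unit : I drinfeld_elt \in unitmx.
Proof.
have e := ribbon_sq H; rewrite /= -/drinfeld_elt in e.
have /mulmx1_unit[] // : I drinfeld_elt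
    *m I (antipode H drinfeld_elt * (ribbon H ^+ 2)^-1) = 1%:M.
rewrite -[LHS](rmorphM I) mulrA -e mulrV ?rmorph1 //.
by rewrite unitrX // ribbon_unit.
Qed.

Variables (g n : nat) (E : pzAlg K) (X : genfam H g n E).
Hypothesis hX : Lrel X.

(** Naturality along coevaluation, with the tensor product fused, says that U_1 times some column is
    the coevaluation. Reshaped into a square matrix, that column is a right inverse. *)
Lemma gmx_rinv s : exists Y, gmx X s I *m Y = 1%:M.
Proof.
have := gmx_natural X s coev_hom.
rewrite lrel_triv // mulmx1 lrel_fusion // -!mulmxA.
move: (mulmx (R'mx _ _ _) _) => y e.
exists (\matrix_(i, k) y (mxtens_index (i, k)) ord0); apply/matrixP => i k.
have /matrixP/(_ (mxtens_index (i, k)) ord0) := e.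
rewrite mxE coev_mxE => e'; rewrite [RHS]mxE -[RHS](rmorph_nat (pzalg_in E)) e'.
rewrite !mxE sum_mxtens; apply: eq_bigr => a _.
rewrite (bigD1 k) //= leg1E eqxx mulr1n !mxE big1 ?addr0 // => b bk.
by rewrite leg1E eq_sym (negPf bk) mul0r.
Qed.

(** Evaluation leaves R'^{-1} on the right of U_2. Cancelling it produces ev R', which is the matrix
    of u, so a left inverse appears only after dividing by the action of u. *)
Lemma gmx_linv s : exists Y, Y *m gmx X s I = 1%:M.
Proof.
have := gmx_natural X s ev_hom.
rewrite lrel_triv // mul1mx lrel_fusion // => /(congr1 (mulmx^~ (R'mx E I' I))).
rewrite !mulmxA -(mulmxA _ (R'imx _ _ _)) VR' mulmx1 -map_mxM.
move: (mulmx (mulmx _ _) (R'mx _ _ _)) => y e.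
pose Y : 'M[E]_m := \matrix_(k, l) y ord0 (mxtens_index (k, l)).
have eY : Y *m gmx X s I = emx E (I drinfeld_elt).
  apply/matrixP => i k; have /matrixP/(_ ord0 (mxtens_index (i, k))) := e.
  rewrite [in RHS]mxE ev_R' => e'; rewrite [RHS]mxE -e'.
  rewrite !mxE sum_mxtens [RHS](bigD1 i) //= [X in _ = _ + X]big1 ?addr0.
    by apply: eq_bigr => a _; rewrite leg2E eqxx mulr1n mxE.
  by move=> b bi; rewrite big1 // => a _; rewrite leg2E (negPf bi) mulr0.
exists (emx E (invmx (I drinfeld_elt)) *m Y).
by rewrite -mulmxA eY -emx_mul mulVmx ?drinfeld_unit // emx_one.
Qed.

Lemma gmx_inv s : exists Y, gmx X s I *m Y = 1%:M /\ Y *m gmx X s I = 1%:M.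
Proof.
have [Y eY] := gmx_rinv s; have [Z eZ] := gmx_linv s; exists Y; split=> //.
by rewrite -(inv_unique eZ eY).
Qed.

End Duality.

(** Each [s * w2 i * si] is moved right past all later [w1 j], after which consecutive [si] and [s]
    cancel. *)
Lemma fusion_prod (M : pzRingType) m (w1 w2 : 'I_m -> M) s si :
  s * si = 1 -> si * s = 1 ->
  (forall i j : 'I_m, (i < j)%N -> GRing.comm (s * w2 i * si) (w1 j)) ->
  \prod_i (w1 i * s * w2 i * si) = \prod_i w1 i * s * \prod_i w2 i * si.
Proof.
move=> ssi sis; elim: m w1 w2 => [|m IH] w1 w2 w12.
  by rewrite !big_ord0 mul1r mulr1 ssi.
rewrite !big_ord_recl IH => [|i j ij]; last by apply: w12; rewrite !lift0.
set p1 := \prod_(i < m) w1 _; set p2 := \prod_(i < m) w2 _.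
have c : GRing.comm (s * w2 ord0 * si) p1.
  by apply: commr_prod => i _; apply: w12; rewrite lift0.
transitivity (w1 ord0 * (s * w2 ord0 * si * p1) * s * p2 * si).
  by rewrite !mulrA.
by rewrite c !mulrA (cancelP sis).
Qed.

(** * The ribbon element on tensor products *)

Section RibbonElement.
Variables (K : fieldType) (H : ribbonHopf K) (E : pzAlg K).
Implicit Types I J : hmod H.
Local Notation v := (ribbon H).
Local Notation V I := (emx E (I v ^+ 2)).

Lemma ten_central (X : tens H H) (z z' : H) :
  (forall h, z * h = h * z) ->
  (forall h, z' * h = h * z') -> (z ⊗ z') * X = X * (z ⊗ z').
Proof.
move=> zC z'C; elim/tens_ind: X => [|a b|X Y eX eY].
- by rewrite mul0r mulr0.
- by rewrite !ten_mul zC z'C.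
- by rewrite mulrDl mulrDr eX eY.
Qed.

Lemma tact_inv I J X : X \is a GRing.unit -> tact I J X^-1 = invmx (tact I J X).
Proof.
move=> uX; rewrite -[LHS]mulmx1 -(mulmxV (tact_unit I J uX)) mulmxA.
by rewrite -[tact I J _ *m _](rmorphM (tact I J)) mulVr // rmorph1 mul1mx.
Qed.

Lemma ribbon2_central h : v ^+ 2 * h = h * v ^+ 2.
Proof.
by rewrite expr2 -[LHS]mulrA (ribbon_central h) mulrA (ribbon_central h) mulrA.
Qed.

Lemma hact_ribbon I : I v ^+ 2 = I (v ^+ 2).
Proof. by rewrite rmorphXn. Qed.

Lemma natural_ribbon : natural (fun I : hmod H => V I).
Proof.
move=> I J F hF; rewrite !hact_ribbon.
by apply: natural_central hF; apply: ribbon2_central.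
Qed.

Lemma ribbon_leg1_tact I J X : GRing.comm (leg1 _ (V I)) (emx E (tact I J X)).
Proof.
rewrite /GRing.comm emx_leg1 -[LHS]emx_mul -[RHS]emx_mul; congr (emx E _).
rewrite hact_ribbon /leg1.
have -> : I (v ^+ 2) *t (1%:M : 'M[K]_(hdim J)) = tact I J ((v ^+ 2) ⊗ 1).
  rewrite tact_ten; congr (_ *t _); exact/esym/rmorph1.
rewrite -[LHS](rmorphM (tact I J)) -[RHS](rmorphM (tact I J)) ten_central //.
  exact: ribbon2_central.
by move=> h; rewrite mul1r mulr1.
Qed.

Lemma ribbon_leg2_tact I J X : GRing.comm (leg2 _ (V J)) (emx E (tact I J X)).
Proof.
rewrite /GRing.comm emx_leg2 -[LHS]emx_mul -[RHS]emx_mul; congr (emx E _).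
rewrite hact_ribbon /leg2.
have -> : (1%:M : 'M[K]_(hdim I)) *t J (v ^+ 2) = tact I J (1 ⊗ (v ^+ 2)).
  rewrite tact_ten; congr (_ *t _); exact/esym/rmorph1.
rewrite -[LHS](rmorphM (tact I J)) -[RHS](rmorphM (tact I J)) ten_central //.
  by move=> h; rewrite mul1r mulr1.
exact: ribbon2_central.
Qed.

(** Squaring Δ(v), with v ⊗ v central, gives (R'R)^{-1} twice: exactly the two copies that
    [handle_fusion] consumes. *)
Lemma ribbon_tens I J : V (hmod_tens I J)
  = Rimx E I J *m R'imx E I J *m (Rimx E I J *m R'imx E I J)
    *m (leg1 _ (V I) *m leg2 _ (V J)).
Proof.
rewrite -emx_tens -!emx_mul; congr (emx E _).
rewrite hact_ribbon expr2 [hact _ _]/= (rmorphM (coprod H)) /= ribbon_coprod.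
rewrite invrM ?tswap_rmat_unit ?rmat_unit //.
set q := (_^-1 * _^-1).
have -> : q * (v ⊗ v) * (q * (v ⊗ v)) = q * q * ((v ^+ 2) ⊗ (v ^+ 2)).
  rewrite [LHS]mulrA -(mulrA q).
  rewrite (ten_central q (@ribbon_central _ H) (@ribbon_central _ H)).
  by rewrite [q * (q * _)]mulrA -[LHS]mulrA ten_mul.
rewrite /q -!tact_inv ?tswap_rmat_unit ?rmat_unit //.
by rewrite !(rmorphM (tact I J)) /= tact_ten !hact_ribbon.
Qed.

End RibbonElement.

(** * The ordered factors of C *)

Section CMatrices.
Variables (K : fieldType) (H : ribbonHopf K) (g n : nat).
Local Notation L := (Lgn H g n).
Local Notation LA := (LgnAlg H g n).
Local Notation LF := (@Lfam K H g n).
Implicit Types I J : hmod H.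
Local Notation V I := (emx LA (I (ribbon H) ^+ 2)).
Local Notation hL := (Lfam_rel H g n).

Lemma mxinvP m (M : 'M[L]_m) : (exists N, M *m N = 1%:M /\ N *m M = 1%:M) ->
  M *m mxinv M = 1%:M /\ mxinv M *m M = 1%:M.
Proof.
move=> [N hN]; apply: (@xgetPex _ 0 [set N | M *m N = 1%:M /\ N *m M = 1%:M]%classic).
by exists N.
Qed.

Lemma AmxV (i : 'I_g) I : Amx n i I *m mxinv (Amx n i I) = 1%:M.
Proof. by have [] := mxinvP (gmx_inv I hL (GenA n i)). Qed.
Lemma VAmx (i : 'I_g) I : mxinv (Amx n i I) *m Amx n i I = 1%:M.
Proof. by have [] := mxinvP (gmx_inv I hL (GenA n i)). Qed.
Lemma BmxV (i : 'I_g) I : Bmx n i I *m mxinv (Bmx n i I) = 1%:M.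
Proof. by have [] := mxinvP (gmx_inv I hL (GenB n i)). Qed.
Lemma VBmx (i : 'I_g) I : mxinv (Bmx n i I) *m Bmx n i I = 1%:M.
Proof. by have [] := mxinvP (gmx_inv I hL (GenB n i)). Qed.

(** Handles and punctures are indexed together, so that the order of the factors is the order of
    [gen_pos] in the exchange relations. *)
Definition block (k : 'I_(g + n)) I : 'M[LA]_(hdim I) :=
  match split k with inl i => Chandle n i I | inr j => Mmx g j I end.

Definition gen_block (s : gen g n) : 'I_(g + n) :=
  match s with GenA i | GenB i => lshift n i | GenM j => rshift g j end.

Lemma gen_blockE s : gen_block s = gen_pos s :> nat.
Proof. by case: s. Qed.

Lemma block_lshift i I : block (lshift n i) I = Chandle n i I.
Proof. by rewrite /block (unsplitK (inl i)). Qed.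
Lemma block_rshift j I : block (rshift g j) I = Mmx g j I.
Proof. by rewrite /block (unsplitK (inr j)). Qed.

Lemma Cmx_blocks I : Cmx g n I = \prod_(k < g + n) block k I.
Proof.
rewrite big_split_ord; congr (_ * _); apply: eq_bigr => k _.
  by rewrite block_lshift.
by rewrite block_rshift.
Qed.

Lemma natural_block k : natural (block k).
Proof.
rewrite /block; case: (split k) => [i|j]; last exact: gmx_natural.
have nA := gmx_natural LF (GenA n i); have nB := gmx_natural LF (GenB n i).
have nAi : natural (fun I => mxinv (Amx n i I) : 'M[LA]_(hdim I)).
  exact: (@natural_inv _ _ LA _ (fun I => mxinv (Amx n i I)) (AmxV i) (VAmx i) nA).
have nBi : natural (fun I => mxinv (Bmx n i I) : 'M[LA]_(hdim I)).
  exact: (@natural_inv _ _ LA _ (fun I => mxinv (Bmx n i I)) (BmxV i) (VBmx i) nB).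
have nV := natural_ribbon (H := H) LA.
exact: (natural_mul (natural_mul (natural_mul (natural_mul nV nB) nAi) nBi) nA).
Qed.

Lemma natural_C : natural (Cmx g n : forall I, 'M[LA]_(hdim I)).
Proof.
by move=> I J F hF; rewrite !Cmx_blocks; apply: (natural_prod natural_block hF).
Qed.

(** [f] will be a leg embedding, possibly followed by conjugation by a braiding. A block is a word
    in v^2, its generators and their inverses, and [comm_inv] deals with the inverses. *)
Lemma comm_block k I (M : pzRingType) (f : 'M[L]_(hdim I) -> M) (y : M) :
  f 1%:M = 1 -> (forall A B, f (A *m B) = f A * f B) ->
  GRing.comm y (f (V I)) ->
  (forall s, gen_block s = k -> GRing.comm y (f (gmx LF s I))) ->
  GRing.comm y (f (block k I)).
Proof.
move=> f1 fM yV yU; have [[i ek]|[j ek]] : (exists i, k = lshift n i)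
    \/ (exists j, k = rshift g j).
- by rewrite -(splitK k); case: (split k) => i; [left|right]; exists i.
- rewrite ek block_lshift /Chandle !fM.
  have yA : GRing.comm y (f (Amx n i I)) by apply: (yU (GenA n i)); rewrite ek.
  have yB : GRing.comm y (f (Bmx n i I)) by apply: (yU (GenB n i)); rewrite ek.
  apply: commrM => //; apply: commrM; first apply: commrM; first exact: commrM.
    by apply: comm_inv yA; rewrite -fM ?AmxV ?VAmx.
  by apply: comm_inv yB; rewrite -fM ?BmxV ?VBmx.
- by rewrite ek block_rshift; apply: (yU (GenM g j)); rewrite ek.
Qed.

End CMatrices.

(** * From generators to C: reflection and fusion for a fixed pair of modules *)

Section CPair.
Variables (K : fieldType) (H : ribbonHopf K) (g n : nat).
Local Notation LA := (LgnAlg H g n).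
Local Notation LF := (@Lfam K H g n).
Local Notation hL := (Lfam_rel H g n).
Variables (I J : hmod H).
Local Notation V I := (emx LA (I (ribbon H) ^+ 2)).
Local Notation M := ('M[LA]_(hdim I * hdim J)).
(* Abstract copies of the matrices [R], [R'] and of the two leg embeddings: unification
   would unfold the concrete ones. *)
Variables (r ri s si : M) (l1 : 'M[LA]_(hdim I) -> M) (l2 : 'M[LA]_(hdim J) -> M).

Hypothesis rri : r * ri = 1.
Hypothesis rir : ri * r = 1.
Hypothesis ssi : s * si = 1.
Hypothesis sis : si * s = 1.
Hypothesis l11 : l1 1%:M = 1.
Hypothesis l21 : l2 1%:M = 1.
Hypothesis l1M : forall A B, l1 (A *m B) = l1 A * l1 B.
Hypothesis l2M : forall A B, l2 (A *m B) = l2 A * l2 B.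

Hypothesis V1r : GRing.comm (l1 (V I)) r.
Hypothesis V1s : GRing.comm (l1 (V I)) s.
Hypothesis V2r : GRing.comm (l2 (V J)) r.
Hypothesis V2s : GRing.comm (l2 (V J)) s.
Let V1ri : GRing.comm (l1 (V I)) ri. Proof. exact: comm_inv rri rir V1r. Qed.
Let V1si : GRing.comm (l1 (V I)) si. Proof. exact: comm_inv ssi sis V1s. Qed.
Let V2ri : GRing.comm (l2 (V J)) ri. Proof. exact: comm_inv rri rir V2r. Qed.
Let V2si : GRing.comm (l2 (V J)) si. Proof. exact: comm_inv ssi sis V2s. Qed.
Hypothesis V1l2 : forall A, GRing.comm (l1 (V I)) (l2 A).
Hypothesis V2l1 : forall A, GRing.comm (l2 (V J)) (l1 A).
Let conjr1 : r * l1 1%:M * ri = 1. Proof. by rewrite l11 mulr1. Qed.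
Let conjrM A B : r * l1 (A *m B) * ri = r * l1 A * ri * (r * l1 B * ri).
Proof. by rewrite l1M conj_mul. Qed.
Let conjs1 : si * l1 1%:M * s = 1. Proof. by rewrite l11 mulr1. Qed.
Let conjsM A B : si * l1 (A *m B) * s = si * l1 A * s * (si * l1 B * s).
Proof. by rewrite l1M conj_mul. Qed.
Let conjrV : r * l1 (V I) * ri = l1 (V I).
Proof. by rewrite -V1r -mulrA rri mulr1. Qed.
Let conjsV : si * l1 (V I) * s = l1 (V I).
Proof. by rewrite -V1si -mulrA sis mulr1. Qed.

Hypothesis exch : forall t u, (gen_pos t < gen_pos u)%N ->
  GRing.comm (r * l1 (gmx LF t I) * ri) (l2 (gmx LF u J)).

Hypothesis exch' : forall t u, (gen_pos t < gen_pos u)%N ->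
  GRing.comm (s * l2 (gmx LF t J) * si) (l1 (gmx LF u I)).

Let block_lo (k : 'I_(g + n)) u : (k < gen_block u)%N ->
  GRing.comm (l2 (gmx LF u J)) (r * l1 (block k I) * ri).
Proof.
move=> ku; apply: (comm_block (f := fun A => r * l1 A * ri)) => //.
  by rewrite conjrV; apply/commr_sym/V1l2.
move=> t tk; apply/commr_sym/exch.
by rewrite -!gen_blockE tk.
Qed.

Let block_hi (k : 'I_(g + n)) u : (gen_block u < k)%N ->
  GRing.comm (l2 (gmx LF u J)) (si * l1 (block k I) * s).
Proof.
move=> ku; apply: (comm_block (f := fun A => si * l1 A * s)) => //.
  by rewrite conjsV; apply/commr_sym/V1l2.
(* The flipped exchange conjugates leg 2 by R'; [comm_conj] transfers this to leg 1 as conjugation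
   by R'^{-1}. *)
move=> t tk; apply: comm_conj => //; apply: exch'.
by rewrite -!gen_blockE tk.
Qed.

Let l1V A Ai : A *m Ai = 1%:M -> l1 A * l1 Ai = 1.
Proof. by move=> e; rewrite -l1M e. Qed.
Let l2V A Ai : A *m Ai = 1%:M -> l2 A * l2 Ai = 1.
Proof. by move=> e; rewrite -l2M e. Qed.

Hypothesis reflect : forall t, r * l1 (gmx LF t I) * s * l2 (gmx LF t J)
  = l2 (gmx LF t J) * r * l1 (gmx LF t I) * s.
Hypothesis reflect' : forall t, s * l2 (gmx LF t J) * r * l1 (gmx LF t I)
  = l1 (gmx LF t I) * s * l2 (gmx LF t J) * r.
Hypothesis hdl : forall i, r * l1 (Bmx n i I) * s * l2 (Amx n i J)
  = l2 (Amx n i J) * r * l1 (Bmx n i I) * ri.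
Hypothesis hdl' : forall i, s * l2 (Bmx n i J) * r * l1 (Amx n i I)
  = l1 (Amx n i I) * s * l2 (Bmx n i J) * si.

Let l1_handle i : l1 (Chandle n i I) = l1 (V I) * (l1 (Bmx n i I)
  * l1 (mxinv (Amx n i I)) * l1 (mxinv (Bmx n i I)) * l1 (Amx n i I)).
Proof. by rewrite /Chandle !l1M !mulrA. Qed.
Let l2_handle i : l2 (Chandle n i J) = l2 (V J) * (l2 (Bmx n i J)
  * l2 (mxinv (Amx n i J)) * l2 (mxinv (Bmx n i J)) * l2 (Amx n i J)).
Proof. by rewrite /Chandle !l2M !mulrA. Qed.

Let block_at u :
  GRing.comm (l2 (gmx LF u J)) (r * l1 (block (gen_block u) I) * s).
Proof.
have VI c : r * (l1 (V I) * c) * s = l1 (V I) * (r * c * s).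
  by rewrite !mulrA V1r.
case: u => i /=; rewrite ?block_lshift ?block_rshift ?l1_handle ?VI.
- apply: commrM; first exact/commr_sym/V1l2.
  rewrite /GRing.comm; apply/esym; exact: (handle_reflectA rri rir
    (l1V (AmxV n i I)) (l1V (VAmx n i I))
    (l1V (BmxV n i I)) (l1V (VBmx n i I)) (reflect (GenA n i)) (reflect' (GenA n i))
    (hdl i)).
- apply: commrM; first exact/commr_sym/V1l2.
  rewrite /GRing.comm; apply/esym; exact: (handle_reflectB ssi sis
    (l1V (AmxV n i I)) (l1V (VAmx n i I))
    (l1V (BmxV n i I)) (l1V (VBmx n i I)) (reflect (GenB n i)) (reflect' (GenB n i))
    (hdl' i)).
- by rewrite /GRing.comm !mulrA; apply/esym; exact: reflect.
Qed.

Let l1_prod m (W : 'I_m -> 'M[LA]_(hdim I)) :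
  l1 (\prod_k W k) = \prod_k l1 (W k).
Proof. exact: (big_morph l1 l1M l11). Qed.
Let l2_prod m (W : 'I_m -> 'M[LA]_(hdim J)) :
  l2 (\prod_k W k) = \prod_k l2 (W k).
Proof. exact: (big_morph l2 l2M l21). Qed.

(** Earlier blocks are handled by the exchange relation, the block of [u] by the reflection equation
    of a handle or puncture, later ones by the flipped exchange; [comm_marked_prod] glues the three
    cases. *)
Lemma C_reflect_of_generators u :
  GRing.comm (l2 (gmx LF u J)) (r * l1 (Cmx g n I) * s).
Proof.
rewrite Cmx_blocks l1_prod.
apply: (@comm_marked_prod M _ _ (gen_block u) _ r ri s si) => // k.
  exact: block_lo.
exact: block_hi.
Qed.

Hypothesis ribbon12 :
  V (hmod_tens I J) = ri * si * (ri * si) * (l1 (V I) * l2 (V J)).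
Hypothesis gfus : forall t, gmx LF t (hmod_tens I J)
  = l1 (gmx LF t I) * s * l2 (gmx LF t J) * si.

Let block_fusion k :
  block k (hmod_tens I J) = l1 (block k I) * s * l2 (block k J) * si.
Proof.
have [[i ->]|[j ->]] : (exists i, k = lshift n i) \/ (exists j, k = rshift g j).
- by rewrite -(splitK k); case: (split k) => i; [left|right]; exists i.
- rewrite !block_lshift l1_handle l2_handle.
  (* Inverses being unique, [mxinv] of a fused matrix must be the product of the leg inverses in
     reverse order. *)
  have inv12 t Y Ai Aj : gmx LF t (hmod_tens I J) *m Y = 1%:M ->
      l1 Ai * l1 (gmx LF t I) = 1 -> l2 Aj * l2 (gmx LF t J) = 1 ->
      Y = s * l2 Aj * si * l1 Ai.
    move=> eY e1 e2; apply/esym; apply: (@inv_unique M (gmx LF t (hmod_tens I J))) => //.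
    by rewrite gfus (fusion_invl ssi sis).
  rewrite /Chandle.
  rewrite (inv12 (GenA n i) _ _ _ (AmxV n i _) (l1V (VAmx n i I)) (l2V (VAmx n i J))).
  rewrite (inv12 (GenB n i) _ _ _ (BmxV n i _) (l1V (VBmx n i I)) (l2V (VBmx n i J))).
  have FA : Amx n i (hmod_tens I J) = l1 (Amx n i I) * s * l2 (Amx n i J) * si.
    exact: gfus.
  have FB : Bmx n i (hmod_tens I J) = l1 (Bmx n i I) * s * l2 (Bmx n i J) * si.
    exact: gfus.
  rewrite ribbon12 FA FB.
  pose Q := ri * si * (ri * si); pose W := l1 (V I) * l2 (V J).
  pose b12 := l1 (Bmx n i I) * s * l2 (Bmx n i J) * si.
  pose a12 := l1 (Amx n i I) * s * l2 (Amx n i J) * si.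
  pose b12i := s * l2 (mxinv (Bmx n i J)) * si * l1 (mxinv (Bmx n i I)).
  pose a12i := s * l2 (mxinv (Amx n i J)) * si * l1 (mxinv (Amx n i I)).
  have QW : GRing.comm W Q.
    have c1 : GRing.comm (l1 (V I)) Q.
      by apply: commrM; apply: commrM; [exact: V1ri|exact: V1si|exact: V1ri|exact: V1si].
    have c2 : GRing.comm (l2 (V J)) Q.
      by apply: commrM; apply: commrM; [exact: V2ri|exact: V2si|exact: V2ri|exact: V2si].
    by apply/commr_sym; apply: commrM; apply/commr_sym.
  (* The product of v^2 on the two legs goes to the front, so that what follows is the left side of
     [handle_fusion]; afterwards v^2 on leg 2 returns past [c1 * s] to its own handle. *)
  transitivity (W * (Q * (b12 * a12i * b12i * a12))).
    by rewrite -[LHS]/(Q * W * b12 * a12i * b12i * a12) [RHS]mulrA QW !mulrA.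
  have h := handle_fusion rri rir ssi sis (l1V (AmxV n i I)) (l1V (VAmx n i I))
    (l2V (AmxV n i J)) (l2V (VAmx n i J)) (l1V (BmxV n i I)) (l1V (VBmx n i I))
    (l2V (BmxV n i J)) (l2V (VBmx n i J)) (reflect (GenA n i))
    (reflect' (GenA n i)) (reflect (GenB n i)) (reflect' (GenB n i))
    (hdl i) (hdl' i).
  rewrite [Q * _]h /W; set c1 := _ * l1 (Amx n i I); set c2 := _ * l2 (Amx n i J).
  have V2c : GRing.comm (l2 (V J)) (c1 * s).
    by apply: commrM => //; apply: commrM => //; apply: commrM => //; apply: commrM.
  transitivity (l1 (V I) * (l2 (V J) * (c1 * s)) * c2 * si); first by rewrite !mulrA.
  by rewrite V2c !mulrA.
by rewrite !block_rshift; apply: gfus.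
Qed.

Let block_exch (k k' : 'I_(g + n)) : (k < k')%N ->
  GRing.comm (s * l2 (block k J) * si) (l1 (block k' I)).
Proof.
move=> kk'; apply: comm_block => // [|u uk'].
  by apply/commr_sym; apply: commrM => //; apply: commrM.
apply/commr_sym; apply: (comm_block (f := fun A => s * l2 A * si)).
- by rewrite l21 mulr1.
- by move=> A B; rewrite l2M conj_mul.
- by rewrite -V2s -mulrA ssi mulr1; apply/commr_sym/V2l1.
by move=> t tk; apply/commr_sym/exch'; rewrite -!gen_blockE tk uk'.
Qed.

Lemma C_fusion_of_generators :
  Cmx g n (hmod_tens I J) = l1 (Cmx g n I) * s * l2 (Cmx g n J) * si.
Proof.
rewrite !Cmx_blocks l1_prod l2_prod.
transitivity (\prod_k (l1 (block k I) * s * l2 (block k J) * si)).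
  by apply: eq_bigr => k _; apply: block_fusion.
by apply: fusion_prod => //; apply: block_exch.
Qed.

End CPair.

Section CRelations.
Variables (K : fieldType) (H : ribbonHopf K) (g n : nat).
Local Notation LA := (LgnAlg H g n).
Local Notation LF := (@Lfam K H g n).
Variables (I J : hmod H).

Let exch t u : (gen_pos t < gen_pos u)%N ->
  Rmx LA I J *m leg1 _ (gmx LF t I) *m Rimx LA I J *m leg2 _ (gmx LF u J)
  = leg2 _ (gmx LF u J) *m (Rmx LA I J *m leg1 _ (gmx LF t I) *m Rimx LA I J).
Proof. by move=> tu; rewrite (lrel_exchange (Lfam_rel H g n)) // !mulmxA. Qed.

Let exch' t u : (gen_pos t < gen_pos u)%N ->
  R'mx LA I J *m leg2 _ (gmx LF t J) *m R'imx LA I J *m leg1 _ (gmx LF u I)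
  = leg1 _ (gmx LF u I) *m (R'mx LA I J *m leg2 _ (gmx LF t J) *m R'imx LA I J).
Proof. by move=> tu; rewrite (gmx_exchange' (Lfam_rel H g n)) // !mulmxA. Qed.

Lemma C_reflect u :
  leg2 _ (gmx LF u J) *m (Rmx LA I J *m leg1 _ (Cmx g n I) *m R'mx LA I J)
  = Rmx LA I J *m leg1 _ (Cmx g n I) *m R'mx LA I J *m leg2 _ (gmx LF u J).
Proof.
have hL := Lfam_rel H g n.
exact: (C_reflect_of_generators (RV _ _ _) (VR _ _ _) (R'V _ _ _) (VR' _ _ _)
  (leg1_1 _ _ _) (@leg1M _ _ _) (@ribbon_leg1_tact _ _ LA I J _)
  (@ribbon_leg1_tact _ _ LA I J _) (@leg_emx_comm _ LA _ _ _)
  exch exch' (fun t => gmx_reflect hL t I J) (fun t => gmx_reflect' hL t I J)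
  (fun i => lrel_handle hL i I J) (fun i => gmx_handle' hL i I J)).
Qed.

Lemma C_fusion : Cmx g n (hmod_tens I J)
  = leg1 _ (Cmx g n I) *m R'mx LA I J *m leg2 _ (Cmx g n J) *m R'imx LA I J.
Proof.
have hL := Lfam_rel H g n.
have rib2_l1 A : leg2 (hdim I) (emx LA (J (ribbon H) ^+ 2)) *m leg1 _ A
    = leg1 _ A *m leg2 _ (emx LA (J (ribbon H) ^+ 2)).
  by rewrite emx_leg_comm.
exact: (C_fusion_of_generators (RV _ _ _) (VR _ _ _) (R'V _ _ _) (VR' _ _ _)
  (leg1_1 _ _ _) (leg2_1 _ _ _) (@leg1M _ _ _) (@leg2M _ _ _)
  (@ribbon_leg1_tact _ _ LA I J _) (@ribbon_leg1_tact _ _ LA I J _)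
  (@ribbon_leg2_tact _ _ LA I J _) (@ribbon_leg2_tact _ _ LA I J _)
  (@leg_emx_comm _ LA _ _ _) rib2_l1
  exch' (fun t => gmx_reflect hL t I J) (fun t => gmx_reflect' hL t I J)
  (fun i => lrel_handle hL i I J) (fun i => gmx_handle' hL i I J)
  (ribbon_tens LA I J) (fun t => lrel_fusion hL t I J)).
Qed.

End CRelations.

Lemma eq_sweedler (K : fieldType) (A B : falgType K) (V : lmodType K)
    (f f' : A -> B -> V) X : (forall a b, f a b = f' a b) -> tlift f X = tlift f' X.
Proof. by move=> ff'; apply: tlift_eq. Qed.

(** * Evaluating tensors at algebra morphisms with commuting images *)

Section MatrixAlgebra.
Variables (K : fieldType) (E : pzAlg K) (m : nat).
Definition mat_in (c : K) : 'M[E]_m := (pzalg_in E c)%:M.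
Fact mat_in_zmod : zmod_morphism mat_in.
Proof. by move=> c d; rewrite /mat_in rmorphB raddfB. Qed.
Fact mat_in_monoid : monoid_morphism mat_in.
Proof. by split=> [|c d]; rewrite /mat_in ?rmorph1 // rmorphM scalar_mxM. Qed.
HB.instance Definition _ := GRing.isZmodMorphism.Build K 'M[E]_m mat_in mat_in_zmod.
HB.instance Definition _ := GRing.isMonoidMorphism.Build K 'M[E]_m mat_in
  mat_in_monoid.
Lemma scalar_entries_comm (c : E) (A : 'M[E]_m) :
  (forall i j, c * A i j = A i j * c) -> c%:M *m A = A *m c%:M.
Proof.
move=> cA; apply/matrixP=> i j; rewrite mul_scalar_mx !mxE (bigD1 j) //=.
rewrite !mxE eqxx mulr1n big1 ?addr0 ?cA // => k kj.
by rewrite !mxE (negPf kj) mulr0n mulr0.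
Qed.
Fact mat_in_central c (A : 'M[E]_m) : mat_in c * A = A * mat_in c.
Proof. by apply: scalar_entries_comm => i j; rewrite pzalg_central. Qed.
Definition mat_alg : pzAlg K := PzAlg mat_in_central.

Lemma mat_algZ c (A : 'M[E]_m) i j :
  (c *: (A : pzmod mat_alg) : 'M[E]_m) i j = c *: (A i j : pzmod E).
Proof. by rewrite !pzscaleE [LHS](_ : _ = (mat_in c *m A) i j) // mul_scalar_mx mxE. Qed.
End MatrixAlgebra.

Section Pairing.
Variables (K : fieldType) (S : pzAlg K).

(** The multiplied image of X under f ⊗ g. With commuting morphisms the legs R_ij become elements of
    one algebra, and no higher tensor power of H has to be handled. *)
Definition pairing (A B : falgType K) (f : A -> S) (g : B -> S) (X : tens A B) : S :=
  tlift (fun a b => f a * g b : pzmod S) X.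

Record alg_morph (A : falgType K) (f : A -> S) : Prop := AlgMorph {
  am_linear : linear (f : A -> pzmod S);
  am_one : f 1 = 1;
  am_mul : forall x y, f (x * y) = f x * f y
}.

Definition commuting (A B : falgType K) (f : A -> S) (g : B -> S) :=
  forall a b, f a * g b = g b * f a.

Section Two.
Variables (A B : falgType K) (f : A -> S) (g : B -> S).
Hypotheses (hf : alg_morph f) (hg : alg_morph g).

Lemma pairing_bilin : bilin (fun a b => f a * g b : pzmod S).
Proof.
split=> [b|a] c u v.
  by rewrite (am_linear hf) [LHS]mulrDl -pzscaleAl.
by rewrite (am_linear hg) [LHS]mulrDr -pzscaleAr.
Qed.

Lemma pairing_ten a b : pairing f g (a ⊗ b) = f a * g b.
Proof. by rewrite /pairing tlift_ten //; apply: pairing_bilin. Qed.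

Lemma pairing_linear : linear (pairing f g : tens A B -> pzmod S).
Proof. by move=> c X Y; rewrite /pairing linearP. Qed.

Lemma pairingD X Y : pairing f g (X + Y) = pairing f g X + pairing f g Y.
Proof. by have := pairing_linear 1 X Y; rewrite !scale1r. Qed.
Lemma pairing0 : pairing f g 0 = 0.
Proof. by rewrite /pairing linear0. Qed.

Hypothesis fg : commuting f g.

Lemma pairingM X Y : pairing f g (X * Y) = pairing f g X * pairing f g Y.
Proof.
elim/tens_ind: X => [|a b|X X' eX eX']; first by rewrite mul0r pairing0 mul0r.
  elim/tens_ind: Y => [|c d|Y Y' eY eY'].
  - by rewrite mulr0 pairing0 mulr0.
  - rewrite ten_mul !pairing_ten (am_mul hf) (am_mul hg) -!mulrA.
    by congr (_ * _); rewrite !mulrA fg.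
  - by rewrite mulrDr !pairingD eY eY' mulrDr.
by rewrite mulrDl !pairingD eX eX' mulrDl.
Qed.

Lemma pairing_morph : alg_morph (pairing f g).
Proof.
split; [exact: pairing_linear | | exact: pairingM].
by rewrite ten_one pairing_ten (am_one hf) (am_one hg) mulr1.
Qed.

End Two.

Lemma pairing_swap (A B : falgType K) (f : A -> S) (g : B -> S) X :
  alg_morph f -> alg_morph g -> commuting f g ->
  pairing g f (tswap X) = pairing f g X.
Proof.
move=> hf hg fg; rewrite /pairing (tlift_lin (tlift _)); last first.
  by move=> c u v; rewrite linearP.
apply: (eq_sweedler (V := pzmod S)) => a b.
by rewrite tlift_ten ?fg //; apply: pairing_bilin.
Qed.

Variable H : ribbonHopf K.
Implicit Types f g k : H -> S.

Definition convol f g (x : H) : S := pairing f g (coprod H x).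

Lemma convol_morph f g : alg_morph f -> alg_morph g -> commuting f g ->
  alg_morph (convol f g).
Proof.
move=> hf hg fg; split=> [c x y||x y]; rewrite /convol.
- by rewrite linearP; apply: pairing_linear.
- by rewrite rmorph1 (am_one (pairing_morph hf hg fg)).
- by rewrite rmorphM pairingM.
Qed.

Lemma pairing_commuting (A B C : falgType K) (f : A -> S) (g : B -> S) (k : C -> S) :
  commuting f k -> commuting g k -> commuting (pairing f g) k.
Proof.
move=> fk gk X c; rewrite /pairing.
rewrite (tlift_lin (fun x : pzmod S => (x : S) * k c : pzmod S)); last first.
  by move=> l u v; rewrite [LHS]mulrDl -pzscaleAl.
rewrite (tlift_lin (fun x : pzmod S => k c * (x : S) : pzmod S)); last first.
  by move=> l u v; rewrite [LHS]mulrDr -pzscaleAr.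
by apply: (eq_sweedler (V := pzmod S)) => a b; rewrite -mulrA gk mulrA fk mulrA.
Qed.

Lemma convol_commuting f g k :
  commuting f k -> commuting g k -> commuting (convol f g) k.
Proof. by move=> fk gk x y; apply: pairing_commuting. Qed.

Lemma commutingC (A B : falgType K) (f : A -> S) (g : B -> S) :
  commuting f g -> commuting g f.
Proof. by move=> fg a b; rewrite fg. Qed.

Local Notation R := (rmat H).

Lemma pairing_Rl f g k : alg_morph f -> alg_morph g -> alg_morph k ->
  commuting f g -> commuting f k -> commuting g k ->
  pairing (convol f g) k R = pairing f k R * pairing g k R.
Proof.
move=> hf hg hk fg fk gk.
have hp := pairing_morph hf hg fg; have pk := pairing_commuting fk gk.
have bp := pairing_bilin hp hk.
have lp : linear (pairing (pairing f g) k : _ -> pzmod S) := pairing_linear _ _.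
have := congr1 (pairing (pairing f g) k) (rmat_coprodl H).
rewrite pairingM // !(tlift_lin (pairing (pairing f g) k : _ -> pzmod S)) // => e.
transitivity (\sw_(a, b <- R) (pairing (pairing f g) k (coprod H a ⊗ b) : pzmod S)).
  by apply: (eq_sweedler (V := pzmod S)) => a b; rewrite pairing_ten.
rewrite [LHS]e; congr (_ * _); apply: (eq_sweedler (V := pzmod S)) => a b.
  by rewrite !pairing_ten // (am_one hg) mulr1.
by rewrite !pairing_ten // (am_one hf) mul1r.
Qed.

Lemma pairing_Rr f g k : alg_morph f -> alg_morph g -> alg_morph k ->
  commuting f g -> commuting k f -> commuting k g ->
  pairing k (convol f g) R = pairing k g R * pairing k f R.
Proof.
move=> hf hg hk fg kf kg.
have hp := pairing_morph hf hg fg.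
have pk := commutingC (pairing_commuting (commutingC kf) (commutingC kg)).
have bp := pairing_bilin hk hp.
have lp : linear (pairing k (pairing f g) : _ -> pzmod S) := pairing_linear _ _.
have := congr1 (pairing k (pairing f g)) (rmat_coprodr H).
rewrite pairingM // !(tlift_lin (pairing k (pairing f g) : _ -> pzmod S)) // => e.
transitivity (\sw_(a, b <- R) (pairing k (pairing f g) (a ⊗ coprod H b) : pzmod S)).
  by apply: (eq_sweedler (V := pzmod S)) => a b; rewrite pairing_ten.
rewrite [LHS]e; congr (_ * _); apply: (eq_sweedler (V := pzmod S)) => a b.
  by rewrite !pairing_ten // (am_one hf) mul1r.
by rewrite !pairing_ten // (am_one hg) mulr1.
Qed.

Lemma pairing_R_convol f g x : alg_morph f -> alg_morph g -> commuting f g ->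
  pairing f g R * convol f g x = convol g f x * pairing f g R.
Proof.
move=> hf hg fg; rewrite /convol -pairingM // rmat_coprod pairingM //.
by congr (_ * _); rewrite -(pairing_swap _ hf hg fg) tswapK.
Qed.

End Pairing.

(** * R against the counit and the antipode *)

Section CounitR.
Variables (K : fieldType) (H : ribbonHopf K).
Local Notation R := (rmat H).
Local Notation HZ := (falg_pz H).

(** Applying the counit to the last two legs of (id ⊗ Δ)(R) = R_13 R_12 shows that this element is
    idempotent; as the image of the invertible R it has a right inverse, so it is 1. *)
Lemma counit_R : \sw_(a, b <- R) (counit H b *: a) = 1.
Proof.
pose f (x : H) : HZ := (counit H x)%:A; pose k (x : H) : HZ := x.
have hf : alg_morph f.
  split=> [c x y||x y]; rewrite /f.
  - by rewrite linearP scalerDl -scalerA falg_pzZ.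
  - by rewrite rmorph1 scale1r.
  - by rewrite rmorphM -[RHS]scalerAl mul1r scalerA.
have hk : alg_morph k by split=> // c x y; rewrite falg_pzZ.
have ff : commuting f f by move=> x y; rewrite /f -!scalerAl !mul1r !scalerA mulrC.
have kf : commuting k f by move=> x y; rewrite /f /k -scalerAl -scalerAr mul1r mulr1.
have fe x : convol f f x = f x.
  rewrite /convol /pairing falg_pz_tlift -{2}[x]counitl.
  rewrite [RHS](tlift_lin (fun y => (counit H y)%:A)); last first.
    by move=> c u v; rewrite linearP scalerDl -scalerA.
  apply: eq_sweedler => a b; rewrite /f -scalerAl mul1r [counit H (_ *: _)]linearZ /=.
  by rewrite scalerA mulrC.
have := pairing_Rr hf hf hk ff kf kf; set e := pairing k f R.
have -> : pairing k (convol f f) R = e.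
  by apply: (eq_sweedler (V := pzmod HZ)) => a b; rewrite fe.
move=> ee.
have eV : e * pairing k f R^-1 = 1.
  rewrite -pairingM // mulrV ?rmat_unit //.
  by rewrite (am_one (pairing_morph hk hf kf)).
have e1 : e = 1 by rewrite -eV {2}ee -mulrA eV mulr1.
rewrite -[RHS]e1 /e /pairing falg_pz_tlift; apply: eq_sweedler => a b.
by rewrite /k /f -scalerAr mulr1.
Qed.

(* Apply [p ⊗ q ⊗ r |-> q S(r) ⊗ p] to [(id ⊗ Delta)(R) = R_13 R_12]. *)
Lemma antipode_R : \sw_(a, b <- R) \sw_(c, d <- R)
  ((d * antipode H b) ⊗ (a * c)) = 1 ⊗ 1.
Proof.
pose G2 (p : H) (Y : tens H H) := \sw_(q, r <- Y) ((q * antipode H r) ⊗ p).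
have b2 (p : H) : bilin (fun q r : H => (q * antipode H r) ⊗ p).
  split=> [b|a] c u v; [rewrite mulrDl -scalerAl|rewrite linearP mulrDr -scalerAr];
  exact: ten_linl.
have bG : bilin G2.
  split=> [Y|p] c u v; last by rewrite /G2 linearP.
  rewrite /G2 -tlift_comb; apply: eq_sweedler => q r.
  exact: ten_linr.
pose G := tlift G2 : tens H (tens H H) -> tens H H.
have lG : linear G by move=> c u v; rewrite /G linearP.
have := congr1 G (rmat_coprodr H); rewrite (tlift_lin G) // => e.
transitivity (G ((\sw_(a, b <- R) (a ⊗ (1 ⊗ b)))
  * (\sw_(a, b <- R) (a ⊗ (b ⊗ 1))))).
  set Z := \sw_(a, b <- R) (a ⊗ (b ⊗ 1)).
  have lY : linear (fun X => G (X * Z)).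
    by move=> c u v; rewrite mulrDl -scalerAl lG.
  rewrite [RHS](tlift_lin (fun X => G (X * Z))) //.
  apply: eq_sweedler => a b.
  have lZ : linear (fun X => G ((a ⊗ (1 ⊗ b)) * X)).
    by move=> c u v; rewrite mulrDr -scalerAr lG.
  rewrite [RHS](tlift_lin (fun X => G ((a ⊗ (1 ⊗ b)) * X))) //.
  apply: eq_sweedler => c d.
  by rewrite !ten_mul mul1r mulr1 /G tlift_ten // /G2 tlift_ten.
rewrite -e.
transitivity (\sw_(a, b <- R) (1 ⊗ (counit H b *: a) : tens H H)); last first.
  rewrite -(tlift_lin (fun x => 1 ⊗ x) (fun a b => counit H b *: a)).
    by rewrite counit_R.
  by case: (bilin_ten H H) => _; apply.
apply: eq_sweedler => a b; rewrite /G tlift_ten // /G2.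
have l1 : linear (fun z : H => z ⊗ a : tens H H) by case: (bilin_ten H H).
rewrite -(tlift_lin (fun z : H => z ⊗ a : tens H H)) // antipoder.
by apply/matrixP=> i j; rewrite !mxE !linearZ /= mulrCA mulrA.
Qed.

End CounitR.

(** * The regular module, and natural families as linear maps on the dual of H *)

Section RegularModule.
Variables (K : fieldType) (H : hopfAlgType K).
Local Notation d := (\dim {:H}).
Local Notation e := (vbasis {:H}).

Definition reg_act (x : H) : 'M[K]_d := \matrix_(k, l) coord e k (x * e`_l).

Lemma reg_act_linear : linear reg_act.
Proof.
by move=> c x y; apply/matrixP=> k l; rewrite !mxE mulrDl -scalerAl linearP.
Qed.

Lemma reg_act_multiplicative : monoid_morphism reg_act.
Proof.
split=> [|x y]; apply/matrixP=> k l.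
  by rewrite [RHS]mxE mxE mul1r coord_vb.
rewrite [RHS]mxE mxE -mulrA {1}(coord_vbasis (memvf (y * e`_l))).
rewrite mulr_sumr linear_sum; apply: eq_bigr => j _.
by rewrite !mxE -scalerAr linearZ mulrC.
Qed.

HB.instance Definition _ := GRing.isLinear.Build _ _ _ _ reg_act reg_act_linear.
HB.instance Definition _ := GRing.isMonoidMorphism.Build _ _ reg_act
  reg_act_multiplicative.
Definition hmod_reg : hmod H := HMod reg_act.

(** Write [x = x * 1] and expand 1 in the basis: the coefficients of this one module span the
    dual. *)
Lemma dual_reg_expand (phi : dualv H) :
  phi = \sum_(p < d) \sum_(q < d)
    ((phi e`_p : K) * coord e q 1) *: mxcoef (I := hmod_reg) p q.
Proof.
apply/lfunP => x; rewrite sum_lfunE.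
rewrite {1}(coord_vbasis (memvf x)) linear_sum; apply: eq_bigr => p _.
rewrite linearZ sum_lfunE /=.
have -> : coord e p x = \sum_q coord e q 1 * coord e p (x * e`_q).
  rewrite -{1}[x]mulr1 {1}(coord_vbasis (memvf 1)) mulr_sumr linear_sum.
  by apply: eq_bigr => q _; rewrite -scalerAr linearZ.
rewrite scaler_suml; apply: eq_bigr => q _.
rewrite scale_lfunE mxcoefE /= mxE.
by rewrite [LHS]mulrC [LHS]mulrA.
Qed.

Lemma dual_ind (P : dualv H -> Prop) : P 0 ->
  (forall c phi psi, P phi -> P psi -> P (c *: phi + psi)) ->
  (forall p q, P (mxcoef (I := hmod_reg) p q)) -> forall phi, P phi.
Proof.
move=> P0 PD Pm phi; rewrite (dual_reg_expand phi).
have PS (r : seq 'I_d) (F : 'I_d -> dualv H) :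
    (forall i, P (F i)) -> P (\sum_(i <- r) F i).
  move=> PF; elim: r => [|i r IH]; first by rewrite big_nil.
  by rewrite big_cons -[F i]scale1r; apply: PD.
apply: (PS) => p; apply: (PS) => q.
by rewrite -[X in P X]addr0; apply: PD.
Qed.

(** The matrix of h -> h e_j, from the regular module to I. *)
Definition orbit_mx (I : hmod H) j : 'M[K]_(hdim I, d) := \matrix_(i, p) I e`_p i j.

End RegularModule.

Section OrbitMap.
Variables (K : fieldType) (H : ribbonHopf K) (I : hmod H).

Lemma orbit_hom (j : 'I_(hdim I)) : @hmod_hom _ _ (hmod_reg H) I (orbit_mx j).
Proof.
move=> h; apply/matrixP=> i l; rewrite !mxE.
transitivity (I (h * (vbasis {:H})`_l) i j); last first.
  by rewrite rmorphM mxE; apply: eq_bigr => k _; rewrite mxE.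
rewrite [in RHS](coord_vbasis (memvf (h * (vbasis {:H})`_l))) linear_sum summxE.
by apply: eq_bigr => p _; rewrite linearZ /= !mxE mulrC.
Qed.

Variables (E : pzAlg K) (N : forall I : hmod H, 'M[E]_(hdim I)).

Definition nat_form (phi : dualv H) : E :=
  \sum_(p < \dim {:H}) \sum_(q < \dim {:H}) 
    pzalg_in E ((phi (vbasis {:H})`_p : K) * coord (vbasis {:H}) q 1)
    * N (hmod_reg H) p q.

Lemma nat_form_linear : linear (nat_form : dualv H -> pzmod E).
Proof.
move=> c phi psi; rewrite /nat_form scaler_sumr -big_split; apply: eq_bigr => p _ /=.
rewrite scaler_sumr -big_split; apply: eq_bigr => q _ /=.
rewrite add_lfunE scale_lfunE mulrDl rmorphD mulrDl; congr (_ + _).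
by rewrite pzscaleE mulrA -rmorphM mulrA.
Qed.

(** [nat_form] is dictated by the regular module. Naturality along the orbit map of e_j moves N over
    to I, and the coordinates of 1 then assemble to I(1), the identity matrix. *)
Lemma nat_form_mxcoef : natural N -> forall i j, nat_form (mxcoef (I := I) i j) = N I i j.
Proof.
move=> nN i j; have /matrixP h := nN _ _ _ (orbit_hom j).
transitivity (\sum_q (map_mx (pzalg_in E) (orbit_mx j) *m N (hmod_reg H)) i q
   * pzalg_in E (coord (vbasis {:H}) q 1)).
  rewrite /nat_form exchange_big; apply: eq_bigr => q _ /=.
  rewrite !mxE mulr_suml; apply: eq_bigr => p _.
  by rewrite mxcoefE !mxE rmorphM -!mulrA -pzalg_central.
transitivity (\sum_(q < \dim {:H}) \sum_k N I i k * pzalg_in E (I (vbasis {:H})`_q k j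
    * coord (vbasis {:H}) q 1)).
  apply: eq_bigr => q _; rewrite h !mxE mulr_suml; apply: eq_bigr => k _.
  by rewrite !mxE rmorphM mulrA.
rewrite exchange_big /=.
transitivity (\sum_k N I i k * pzalg_in E ((1%:M : 'M_(hdim I)) k j)); last first.
  rewrite (bigD1 j) //= mxE eqxx rmorph1 mulr1 big1 ?addr0 // => k kj.
  by rewrite mxE (negPf kj) rmorph0 mulr0.
apply: eq_bigr => k _; rewrite -mulr_sumr; congr (_ * _).
rewrite -rmorph_sum; congr (pzalg_in E _).
transitivity (I 1 k j); last by rewrite rmorph1.
rewrite {2}(coord_vbasis (memvf 1)) linear_sum summxE; apply: eq_bigr => q _.
by rewrite linearZ mxE mulrC.
Qed.

End OrbitMap.

(** * Matrices obtained from R R', and their fusion *)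

Section MatrixMorphisms.
Variables (K : fieldType) (H : ribbonHopf K) (E : pzAlg K).
Local Notation MA m := (mat_alg E m).

Lemma mat_alg_ext_linear (V : lmodType K) m (f : V -> 'M[E]_m) :
  (forall i j, linear (fun x => f x i j : pzmod E)) -> linear (f : V -> pzmod (MA m)).
Proof.
move=> hf c x y; apply/matrixP => i j; rewrite [RHS]mxE (mat_algZ c (f x)).
exact: hf.
Qed.

Lemma mat_alg_entry_linear m i j :
  linear (fun A : pzmod (MA m) => (A : 'M[E]_m) i j : pzmod E).
Proof. by move=> c A B; rewrite mxE mat_algZ. Qed.

Lemma am_emx (I : hmod H) : alg_morph (fun h => emx E (I h) : MA (hdim I)).
Proof.
split=> [||x y].
- apply: mat_alg_ext_linear => i j c x y.
  by rewrite !mxE linearP !mxE rmorphD rmorphM.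
- by rewrite rmorph1; apply: emx_one.
- by rewrite rmorphM; apply: emx_mul.
Qed.

Lemma am_scalar m (sg : H -> E) : alg_morph sg -> alg_morph (fun h => (sg h)%:M : MA m).
Proof.
move=> hs; split=> [||x y].
- apply: mat_alg_ext_linear => i j c x y; rewrite !mxE (am_linear hs).
  by rewrite mulrnDl -scalerMnr.
- by rewrite (am_one hs).
- by rewrite (am_mul hs); apply: scalar_mxM.
Qed.

Lemma am_leg1 m n (f : H -> MA m) : alg_morph f ->
  alg_morph (fun h => leg1 n (f h) : MA (m * n)).
Proof.
move=> hf; split=> [||x y].
- apply: mat_alg_ext_linear => x y c h k.
  case: (mxtens_indexP x) => i a; case: (mxtens_indexP y) => j b.
  by rewrite !leg1E (am_linear hf) (mat_alg_entry_linear i j) mulrnDl -scalerMnr.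
- by rewrite (am_one hf); apply: leg1_1.
- by rewrite (am_mul hf); apply: leg1M.
Qed.

Lemma am_leg2 m n (f : H -> MA n) : alg_morph f ->
  alg_morph (fun h => leg2 m (f h) : MA (m * n)).
Proof.
move=> hf; split=> [||x y].
- apply: mat_alg_ext_linear => x y c h k.
  case: (mxtens_indexP x) => i a; case: (mxtens_indexP y) => j b.
  by rewrite !leg2E (am_linear hf) (mat_alg_entry_linear a b) mulrnDl -scalerMnr.
- by rewrite (am_one hf); apply: leg2_1.
- by rewrite (am_mul hf); apply: leg2M.
Qed.

Lemma tlift_mat_entry (A B : falgType K) m (f : A -> B -> 'M[E]_m) X i j :
  (tlift (f : A -> B -> pzmod (MA m)) X : 'M[E]_m) i j
    = tlift (fun a b => f a b i j : pzmod E) X.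
Proof.
exact: (tlift_lin (fun M : pzmod (MA m) => (M : 'M[E]_m) i j : pzmod E) _ _
  (mat_alg_entry_linear i j)).
Qed.

Definition contract (X : tens H H) (phi : dualv H) : H :=
  \sw_(a, b <- X) ((phi a : K) *: b).

Lemma contract_linear X : linear (contract X).
Proof.
move=> c phi psi; rewrite /contract -tlift_comb; apply: tlift_eq => a b.
by rewrite add_lfunE scale_lfunE scalerDl scalerA.
Qed.

Lemma linear_scale (U V : lmodType K) (f : U -> V) c x :
  linear f -> f (c *: x) = c *: f x.
Proof.
move=> hf; pose F := GRing.isLinear.Build K U V _ f hf.
by pose G : {linear U -> V} := HB.pack f F; rewrite -[f]/(G : U -> V) linearZ.
Qed.

Lemma mulmx_scalarE m (A : 'M[E]_m) c i j : (A *m c%:M) i j = A i j * c.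
Proof.
rewrite mxE (bigD1 j) //= mxE eqxx mulr1n big1 ?addr0 // => k kj.
by rewrite mxE (negPf kj) mulr0.
Qed.

Lemma leg1_scalar m n (c : E) : leg1 n (c%:M : 'M_m) = c%:M.
Proof.
apply/matrixP=> x y; case: (mxtens_indexP x) => i k.
case: (mxtens_indexP y) => j l; rewrite leg1E !mxE.
by rewrite (can_eq (@mxtens_indexK _ _)) xpair_eqE -mulrnA mulnb.
Qed.
Lemma leg2_scalar m n (c : E) : leg2 m (c%:M : 'M_n) = c%:M.
Proof.
apply/matrixP=> x y; case: (mxtens_indexP x) => i k.
case: (mxtens_indexP y) => j l; rewrite leg2E !mxE.
by rewrite (can_eq (@mxtens_indexK _ _)) xpair_eqE -mulrnA mulnb andbC.
Qed.

Lemma leg1_linear m n : linear (@leg1 E m n : pzmod (MA m) -> pzmod (MA (m * n))).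
Proof.
apply: mat_alg_ext_linear => x y c A B.
case: (mxtens_indexP x) => i k; case: (mxtens_indexP y) => j l.
by rewrite !leg1E (mat_alg_entry_linear i j) mulrnDl -scalerMnr.
Qed.
Lemma leg2_linear m n : linear (@leg2 E m n : pzmod (MA n) -> pzmod (MA (m * n))).
Proof.
apply: mat_alg_ext_linear => x y c A B.
case: (mxtens_indexP x) => i k; case: (mxtens_indexP y) => j l.
by rewrite !leg2E (mat_alg_entry_linear k l) mulrnDl -scalerMnr.
Qed.

Section Legs.
Variables (sg : H -> E) (hs : alg_morph sg).

Definition contract_mx (X : tens H H) (I : hmod H) : 'M[E]_(hdim I) :=
  \matrix_(i, j) sg (contract X (mxcoef i j)).

Lemma contract_mxE X I : contract_mx X I
  = pairing (fun h => emx E (I h) : MA _) (fun h => (sg h)%:M : MA _) X.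
Proof.
apply/matrixP => i j; rewrite tlift_mat_entry mxE.
rewrite (tlift_lin (sg : H -> pzmod E)); last exact: am_linear.
apply: (@tlift_eq K H H (pzmod E)) => a b; rewrite [RHS]mulmx_scalarE mxE mxcoefE.
by rewrite (linear_scale _ _ (am_linear hs)).
Qed.

Variables (I J : hmod H).
Local Notation M := (MA (hdim I * hdim J)).
(** [rho1], [rho2], [rho3] are three actions of H, on I, on J and through [sg], with pairwise
    commuting images; their pairings with R are the legs R_ij. *)
Definition rho1 (h : H) : M := leg1 (hdim J) (emx E (I h)).
Definition rho2 (h : H) : M := leg2 (hdim I) (emx E (J h)).
Definition rho3 (h : H) : M := (sg h)%:M.

Lemma rho1_morph : alg_morph rho1. Proof. exact: am_leg1 (am_emx I). Qed.
Lemma rho2_morph : alg_morph rho2. Proof. exact: am_leg2 (am_emx J). Qed.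
Lemma rho3_morph : alg_morph rho3. Proof. exact: am_scalar. Qed.
Lemma rho12 : commuting rho1 rho2.
Proof. by move=> x y; apply: leg_emx_comm. Qed.
Lemma rho13 : commuting rho1 rho3.
Proof.
by move=> x y; rewrite /rho1 /rho3 -(leg2_scalar _ (hdim J)); apply: leg_emx_comm.
Qed.
Lemma rho23 : commuting rho2 rho3.
Proof.
move=> x y; rewrite /rho2 /rho3 -(leg1_scalar _ (hdim J)).
by apply/esym; apply: emx_leg_comm.
Qed.

Lemma contract_leg1 X : leg1 (hdim J) (contract_mx X I) = pairing rho1 rho3 X.
Proof.
rewrite contract_mxE.
rewrite [LHS](tlift_lin (@leg1 E _ _ : pzmod (MA _) -> pzmod (MA _)) _ _
  (@leg1_linear _ _)).
apply: (@tlift_eq K H H (pzmod M)) => a b.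
by rewrite [LHS]leg1M leg1_scalar.
Qed.

Lemma contract_leg2 X : leg2 (hdim I) (contract_mx X J) = pairing rho2 rho3 X.
Proof.
rewrite contract_mxE.
rewrite [LHS](tlift_lin (@leg2 E _ _ : pzmod (MA _) -> pzmod (MA _)) _ _
  (@leg2_linear _ _)).
apply: (@tlift_eq K H H (pzmod M)) => a b.
by rewrite [LHS]leg2M leg2_scalar.
Qed.

Lemma emx_linear m : linear (@emx K E m : 'M[K]_m -> pzmod (MA m)).
Proof.
by apply: mat_alg_ext_linear => i j c A B; rewrite !mxE rmorphD rmorphM.
Qed.

Lemma pairing_tact X : pairing rho1 rho2 X = emx E (tact I J X).
Proof.
rewrite [RHS](tlift_lin (@emx K E _ : _ -> pzmod M) _ _ (@emx_linear _)).
by apply: (@tlift_eq K H H (pzmod M)) => a b; rewrite emx_tens.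
Qed.

Lemma pairing_R12 : pairing rho1 rho2 (rmat H) = Rmx E I J.
Proof. exact: pairing_tact. Qed.
Lemma pairing_R21 : pairing rho2 rho1 (rmat H) = R'mx E I J.
Proof.
rewrite -(pairing_swap _ rho2_morph rho1_morph (commutingC rho12)).
exact: pairing_tact.
Qed.

Let h1 := rho1_morph.
Let h2 := rho2_morph.
Let h3 := rho3_morph.
Let c12 := rho12.
Let c23 := rho23.
Let c21 := commutingC rho12.
Let c31 := commutingC rho13.
Let c32 := commutingC rho23.
Local Notation R := (rmat H).
Local Notation W := (R * tswap R).

Lemma pairing_W (f k : H -> M) : alg_morph f -> alg_morph k -> commuting f k ->
  pairing f k W = pairing f k R * pairing k f R.
Proof.
move=> hf hk fk; rewrite pairingM //; congr (_ * _).
by rewrite -(pairing_swap _ hk hf (commutingC fk)).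
Qed.

Lemma contract_tens X :
  contract_mx X (hmod_tens I J) = pairing (convol rho1 rho2) rho3 X.
Proof.
rewrite contract_mxE; apply: (@tlift_eq K H H (pzmod M)) => a b.
by rewrite /convol pairing_tact.
Qed.

(** Since (Δ ⊗ id)(R R') = R_13 R_23 R_32 R_31, it suffices to move R_23 R_32 past R_31 R_21. The
    latter is R with its first leg spread by Δ over 3 and 2, and the double braiding R_23 R_32
    commutes with that coproduct. *)
Lemma contract_fusion : contract_mx W (hmod_tens I J) * R'mx E I J
  = leg1 _ (contract_mx W I) * R'mx E I J * leg2 _ (contract_mx W J).
Proof.
rewrite contract_tens contract_leg1 contract_leg2 -pairing_R21.
have hc := convol_morph h1 h2 c12; have hd := convol_morph h3 h2 c32.
have hd' := convol_morph h2 h3 c23.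
rewrite !pairing_W //; last exact: convol_commuting.
rewrite pairing_Rl // pairing_Rr //.
set r13 := pairing rho1 rho3 R; set r31 := pairing rho3 rho1 R.
set r23 := pairing rho2 rho3 R; set r32 := pairing rho3 rho2 R.
set r21 := pairing rho2 rho1 R.
have e : pairing (convol rho3 rho2) rho1 R = r31 * r21 by rewrite pairing_Rl.
have cW x : GRing.comm (r23 * r32) (convol rho3 rho2 x).
  rewrite /GRing.comm -mulrA pairing_R_convol // mulrA pairing_R_convol //.
  by rewrite mulrA.
have cW1 x : GRing.comm (r23 * r32) (rho1 x).
  apply/commr_sym; apply: commrM.
    by apply/esym; apply: (pairing_commuting c21 c31).
  by apply/esym; apply: (pairing_commuting c31 c21).
have c : r23 * r32 * (r31 * r21) = r31 * r21 * (r23 * r32).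
  rewrite -e /pairing.
  rewrite (tlift_lin (fun x : pzmod M => r23 * r32 * (x : M) : pzmod M)); last first.
    by move=> l u v; rewrite [LHS]mulrDr -pzscaleAr.
  rewrite (tlift_lin (fun x : pzmod M => (x : M) * (r23 * r32) : pzmod M)); last first.
    by move=> l u v; rewrite [LHS]mulrDl -pzscaleAl.
  apply: (@tlift_eq K H H (pzmod M)) => a b.
  by rewrite mulrA cW -mulrA cW1 mulrA.
transitivity (r13 * (r23 * r32 * (r31 * r21))); first by rewrite !mulrA.
by rewrite c !mulrA.
Qed.

(** It reads the R C_1 R' of the reflection equation as R R' with its second leg acting by sg(h') on
    E and by h'' on J. *)
Lemma contract_convol : pairing rho1 (convol rho3 rho2) W
  = Rmx E I J * leg1 _ (contract_mx W I) * R'mx E I J.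
Proof.
have hd := convol_morph h3 h2 c32.
rewrite contract_leg1 -pairing_R12 -pairing_R21 !pairing_W //; last first.
  exact/commutingC/convol_commuting.
by rewrite pairing_Rl // pairing_Rr // !mulrA.
Qed.

End Legs.
End MatrixMorphisms.

Lemma pz_sandwich_linear (K : fieldType) (S : pzAlg K) (P Q : S) :
  linear (fun X : pzmod S => P * (X : S) * Q : pzmod S).
Proof. by move=> c u v; rewrite mulrDr [LHS]mulrDl -pzscaleAr -pzscaleAl. Qed.

Section RemoveBraiding.
Variables (K : fieldType) (H : ribbonHopf K) (E : pzAlg K) (I J : hmod H).
Local Notation M := (mat_alg E (hdim I * hdim J)).
Local Notation R := (rmat H).

(** The outer scalar matrices slide past A_1 and B_2 to R', where [antipode_R] collapses everything.
    Having them outside allows a linear map of the entries to be applied termwise. *)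
Lemma remove_R' (A : 'M[E]_(hdim I)) (B : 'M[E]_(hdim J)) :
  \sw_(a, b <- R) (leg2 _ (emx E (J a)) *m (leg1 _ A *m R'mx E I J *m leg2 _ B)
    *m leg1 _ (emx E (I (antipode H b))) : pzmod M)
  = leg1 _ A *m leg2 _ B.
Proof.
pose F (X : tens H H) : pzmod M := leg1 _ A *m emx E (tact I J X) *m leg2 _ B.
have lF : linear F.
  move=> c u v; rewrite /F tact_is_linear emx_linear.
  exact: (pz_sandwich_linear (S := M)).
transitivity (F (\sw_(a, b <- R) \sw_(c, d <- R)
    ((d * antipode H b) ⊗ (a * c)))); last first.
  by rewrite antipode_R /F -ten_one rmorph1 emx_one mulmx1.
rewrite (tlift_lin F) //; apply: (@tlift_eq K H H (pzmod M)) => a b.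
rewrite (tlift_lin F) //.
pose G (Y : 'M[K]_(hdim I * hdim J)) : pzmod M :=
  leg2 _ (emx E (J a)) *m (leg1 _ A *m emx E Y *m leg2 _ B)
    *m leg1 _ (emx E (I (antipode H b))).
have lG : linear G.
  move=> c u v; rewrite /G emx_linear.
  rewrite [X in _ *m X *m _](pz_sandwich_linear (S := M) (leg1 _ A) (leg2 _ B)).
  exact: (pz_sandwich_linear (S := M)).
rewrite -/(G _) /tswap (tlift_lin (tact I J)); last exact: tact_is_linear.
rewrite (tlift_lin G) //; apply: (@tlift_eq K H H (pzmod M)) => c d.
rewrite /G /F !tact_ten !emx_tens !rmorphM !emx_mul leg1M leg2M !mulmxA.
rewrite -[LHS]mulmxA -leg_emx_comm -emx_leg_comm !mulmxA.
rewrite -(mulmxA (leg1 _ A)) -leg_emx_comm !mulmxA.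
rewrite -(mulmxA _ (leg2 _ (emx E (J c)))) -leg_emx_comm !mulmxA.
by rewrite -(mulmxA _ (leg2 _ (emx E (J a))) (leg1 _ _)) -leg_emx_comm !mulmxA.
Qed.
End RemoveBraiding.

(** * Construction of the quantum moment map *)

Section MomentMap.
Variables (K : fieldType) (H : ribbonHopf K) (g n : nat).
Local Notation LA := (LgnAlg H g n).
Local Notation HZ := (falg_pz H).
Local Notation W := (rmat H * tswap (rmat H)).
Implicit Types I J : hmod H.

Section MapLinear.
Variables (E : pzAlg K) (mu : {linear H -> pzmod E}).

Lemma map_mx_emx_mul m p (A : 'M[K]_m) (X : 'M[HZ]_(m, p)) :
  map_mx (mu : HZ -> E) (emx HZ A *m X) = emx E A *m map_mx (mu : HZ -> E) X.
Proof.
apply/matrixP => i j; rewrite !mxE [LHS]linear_sum; apply: eq_bigr => k _.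
by rewrite !mxE -[_ * _ in LHS]scalerAl mul1r linearZ.
Qed.

Lemma map_mx_mul_emx m p (A : 'M[K]_p) (X : 'M[HZ]_(m, p)) :
  map_mx (mu : HZ -> E) (X *m emx HZ A) = map_mx (mu : HZ -> E) X *m emx E A.
Proof.
apply/matrixP => i j; rewrite !mxE [LHS]linear_sum; apply: eq_bigr => k _.
by rewrite !mxE -[_ * _ in LHS]scalerAr mulr1 linearZ /= pzscaleE pzalg_central.
Qed.

Lemma map_mx_linear m : linear (map_mx (mu : HZ -> E)
  : pzmod (mat_alg HZ m) -> pzmod (mat_alg E m)).
Proof.
apply: mat_alg_ext_linear => i j c A B; rewrite mxE [X in mu X]mxE.
by rewrite mat_algZ falg_pzZ linearP !mxE.
Qed.
End MapLinear.

Lemma rinv_mul m (A B : 'M[LA]_m) : (exists A', A *m A' = 1%:M) ->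
  (exists B', B *m B' = 1%:M) -> exists C', A *m B *m C' = 1%:M.
Proof.
move=> [A' eA] [B' eB]; exists (B' *m A').
by rewrite !mulmxA -(mulmxA A) eB mulmx1.
Qed.

Lemma C_rinv I : exists Y, Cmx g n I *m Y = 1%:M.
Proof.
rewrite Cmx_blocks; elim/big_ind: _ => [|A B|k _].
- by exists 1%:M; rewrite mulmx1.
- exact: rinv_mul.
rewrite /block; case: (split k) => i; last first.
  by have [Y [eY _]] := gmx_inv I (Lfam_rel H g n) (GenM g i); exists Y.
rewrite /Chandle.
apply: rinv_mul; last by exists (mxinv (Amx n i I)); apply: AmxV.
apply: rinv_mul; last by exists (Bmx n i I); apply: VBmx.
apply: rinv_mul; last by exists (Amx n i I); apply: VAmx.
apply: rinv_mul; last by exists (mxinv (Bmx n i I)); apply: BmxV.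
exists (emx LA (I ((ribbon H ^+ 2)^-1))).
rewrite hact_ribbon -[LHS](emx_mul LA) -[I _ *m _](rmorphM I) mulrV.
  by rewrite rmorph1; apply: emx_one.
by rewrite unitrX // ribbon_unit.
Qed.

Hypothesis hH : factorizable H.

Theorem moment_map : exists mu : H -> LA, alg_morph mu /\
  forall I, contract_mx mu W I = Cmx g n I.
Proof.
case: hH => Dinv DK KD.
have {}DK : cancel (contract W) Dinv := DK.
have {}KD : cancel Dinv (contract W) := KD.
have Dlin : linear Dinv.
  by move=> c x y; apply: (can_inj DK); rewrite contract_linear !KD.
(* Forced by C = (id ⊗ mu)(R R'): write h as (phi ⊗ id)(R R') and evaluate on phi the linear map
   that C defines. *)
pose mu (h : H) : LA := nat_form (Cmx g n : forall I, 'M[LA]_(hdim I)) (Dinv h).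
have mulin : linear (mu : H -> pzmod LA).
  by move=> c x y; rewrite /mu Dlin nat_form_linear.
have muC I : contract_mx mu W I = Cmx g n I.
  apply/matrixP => i j; rewrite mxE /mu DK nat_form_mxcoef //.
  exact: natural_C.
have cE I i j : Cmx g n I i j = mu (contract W (mxcoef i j)).
  by rewrite -muC mxE.
pose F := GRing.isLinear.Build K H (pzmod LA) _ mu mulin.
pose MU : {linear H -> pzmod LA} := HB.pack (mu : H -> pzmod LA) F.
(* R R' as a matrix over H itself, the universal case of which C is the entrywise image under mu. *)
pose Z I := contract_mx (id : H -> HZ) W I.
have hid : alg_morph (id : H -> HZ).
  by split=> // c x y; rewrite falg_pzZ.
have muZ I : map_mx (MU : HZ -> LA) (Z I) = Cmx g n I.
  by rewrite -muC; apply/matrixP => i j; rewrite !mxE.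
have muR I J : map_mx (MU : HZ -> LA)
     (leg1 _ (Z I) *m R'mx HZ I J *m leg2 _ (Z J))
   = leg1 _ (Cmx g n I) *m R'mx LA I J *m leg2 _ (Cmx g n J).
  rewrite -[X in map_mx _ X](contract_fusion hid) [LHS]map_mx_mul_emx.
  have := muZ (hmod_tens I J); rewrite /Z => ->.
  by rewrite C_fusion -[LHS]mulmxA [X in _ *m X](VR' LA I J) mulmx1.
(* Rewriting both sides by [remove_R'] leaves only scalar matrices around the fused expression,
   whose image under mu is given by [muR]. *)
have muZZ I J : map_mx (MU : HZ -> LA) (leg1 (hdim J) (Z I) *m leg2 _ (Z J))
   = leg1 _ (Cmx g n I) *m leg2 _ (Cmx g n J).
  rewrite -(remove_R' (Cmx g n I : 'M[LA]_(hdim I)) (Cmx g n J : 'M[LA]_(hdim J))).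
  rewrite -(remove_R' (Z I) (Z J)).
  rewrite [LHS](tlift_lin (map_mx (MU : HZ -> LA)
    : pzmod (mat_alg HZ _) -> pzmod (mat_alg LA _))); last exact: map_mx_linear.
  apply: (@tlift_eq K H H (pzmod (mat_alg LA _))) => a b.
  rewrite -muR emx_leg2 emx_leg1 map_mx_mul_emx map_mx_emx_mul.
  by rewrite -emx_leg1 -emx_leg2.
(* By factorizability the entries of Z for the regular module span H, and on these entries
   multiplicativity is [muZZ]. *)
have muM x y : mu (x * y) = mu x * mu y.
  rewrite -(KD x) -(KD y); move: (Dinv x) (Dinv y) => phi psi.
  have D0 : contract W 0 = 0.
    by have := contract_linear W (-1) 0 0; rewrite scaler0 addr0 scaleN1r addNr.
  have mu0 : mu 0 = 0 by exact: (linear0 MU).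
  elim/dual_ind: phi => [|c phi phi' e e'|p q].
  - by rewrite D0 mul0r mu0 mul0r.
  - rewrite contract_linear mulrDl -scalerAl !mulin e e' [RHS]mulrDl.
    by rewrite -pzscaleAl.
  elim/dual_ind: psi => [|c psi psi' e e'|r t].
  - by rewrite D0 mulr0 mu0 mulr0.
  - rewrite contract_linear mulrDr -scalerAr !mulin e e' [RHS]mulrDr.
    by rewrite -pzscaleAr.
  have /matrixP/(_ (mxtens_index (p, r)) (mxtens_index (q, t))) :=
    muZZ (hmod_reg H) (hmod_reg H).
  by rewrite [RHS]leg12E !cE mxE [X in MU X](leg12E (Z _) (Z _)) !mxE.
exists mu; split=> //; split=> //.
(* [mu 1] is a left unit for the entries of C; right invertibility of C forces it to be 1, read off
   on a diagonal entry, which exists since H is nonzero. *)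
have [Y eY] := C_rinv (hmod_reg H).
have m1 : (mu 1)%:M *m Cmx g n (hmod_reg H) = Cmx g n (hmod_reg H).
  apply/matrixP => i j; rewrite mul_scalar_mx mxE cE.
  by rewrite -muM mul1r.
have : (mu 1)%:M = 1%:M :> 'M[LA]_(hdim (hmod_reg H)).
  by rewrite -[LHS]mulmx1 -eY mulmxA m1.
have d_gt0 : (0 < \dim {:H})%N by apply: (adim_gt0 {:H}%AS).
move/matrixP/(_ (Ordinal d_gt0) (Ordinal d_gt0)).
by rewrite !mxE eqxx !mulr1n.
Qed.

End MomentMap.

(** * Invariants as the commutant of the moment map *)

Section Centralizer.
Variables (K : fieldType) (H : ribbonHopf K) (g n : nat).
Local Notation L := (Lgn H g n).
Local Notation LA := (LgnAlg H g n).
Local Notation LF := (@Lfam K H g n).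
Local Notation W := (rmat H * tswap (rmat H)).
Local Notation CV := (convAlg H LA).
Implicit Types I J : hmod H.

Hypothesis hH : factorizable H.

(** Surjectivity of phi -> (phi ⊗ id)(R R'), combined with the spanning property of the regular
    module, as an induction principle. *)
Lemma contract_onto (P : H -> Prop) : P 0 ->
  (forall c x y, P x -> P y -> P (c *: x + y)) ->
  (forall p q, P (contract W (mxcoef (I := hmod_reg H) p q))) -> forall h, P h.
Proof.
move=> P0 PD Pm h; case: hH => Dinv _ KD.
have <- : contract W (Dinv h) = h := KD h.
elim/dual_ind: (Dinv h) => [|c phi psi e e'|p q] //.
  by have -> : contract W 0 = 0; first
    by have := contract_linear W (-1) 0 0; rewrite scaler0 addr0 scaleN1r addNr.
by rewrite contract_linear; apply: PD.
Qed.

Variables (mu : H -> LA) (hmu : alg_morph mu).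
Hypothesis muC : forall I, contract_mx mu W I = Cmx g n I.

Definition theta J (h : H) : mat_alg LA (hdim J) :=
  convol (fun h => (mu h)%:M : mat_alg LA (hdim J)) (fun h => emx LA (J h)) h.

Lemma theta_linear J : linear (theta J : H -> pzmod (mat_alg LA (hdim J))).
Proof. by move=> c x y; rewrite /theta /convol linearP; apply: pairing_linear. Qed.

Lemma theta_leg2 I J h :
  convol (rho3 mu I J) (rho2 LA I J) h = leg2 (hdim I) (theta J h).
Proof.
rewrite [RHS](tlift_lin (@leg2 LA _ _ : pzmod (mat_alg LA _) -> pzmod (mat_alg LA _)));
  last exact: leg2_linear.
apply: (@tlift_eq K H H (pzmod (mat_alg LA _))) => a b.
by rewrite [RHS]leg2M leg2_scalar.
Qed.

Lemma pairing_leg2_entry I J (F : H -> 'M[LA]_(hdim J)) X i j k l :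
  linear (F : H -> pzmod (mat_alg LA (hdim J))) ->
  (pairing (rho1 LA I J) (fun h => leg2 _ (F h) : mat_alg LA _) X
    : 'M[LA]_(hdim I * hdim J)) (mxtens_index (i, k)) (mxtens_index (j, l))
  = F (contract X (mxcoef i j)) k l.
Proof.
move=> hF; rewrite tlift_mat_entry.
have hF' : linear (fun h => F h k l : pzmod LA).
  by move=> c x y; rewrite hF mat_alg_entry_linear.
rewrite [RHS](tlift_lin (fun h => F h k l : pzmod LA)) //.
apply: (@tlift_eq K H H (pzmod LA)) => a b.
by rewrite [LHS]leg12E mxE mxcoefE (linear_scale _ _ hF').
Qed.

(** By [contract_convol] the reflection equation for C says that U_2 commutes with R R' whose second
    leg acts by [theta]. Its entries on the regular module give the claim for a spanning set of
    h. *)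
Lemma theta_comm J s h :
  theta J h *m gmx LF s J = gmx LF s J *m theta J h.
Proof.
pose I := hmod_reg H; pose M := mat_alg LA (hdim I * hdim J).
pose u2 : M := leg2 (hdim I) (gmx LF s J).
have hw := @contract_convol _ _ _ _ hmu I J.
have cw : u2 * pairing (rho1 LA I J) (convol (rho3 mu I J) (rho2 LA I J)) W
    = pairing (rho1 LA I J) (convol (rho3 mu I J) (rho2 LA I J)) W * u2.
  by rewrite hw muC; apply: C_reflect.
pose F1 h := theta J h *m gmx LF s J; pose F2 h := gmx LF s J *m theta J h.
have l1 : linear (F1 : H -> pzmod (mat_alg LA _)).
  move=> c x y; rewrite /F1 theta_linear.
  by rewrite [LHS](mulrDl (_ : mat_alg LA (hdim J))) -pzscaleAl.
have l2 : linear (F2 : H -> pzmod (mat_alg LA _)).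
  move=> c x y; rewrite /F2 theta_linear.
  by rewrite [LHS](mulrDr (_ : mat_alg LA (hdim J))) -pzscaleAr.
have e1 : pairing (rho1 LA I J) (convol (rho3 mu I J) (rho2 LA I J)) W * u2
    = pairing (rho1 LA I J) (fun h => leg2 _ (F1 h) : M) W.
  rewrite /pairing (tlift_lin (fun x : pzmod M => (x : M) * u2 : pzmod M)); last first.
    by move=> c x y; rewrite [LHS]mulrDl -pzscaleAl.
  apply: (@tlift_eq K H H (pzmod M)) => a b; rewrite theta_leg2 -mulrA.
  by congr (_ * _); rewrite /F1 [RHS]leg2M.
have e2 : u2 * pairing (rho1 LA I J) (convol (rho3 mu I J) (rho2 LA I J)) W
    = pairing (rho1 LA I J) (fun h => leg2 _ (F2 h) : M) W.
  rewrite /pairing (tlift_lin (fun x : pzmod M => u2 * (x : M) : pzmod M)); last first.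
    by move=> c x y; rewrite [LHS]mulrDr -pzscaleAr.
  apply: (@tlift_eq K H H (pzmod M)) => a b; rewrite theta_leg2 mulrA.
  have -> : u2 * rho1 LA I J a = rho1 LA I J a * u2 by apply/esym; apply: leg_emx_comm.
  by rewrite -mulrA; congr (_ * _); rewrite /F2 [RHS]leg2M.
rewrite -/(F1 h) -/(F2 h).
elim/contract_onto: h => [|c x y ex ey|p q].
- by have := l1 (-1) 0 0; rewrite scaler0 addr0 scaleN1r addNr => ->;
    have := l2 (-1) 0 0; rewrite scaler0 addr0 scaleN1r addNr => ->.
- by rewrite l1 l2 ex ey.
apply/matrixP => k l; rewrite -(pairing_leg2_entry _ _ _ _ _ l1).
by rewrite -(pairing_leg2_entry _ _ _ _ _ l2) -e1 -e2 cw.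
Qed.

Definition muhat : CV := cmk (mu : H -> pzmod LA).
Definition delta : {rmorphism L -> CV} := Llift (coact_rel (Lfam_rel H g n)).

Lemma muhatE h : cev muhat h = mu h.
Proof. by rewrite cmkE //; apply: am_linear. Qed.

Lemma ccst_in c : ccst H (pzalg_in LA c) = pzalg_in CV c.
Proof. by apply: cev_ext => h; rewrite ccstE. Qed.

Lemma muhat_theta J i j h :
  cev (muhat * Tmx LA (J : H -> 'M[K]_(hdim J)) i j) h
    = (theta J h : 'M[LA]_(hdim J)) i j.
Proof.
rewrite cevM [RHS]tlift_mat_entry; apply: (@tlift_eq K H H (pzmod LA)) => a b.
rewrite muhatE TmxE; last exact: hact_linear.
transitivity (((mu a)%:M *m emx LA (J b)) i j); last by [].
by rewrite mul_scalar_mx !mxE.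
Qed.

(** In the convolution algebra the action on a generator is T U T^{-1} and [theta] is [muhat] T.
    Since [muhat] T commutes with U, the factors T cancel. *)
Lemma muhat_gen s J :
  muhat%:M *m gmx (coact LF) s J = map_mx (ccst H (E := LA)) (gmx LF s J) *m muhat%:M
    :> 'M[CV]_(hdim J).
Proof.
rewrite gmx_coact; set T := Tmx _ _; set TS := Tmx _ _; set U := map_mx _ _.
have key (N : 'M[CV]_(hdim J)) :
    (forall i j h, cev (N i j) h = (theta J h : 'M[LA]_(hdim J)) i j) ->
    N *m U = U *m N.
  move=> hN; apply/matrixP => i j; apply: cev_ext => h.
  transitivity (((theta J h : 'M[LA]_(hdim J)) *m gmx LF s J) i j).
    rewrite mxE cev_sum mxE; apply: eq_bigr => k _.
    by rewrite [U _ _]mxE ccst_mulr hN.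
  rewrite [LHS](congr1 (fun A : 'M[LA]_(hdim J) => A i j) (theta_comm J s h)).
  rewrite [in RHS]mxE cev_sum mxE; apply: eq_bigr => k _.
  by rewrite [U _ _]mxE ccst_mull hN.
have mTU : muhat%:M *m T *m U = U *m (muhat%:M *m T).
  apply: key => i j h; rewrite mul_scalar_mx mxE; exact: muhat_theta.
have conj_shift (P : pzRingType) (m t u t' : P) :
    m * t * u = u * (m * t) -> t * t' = 1 -> m * (t * u * t') = u * m.
  by move=> e e'; rewrite !mulrA e -!mulrA e' mulr1.
exact: (@conj_shift 'M[CV]_(hdim J) _ _ _ _ mTU (T_TS LA J)).
Qed.

Lemma muhat_delta (x : LA) : muhat * delta x = ccst H x * muhat.
Proof.
have Cc c : muhat * delta (pzalg_in LA c) = ccst H (pzalg_in LA c) * muhat.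
  by rewrite Llift_in ccst_in; apply/esym/(@pzalg_central K CV).
have CD (y z : LA) : muhat * delta y = ccst H y * muhat ->
    muhat * delta z = ccst H z * muhat ->
    muhat * delta (y + z) = ccst H (y + z) * muhat.
  by move=> e e'; rewrite !rmorphD mulrDr mulrDl e e'.
have CM (y z : LA) : muhat * delta y = ccst H y * muhat ->
    muhat * delta z = ccst H z * muhat ->
    muhat * delta (y * z) = ccst H (y * z) * muhat.
  by move=> e e'; rewrite !rmorphM mulrA e -[LHS]mulrA e' mulrA.
elim/(@Lgn_ind K H g n): x => // s phi.
elim/dual_ind: phi => [|c phi psi e e'|p q].
- by rewrite linear0 -(rmorph0 (pzalg_in LA)).
- by rewrite linearP; apply: (CD) => //; apply: (CM).
have /matrixP/(_ p q) := muhat_gen s (hmod_reg H).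
rewrite mul_scalar_mx mxE mulmx_scalarE !mxE => <-.
by rewrite Llift_gen.
Qed.

Lemma muhat_linv : exists nu : CV, nu * muhat = 1.
Proof.
have muSlin : linear (fun h => mu (antipode H h) : pzmod LA).
  by move=> c x y; rewrite linearP (am_linear hmu).
exists (cmk (fun h => mu (antipode H h) : pzmod LA)).
apply: cev_ext => h; rewrite cevM [RHS]cinE rmorph1.
transitivity (mu (\sw_(a, b <- coprod H h) (antipode H a * b)) : pzmod LA).
  rewrite (tlift_lin (mu : H -> pzmod LA)); last exact: am_linear.
  apply: (@tlift_eq K H H (pzmod LA)) => a b.
  by rewrite muhatE cmkE // (am_mul hmu).
by rewrite antipodel (linear_scale _ _ (am_linear hmu)) (am_one hmu).
Qed.

Lemma invariant_delta (x : L) : Linvariant x <-> delta x = ccst H (x : LA).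
Proof.
split=> [xI|dx h].
  by apply: cev_ext => h; rewrite ccstE; apply: xI.
by rewrite /Lact -/delta dx ccstE.
Qed.

Lemma invariant_iff_comm_moment (x : L) :
  Linvariant x <-> forall h, mu h * x = x * mu h.
Proof.
rewrite invariant_delta; split=> [dx h|xmu].
  have := congr1 (fun f : CV => cev f h) (muhat_delta x).
  by rewrite dx ccst_mulr ccst_mull muhatE.
have [nu num] := muhat_linv.
have cx : muhat * ccst H (x : LA) = ccst H (x : LA) * muhat.
  by apply: cev_ext => h; rewrite ccst_mulr ccst_mull muhatE xmu.
(* Both [delta x] and [ccst H x] become [ccst H x * muhat] when multiplied on the left by [muhat],
   which is left cancellable. *)
by rewrite -[LHS]mul1r -num -mulrA muhat_delta -cx mulrA num mul1r.
Qed.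

Lemma invariant_iff_comm_C (x : L) : Linvariant x <->
  forall I, map_mx (fun c : L => c * x) (Cmx g n I)
    = map_mx (fun c : L => x * c) (Cmx g n I).
Proof.
rewrite invariant_iff_comm_moment; split=> [xmu I|xC].
  by apply/matrixP => i j; rewrite -muC !mxE xmu.
apply: contract_onto => [|c h h' e e'|p q].
- by rewrite (_ : mu 0 = 0) ?mul0r ?mulr0 //;
    have := am_linear hmu (-1) 0 0; rewrite scaler0 addr0 scaleN1r addNr.
- rewrite (am_linear hmu) [LHS]mulrDl [RHS]mulrDr e'; congr (_ + _).
  rewrite !pzscaleE -mulrA e !mulrA; congr (_ * _).
  exact: (@pzalg_central _ LA).
by have /matrixP/(_ p q) := xC (hmod_reg H); rewrite -muC !mxE.
Qed.

End Centralizer.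

(** * The subalgebra of invariants and its action on Inv(V) *)

Section Invariants.
Variables (K : fieldType) (H : ribbonHopf K) (g n : nat).
Local Notation L := (Lgn H g n).
Local Notation LA := (LgnAlg H g n).

Lemma Linv_delta (x : L) :
  (x \in Linv H g n) <-> Llift (coact_rel (Lfam_rel H g n)) x = ccst H (x : LA).
Proof. by rewrite -invariant_delta; split=> [/asboolP|/asboolP]. Qed.

(** The invariants are the equalizer of two ring morphisms into the convolution algebra, the
    coaction and x -> (h -> ε(h) x). *)
Lemma Linv_subring : GRing.subring_closed (Linv H g n).
Proof.
split=> [|x y|x y]; rewrite !Linv_delta.
- by rewrite !rmorph1.
- by move=> ex ey; rewrite !rmorphB ex ey.
- by move=> ex ey; rewrite !rmorphM ex ey.
Qed.

Lemma Linv_const c : pzalg_in LA c \in Linv H g n.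
Proof. by apply/Linv_delta; rewrite Llift_in ccst_in. Qed.

Lemma InvP (V : lmodType L) (w : V) : reflect (forall (I : hmod H) i j,
  Cmx g n I i j *: w = (1%:M : 'M[L]_(hdim I)) i j *: w) (w \in Inv V).
Proof.
apply: (iffP (asboolP _)) => [wI I i j|wI I].
  by have /matrixP/(_ i j) := wI I; rewrite !mxE.
by apply/matrixP => i j; rewrite mxE wI !mxE.
Qed.

Lemma Inv_zmod (V : lmodType L) : GRing.zmod_closed (Inv V).
Proof.
split=> [|v w /InvP ev /InvP ew]; apply/InvP => I i j.
  by rewrite !scaler0.
by rewrite !scalerBr ev ew.
Qed.

End Invariants.

Theorem invariant_iff_comm_C_and_Inv (K : fieldType) (H : ribbonHopf K)
    (hH : factorizable H) (g n : nat) :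
  (forall x : Lgn H g n,
     Linvariant x <->
     forall I : hmod H,
       map_mx (fun c => c * x) (Cmx g n I) = map_mx (fun c => x * c) (Cmx g n I))
  /\
  (forall V : lmodType (Lgn H g n),
     [/\ GRing.subring_closed (Linv H g n),
         (forall c : K, pzalg_in (LgnAlg H g n) c \in Linv H g n),
         GRing.zmod_closed (Inv V)
       & forall (x : Lgn H g n) (w : V),
           x \in Linv H g n -> w \in Inv V -> x *: w \in Inv V]).
Proof.
have [mu [hmu muC]] := moment_map g n hH.
have inv x := invariant_iff_comm_C hH hmu muC x.
split=> // V; split.
- exact: Linv_subring.
- exact: Linv_const.
- exact: Inv_zmod.
move=> x w /asboolP/inv xC /InvP wI; apply/InvP => I i j.
(* An entry of C passes through x and acts on [w] as a Kronecker delta, which commutes with x. *)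
have /matrixP/(_ i j) := xC I; rewrite [LHS]mxE [RHS]mxE => e.
rewrite [LHS]scalerA e -[LHS]scalerA wI mxE !scalerA.
by case: (i == j); rewrite ?mulr1n ?mulr0n ?mul1r ?mulr1 ?mul0r ?mulr0.
Qed.

Theorem theorem4p6 (R : realType) (H : ribbonHopf R[i])
    (hH : factorizable H) (g n : nat) :
  (forall x : Lgn H g n,
     Linvariant x <->
     forall I : hmod H,
       map_mx (fun c => c * x) (Cmx g n I) = map_mx (fun c => x * c) (Cmx g n I))
  /\
  (forall V : lmodType (Lgn H g n),
     [/\ GRing.subring_closed (Linv H g n),
         (forall c : R[i], pzalg_in (LgnAlg H g n) c \in Linv H g n),
         GRing.zmod_closed (Inv V)
       & forall (x : Lgn H g n) (w : V),
           x \in Linv H g n -> w \in Inv V -> x *: w \in Inv V]).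
Proof. exact: invariant_iff_comm_C_and_Inv. Qed.
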